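(* Let $r_c>0$, let $k\ge 1$ be an integer, put $r_m=\frac{r_c}{k+1}$, and let $\lambda>0$ with $\lambda\neq r_m$. Let $c:\mathbb{R}\to\mathbb{R}^3$ be the single-wrapped epitrochoid $c(t)=(x(t),y(t),0)$ with $$x(t)=(r_c+r_m)\cos t-\lambda\cos\left(\frac{r_c+r_m}{r_m}\,t\right),\qquad y(t)=(r_c+r_m)\sin t-\lambda\sin\left(\frac{r_c+r_m}{r_m}\,t\right).$$ Then no complete minimal immersion in $\mathbb{R}^3$ has $c$ as a geodesic. That is, there do not exist a connected Riemann surface $M$ (without boundary), a complete conformal minimal immersion $f:M\to\mathbb{R}^3$, and a smooth curve $\gamma:\mathbb{R}\to M$ such that $f\circ\gamma=c$ and $\gamma$ is, up to reparametrization, a geodesic of $M$ for the metric induced by $f$.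
   Context: An epitrochoid is the planar curve $c(t)=(x(t),y(t),0)$ with $x(t)=(r_c+r_m)\cos t-\lambda\cos\left(\frac{r_c+r_m}{r_m}t\right)$ and $y(t)=(r_c+r_m)\sin t-\lambda\sin\left(\frac{r_c+r_m}{r_m}t\right)$, where $r_c>0$ is the radius of a fixed circle, $r_m>0$ is the radius of a circle rolling around the outside of the fixed circle, and $\lambda>0$ is the distance between the center of the rolling circle and the tracing point. The condition $\lambda\neq r_m$ ensures that $c$ is a regular curve, i.e. $x'(t)^2+y'(t)^2>0$ for all $t$. After normalizing $r_c=1$ (by scaling), an epitrochoid is called single-wrapped if there is an integer $k\geq 1$ with $r_m=1/(k+1)$; for general $r_c$ this means $r_m=r_c/(k+1)$. A minimal immersion $f:M\to\mathbb{R}^3$ is a smooth immersion (no branch points) with identically zero mean curvature; it is complete if the induced Riemannian metric on $M$ is complete. It need not be injective. The curve $\gamma$ being a geodesic up to reparametrization means that, for every $t$, the tangential component of $c''(t)=(f\circ\gamma)''(t)$ in $df(T_{\gamma(t)}M)$ is a multiple of $c'(t)$ (equivalently, the arc-length reparametrization of $\gamma$ is a geodesic of the induced metric). *)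

(* Defs.v *)
From HB Require Import structures.
From mathcomp Require Export all_boot all_order all_algebra.
From mathcomp Require Export all_classical all_reals all_analysis.
From mathcomp.real_closed Require Export complex.

Set Implicit Arguments.
Unset Strict Implicit.
Unset Printing Implicit Defensive.

Export Order.TTheory GRing.Theory Num.Theory.
Export numFieldNormedType.Exports.

Global Open Scope classical_set_scope.
Global Open Scope ring_scope.
Global Open Scope complex_scope.

(* R[i] packed as a numClosedFieldType: it then carries the topology of the
   modulus and is a normed module over itself, so that [derivable h z 1] is
   complex differentiability. *)
Definition Cx (R : realType) : numClosedFieldType := R[i].

Definition Cx_of_pair (R : realType) (x : R * R) : Cx R := x.1 +i* x.2.

Definition pair_of_Cx (R : realType) (z : Cx R) : R * R :=
  (complex.Re z, complex.Im z).

Definition holomorphic_on (R : realType) (D : set (Cx R)) (h : Cx R -> Cx R) :=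
  forall z, D z -> derivable h z 1.

(* All (iterated) directional derivatives up to order n exist and are
   continuous. For D open and V finite-dimensional, the only case used below,
   this is the usual class C^n. *)
Fixpoint Cn (R : realType) (V W : normedModType R) (n : nat)
    (D : set V) (f : V -> W) : Prop :=
  (forall x, D x -> {for x, continuous f}) /\
  (if n is m.+1 then
     forall v, (forall x, D x -> derivable f x v) /\ Cn m D ('D_v f)
   else True).

Section EuclideanSpace.
Variable R : realType.

Definition dot (u v : 'rV[R]_3) : R := (u *m v^T) 0 0.

(* The library norm on 'rV[R]_3 is the sup norm. *)
Definition enorm (u : 'rV[R]_3) : R := Num.sqrt (dot u u).

(* The indices k + 1 and k + 2 are taken modulo 3. *)
Definition cross (u v : 'rV[R]_3) : 'rV[R]_3 :=
  \row_(k < 3) (u 0 (k + 1) * v 0 (k + 2) - u 0 (k + 2) * v 0 (k + 1)).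

Variable X : R * R -> 'rV[R]_3.

Definition partial_u : R * R -> 'rV[R]_3 := 'D_(1, 0) X.
Definition partial_v : R * R -> 'rV[R]_3 := 'D_(0, 1) X.

Definition unit_normal (x : R * R) : 'rV[R]_3 :=
  let n := cross (partial_u x) (partial_v x) in (enorm n)^-1 *: n.

Definition mean_curvature (x : R * R) : R :=
  let E := dot (partial_u x) (partial_u x) in
  let F := dot (partial_u x) (partial_v x) in
  let G := dot (partial_v x) (partial_v x) in
  let L := dot ('D_(1, 0) partial_u x) (unit_normal x) in
  let M := dot ('D_(0, 1) partial_u x) (unit_normal x) in
  let N := dot ('D_(0, 1) partial_v x) (unit_normal x) in
  (L * G - 2 * M * F + N * E) / (2 * (E * G - F ^+ 2)).

End EuclideanSpace.

(* chart_map and chart_inv are total functions; their values outside chart_dom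
   and its image are irrelevant. *)
Record chart (R : realType) (M : topologicalType) := Chart {
  chart_dom : set M;
  chart_map : M -> Cx R;
  chart_inv : Cx R -> M;
  chart_dom_open : open chart_dom;
  chart_im_open : open (chart_map @` chart_dom);
  chart_mapK : forall p, chart_dom p -> chart_inv (chart_map p) = p;
  chart_map_continuous :
    forall p, chart_dom p -> {for p, continuous chart_map};
  chart_inv_continuous :
    forall z, (chart_map @` chart_dom) z -> {for z, continuous chart_inv}
}.

Record riemannSurface (R : realType) := RiemannSurface {
  rs_space :> topologicalType;
  atlas : set (chart R rs_space);
  rs_hausdorff : hausdorff_space rs_space;
  rs_connected : connected [set: rs_space];
  atlas_cover : forall p : rs_space, exists2 e, atlas e & chart_dom e p;
  atlas_holomorphic : forall e1 e2, atlas e1 -> atlas e2 ->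
    holomorphic_on (chart_map e1 @` (chart_dom e1 `&` chart_dom e2))
                   (chart_map e2 \o chart_inv e1)
}.

Section MapsAndCurves.
Variables (R : realType) (M : riemannSurface R).

Definition coord_dom (e : chart R M) : set (R * R) :=
  [set x | (chart_map e @` chart_dom e) (Cx_of_pair x)].

Definition coords (e : chart R M) (p : M) : R * R :=
  pair_of_Cx (chart_map e p).

(* f read in the real coordinates (u, v) of the chart z = u + iv *)
Definition in_chart (f : M -> 'rV[R]_3) (e : chart R M) (x : R * R) :
    'rV[R]_3 :=
  f (chart_inv e (Cx_of_pair x)).

Definition curve_Cn (n : nat) (I : set R) (s : R -> M) :=
  (forall t, I t -> {for t, continuous s}) /\
  (forall e, atlas e -> Cn n (I `&` s @^-1` chart_dom e) (coords e \o s)).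

Definition smooth_curve (s : R -> M) := forall n, curve_Cn n [set: R] s.

Variable f : M -> 'rV[R]_3.

Definition smooth_map :=
  forall e, atlas e -> forall n, Cn n (coord_dom e) (in_chart f e).

Definition immersion :=
  forall e, atlas e -> forall x, coord_dom e x ->
    forall v, 'D_v (in_chart f e) x = 0 -> v = 0.

Definition conformal :=
  forall e, atlas e -> forall x, coord_dom e x ->
    let fu := partial_u (in_chart f e) x in
    let fv := partial_v (in_chart f e) x in
    dot fu fu = dot fv fv /\ dot fu fv = 0.

Definition minimal :=
  forall e, atlas e -> forall x, coord_dom e x ->
    mean_curvature (in_chart f e) x = 0.

(* For the metric induced by f, the norm of the velocity of s is the Euclidean
   norm of the velocity of f \o s. *)
Definition arc_length (s : R -> M) (a b : R) : \bar R :=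
  (\int[lebesgue_measure]_(t in `[a, b]) (enorm (derive1 (f \o s) t))%:E)%E.

(* [pwC1_path p q l]: there is a piecewise C^1 curve of length l from p to q,
   given as a finite chain of C^1 arcs. *)
Inductive pwC1_path : M -> M -> \bar R -> Prop :=
| pwC1_nil p : pwC1_path p p 0%E
| pwC1_cons (s : R -> M) (a b : R) (I : set R) (q : M) (l : \bar R) :
    a <= b -> open I -> `[a, b] `<=` I -> curve_Cn 1 I s ->
    pwC1_path (s b) q l -> pwC1_path (s a) q (arc_length s a b + l)%E.

Definition induced_dist (p q : M) : \bar R :=
  ereal_inf [set l | pwC1_path p q l].

Definition complete_immersion :=
  forall u : nat -> M,
    (forall eps : R, 0 < eps -> exists N, forall m n, (N <= m)%N -> (N <= n)%N ->
       (induced_dist (u m) (u n) < eps%:E)%E) ->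
    exists p : M, forall eps : R, 0 < eps -> exists N, forall n, (N <= n)%N ->
      (induced_dist (u n) p < eps%:E)%E.

Definition tangent_plane (p : M) : set 'rV[R]_3 :=
  [set w | exists e v, [/\ atlas e, chart_dom e p &
                         w = 'D_v (in_chart f e) (coords e p)]].

(* w is the orthogonal projection of a onto df(T_p M). *)
Definition tangential_component (p : M) (a w : 'rV[R]_3) :=
  tangent_plane p w /\ (forall w', tangent_plane p w' -> dot (a - w) w' = 0).

Definition geodesic_up_to_reparam (gamma : R -> M) :=
  forall t, exists mu : R,
    tangential_component (gamma t) (derive1n 2 (f \o gamma) t)
                         (mu *: derive1 (f \o gamma) t).

End MapsAndCurves.

Definition epitrochoid (R : realType) (rc rm lambda : R) (t : R) : 'rV[R]_3 :=
  \row_(j < 3)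
    [:: (rc + rm) * cos t - lambda * cos ((rc + rm) / rm * t);
        (rc + rm) * sin t - lambda * sin ((rc + rm) / rm * t);
        0]`_j.

(* Main.v *)
(* Write n = k + 2 and r = r_m, so that x + iy = P and x - iy = Q along the curve,
   where P(t) = n r e^{it} - lambda e^{int} and Q(t) = n r e^{-it} - lambda e^{-int}
   are entire in t. In a conformal chart the complex gradients phi_j of the
   coordinates are holomorphic and phi_1^2 + phi_2^2 + phi_3^2 = 0, that is
   A B = - phi_3^2 for A = phi_1 + i phi_2 and B = phi_1 - i phi_2. Along a planar
   geodesic with nonzero curvature the conormal is vertical, hence A dw = dP and
   B dw = dQ: near the curve, a holomorphic function zeta on the surface satisfies
   P'(zeta) zeta' = A and Q'(zeta) zeta' = B. Moving zeta along a segment of complex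
   times traces a path of finite length on the surface, so by completeness the
   relation continues along every segment without zeros of Q'. The segment from
   t = pi / (k + 1) to t = i ln(lambda / r) / (k + 1) is one; at its end P' has a
   simple zero, whereas phi_3^2 = - P'(zeta) Q'(zeta) zeta'^2 has only zeros of even
   order. The hypothesis lambda <> r is what keeps the zeros of P' and Q' apart. *)
Require Import Defs.
From mathcomp Require Import ring lra.

Set Implicit Arguments.
Unset Strict Implicit.
Unset Printing Implicit Defensive.

(** * Complex and real differentiability *)

(** Why [Q], and not [P], parametrizes: with [shift = ln (lambda / r) / (k + 1)], the zeros of [Q']
    lie on [Im z = - shift] and those of [P'] on [Im z = shift]. A segment from the real axis to
    [i shift] never meets the former line, whatever the sign of [shift], so [Q] stays locally
    invertible in time, and continuing the surface amounts to solving [Q (zeta) = FB + constant]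
    with [FB] a primitive of [B]. The start is an outermost point because the curvature is positive
    there for every [lambda], while elsewhere it may vanish or change sign. Continuation need not be
    unique, since [f] may fail to be injective and [M] to be simply connected. Times are therefore
    tied to points of [M] by a relation, and completeness is exploited through a maximality argument
    on pairs of a time and a point. Power series and contour integrals are avoided: each holomorphic
    function comes with a derivative that is again differentiable, and the identity theorem is drawn
    from the maximum principle, itself a second derivative test. *)

Section Modulus.
Variable R : realType.
Implicit Types x y z : Cx R.

Definition cabs (z : Cx R) : R := ComplexField.Normc.normc z.

(** In the final theorem the same name is a bound variable, the radius of the fixed circle. *)
Definition rc (a : R) : Cx R := a%:C.
Definition ci : Cx R := 'i.

Lemma cabsE z : cabs z = Num.sqrt (complex.Re z ^+ 2 + complex.Im z ^+ 2).
Proof. by case: z. Qed.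

Lemma normCxE z : `|z| = rc (cabs z).
Proof. by case: z. Qed.

Lemma cabs_ge0 z : 0 <= cabs z.
Proof. by rewrite cabsE sqrtr_ge0. Qed.

Lemma cabs_eq0 z : (cabs z == 0) = (z == 0).
Proof.
apply/eqP/eqP => [/ComplexField.Normc.eq0_normc //|->].
exact: ComplexField.Normc.normc0.
Qed.

Lemma cabs_gt0 z : (0 < cabs z) = (z != 0).
Proof. by rewrite lt0r cabs_eq0 cabs_ge0 andbT. Qed.

Lemma cabs0 : cabs 0 = 0. Proof. by apply/eqP; rewrite cabs_eq0. Qed.

Lemma cabs1 : cabs 1 = 1. Proof. exact: ComplexField.Normc.normc1. Qed.

Lemma cabsM x y : cabs (x * y) = cabs x * cabs y.
Proof. exact: ComplexField.Normc.normcM. Qed.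

Lemma cabsV x : cabs x^-1 = (cabs x)^-1.
Proof. exact: ComplexField.Normc.normcV. Qed.

Lemma cabsN x : cabs (- x) = cabs x.
Proof. exact: complex.normcN. Qed.

Lemma cabsX x n : cabs (x ^+ n) = cabs x ^+ n.
Proof. by elim: n => [|n IH]; rewrite ?expr0 ?cabs1// !exprS cabsM IH. Qed.

Lemma cabsD x y : cabs (x + y) <= cabs x + cabs y.
Proof. exact: complex.le_normcD. Qed.

Lemma cabsBC x y : cabs (x - y) = cabs (y - x).
Proof. by rewrite -opprB cabsN. Qed.

Lemma cabsB_le x y z : cabs (x - z) <= cabs (x - y) + cabs (y - z).
Proof. by rewrite -[x - z](subrKA y); exact: cabsD. Qed.

Lemma cabs_sub_ge x y : cabs x - cabs y <= cabs (x - y).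
Proof. by have := cabsD (x - y) y; rewrite subrK; lra. Qed.

Lemma cabs_rc (a : R) : cabs (rc a) = `|a|.
Proof. by rewrite cabsE /= expr0n addr0 sqrtr_sqr. Qed.

Lemma cabs_ci : cabs ci = 1.
Proof. by rewrite cabsE /= expr0n add0r expr1n sqrtr1. Qed.

Lemma sqr_cabs z : cabs z ^+ 2 = complex.Re z ^+ 2 + complex.Im z ^+ 2.
Proof. by rewrite cabsE sqr_sqrtr// addr_ge0 ?sqr_ge0. Qed.

Lemma mul_conjc z : z * z^*%C = rc (cabs z ^+ 2).
Proof. by rewrite sqr_cabs; apply/eqP; rewrite eq_complex; case: z => a b /=; apply/andP; split; apply/eqP; ring. Qed.

Lemma cabsJ z : cabs z^*%C = cabs z.
Proof. by rewrite !cabsE; case: z => a b /=; rewrite sqrrN. Qed.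

Lemma Re_le_cabs z : `|complex.Re z| <= cabs z.
Proof. by rewrite cabsE -sqrtr_sqr ler_wsqrtr// lerDl sqr_ge0. Qed.

Lemma Im_le_cabs z : `|complex.Im z| <= cabs z.
Proof. by rewrite cabsE -sqrtr_sqr ler_wsqrtr// lerDr sqr_ge0. Qed.

Lemma CxE z : z = rc (complex.Re z) + ci * rc (complex.Im z).
Proof. by apply/eqP; rewrite eq_complex /=; apply/andP; split; apply/eqP; simpc. Qed.

Lemma cabs_le_ReIm z : cabs z <= `|complex.Re z| + `|complex.Im z|.
Proof.
by rewrite {1}[z]CxE; apply: (le_trans (cabsD _ _)); rewrite cabsM cabs_ci mul1r !cabs_rc.
Qed.

Lemma ReD x y : complex.Re (x + y) = complex.Re x + complex.Re y.
Proof. by case: x; case: y. Qed.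
Lemma ImD x y : complex.Im (x + y) = complex.Im x + complex.Im y.
Proof. by case: x; case: y. Qed.
Lemma ReN x : complex.Re (- x) = - complex.Re x. Proof. by case: x. Qed.
Lemma ImN x : complex.Im (- x) = - complex.Im x. Proof. by case: x. Qed.
Lemma ReM x y : complex.Re (x * y) = complex.Re x * complex.Re y - complex.Im x * complex.Im y.
Proof. by case: x; case: y. Qed.
Lemma ImM x y : complex.Im (x * y) = complex.Re x * complex.Im y + complex.Im x * complex.Re y.
Proof. by case: x; case: y. Qed.
Lemma Re_ci : complex.Re ci = 0. Proof. by []. Qed.
Lemma Im_ci : complex.Im ci = 1. Proof. by []. Qed.
Lemma Re_rc (a : R) : complex.Re (rc a) = a. Proof. by []. Qed.
Lemma Im_rc (a : R) : complex.Im (rc a) = 0. Proof. by []. Qed.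
Definition ReImE := (ReD, ImD, ReN, ImN, ReM, ImM, Re_ci, Im_ci, Re_rc, Im_rc).

Lemma Cx_eq x y : complex.Re x = complex.Re y -> complex.Im x = complex.Im y -> x = y.
Proof. by case: x y => [a b] [c d] /= -> ->. Qed.

Lemma rcD (a b : R) : rc (a + b) = rc a + rc b.
Proof. by apply: Cx_eq; rewrite !ReImE ?addr0. Qed.
Lemma rcN (a : R) : rc (- a) = - rc a.
Proof. by apply: Cx_eq; rewrite !ReImE ?oppr0. Qed.
Lemma rcB (a b : R) : rc (a - b) = rc a - rc b.
Proof. by rewrite rcD rcN. Qed.
Lemma rcM (a b : R) : rc (a * b) = rc a * rc b.
Proof. by apply: Cx_eq; rewrite !ReImE; ring. Qed.
Lemma rc0 : rc 0 = 0. Proof. by []. Qed.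
Lemma rc1 : rc 1 = 1. Proof. by []. Qed.
Lemma rc_inj : injective rc. Proof. by move=> a b []. Qed.
Lemma ci_sqr : ci * ci = -1.
Proof. by apply: Cx_eq; rewrite !ReImE /=; ring. Qed.
Lemma ci_neq0 : ci != 0.
Proof. by rewrite -cabs_eq0 cabs_ci oner_eq0. Qed.

(** Balls of [Cx R] have radii in [R[i]]; a positive element of [R[i]] is real, so real radii give
    the same filter. *)
Lemma nbhs_cabsP z (A : set (Cx R)) :
  nbhs z A <-> exists2 d, 0 < d & forall y, cabs (y - z) < d -> A y.
Proof.
split.
  move/nbhs_ballP => [e /= e0 he]; exists (complex.Re e).
    by move: e0; rewrite ltcE /= => /andP[].
  move=> y yz; apply: he; rewrite -ball_normE /= normCxE cabsBC.
  move: e0; rewrite ltcE /= => /andP[/eqP e0 _].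
  by rewrite ltcE /= -e0 eqxx.
move=> [d d0 hd]; apply/nbhs_ballP; exists (rc d); first by rewrite /= ltcR.
by move=> y; rewrite -ball_normE /= normCxE ltcR cabsBC; exact: hd.
Qed.

Lemma near_and (T : topologicalType) (x : T) (P Q : T -> Prop) :
  (\forall y \near x, P y) -> (\forall y \near x, Q y) ->
  \forall y \near x, P y /\ Q y.
Proof. exact: filterI. Qed.

Lemma near_cabs z (d : R) : 0 < d -> \forall y \near z, cabs (y - z) < d.
Proof. by move=> d0; apply/nbhs_cabsP; exists d. Qed.

End Modulus.
Notation Re := complex.Re.
Notation Im := complex.Im.
#[global] Hint Resolve cabs_ge0 : core.

Section Derivatives.
Variable R : realType.
Implicit Types (x y z l m : Cx R) (g h : Cx R -> Cx R) (u v : R -> Cx R).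

(** A first-order expansion without quotient: the point [y = z] needs no exclusion, and the
    derivative is an explicit value with which the chain rules compute. *)
Definition cderiv h z l := forall e : R, 0 < e ->
  \forall y \near z, cabs (h y - h z - l * (y - z)) <= e * cabs (y - z).

(* [l] is the gradient of [f] packed as d_x f - i d_y f. *)
Definition cgrad (f : Cx R -> R) z l := forall e : R, 0 < e ->
  \forall y \near z, `|f y - f z - Re (l * (y - z))| <= e * cabs (y - z).

Definition vderiv u (t : R) l := forall e : R, 0 < e ->
  \forall s \near t, cabs (u s - u t - l * rc (s - t)) <= e * `|s - t|.

Lemma cderiv_lip h z l : cderiv h z l ->
  \forall y \near z, cabs (h y - h z) <= (cabs l + 1) * cabs (y - z).
Proof.
move=> /(_ 1 ltr01); apply: filterS => y; rewrite mul1r => H.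
have -> : h y - h z = (h y - h z - l * (y - z)) + l * (y - z) by ring.
by apply: (le_trans (cabsD _ _)); rewrite cabsM mulrDl mul1r addrC lerD2l.
Qed.

Lemma vderiv_lip u t l : vderiv u t l ->
  \forall s \near t, cabs (u s - u t) <= (cabs l + 1) * `|s - t|.
Proof.
move=> /(_ 1 ltr01); apply: filterS => s; rewrite mul1r => H.
have -> : u s - u t = (u s - u t - l * rc (s - t)) + l * rc (s - t) by ring.
by apply: (le_trans (cabsD _ _)); rewrite cabsM cabs_rc mulrDl mul1r addrC lerD2l.
Qed.

Lemma nearR_dist (t d : R) : 0 < d -> \forall s \near t, `|s - t| < d.
Proof. by move=> d0; apply/nbhs_ballP; exists d => // s; rewrite /= /ball /= distrC. Qed.

Lemma cvg_cabsP (T : Type) (F : set_system T) (FF : Filter F) (h : T -> Cx R) l :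
  (forall e : R, 0 < e -> \forall y \near F, cabs (h y - l) < e) <-> h @ F --> l.
Proof.
split=> H; last first.
  by move=> e e0; apply: (H [set y | cabs (y - l) < e]); exact: near_cabs.
move=> A /nbhs_cabsP [d d0 hd]; rewrite /nbhs /=.
by apply: filterS (H d d0) => y /hd.
Qed.

Lemma continuous_cabsP (T : topologicalType) (x : T) (h : T -> Cx R) :
  (forall e : R, 0 < e -> \forall y \near x, cabs (h y - h x) < e) <->
  {for x, continuous h}.
Proof. exact: (@cvg_cabsP _ (nbhs x)). Qed.

Lemma cderiv_continuous h z l : cderiv h z l -> {for z, continuous h}.
Proof.
move=> H; apply/continuous_cabsP => e e0.
have l1 : 0 < cabs l + 1 by have := cabs_ge0 l; lra.
near=> y.
have h1 : cabs (h y - h z) <= (cabs l + 1) * cabs (y - z).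
  by near: y; exact: cderiv_lip.
apply: (le_lt_trans h1).
rewrite mulrC -ltr_pdivlMr//.
by near: y; apply: near_cabs; rewrite divr_gt0.
Unshelve. all: by end_near. Qed.

Lemma vderiv_continuous u t l : vderiv u t l -> {for t, continuous u}.
Proof.
move=> H; apply/continuous_cabsP => e e0.
have l1 : 0 < cabs l + 1 by have := cabs_ge0 l; lra.
near=> y.
have h1 : cabs (u y - u t) <= (cabs l + 1) * `|y - t|.
  by near: y; exact: vderiv_lip.
apply: (le_lt_trans h1).
rewrite mulrC -ltr_pdivlMr//.
by near: y; apply: nearR_dist; rewrite divr_gt0.
Unshelve. all: by end_near. Qed.

Lemma cgrad_lip f z l : cgrad f z l ->
  \forall y \near z, `|f y - f z| <= (cabs l + 1) * cabs (y - z).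
Proof.
move=> /(_ 1 ltr01); apply: filterS => y; rewrite mul1r => H.
have -> : f y - f z = (f y - f z - Re (l * (y - z))) + Re (l * (y - z)) by ring.
apply: (le_trans (ler_normD _ _)); rewrite mulrDl mul1r addrC lerD//.
by rewrite -cabsM Re_le_cabs.
Qed.

Lemma cgrad_continuous f z l : cgrad f z l -> {for z, continuous f}.
Proof.
move=> H; apply/(@cvgrPdist_lt _ _ _ (nbhs z)) => e e0.
have l1 : 0 < cabs l + 1 by have := cabs_ge0 l; lra.
near=> y.
have h1 : `|f y - f z| <= (cabs l + 1) * cabs (y - z).
  by near: y; exact: cgrad_lip.
rewrite distrC; apply: (le_lt_trans h1).
rewrite mulrC -ltr_pdivlMr//.
by near: y; apply: near_cabs; rewrite divr_gt0.
Unshelve. all: by end_near. Qed.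

(* The common estimate behind the chain rules. *)
Lemma chain_estimate (a m d q l D n e : R) :
  0 <= e -> e <= 1 -> 0 <= n ->
  a <= d + m * q -> d <= (e / (l + m + 2)) * D ->
  q <= (e / (l + m + 2)) * n -> D <= (l + 1) * n -> 0 <= l -> 0 <= m -> a <= e * n.
Proof.
move=> e0 e1 n0 ha hd hq hD l0 m0.
have s0 : 0 < l + m + 2 by lra.
set c := e / (l + m + 2) in hd hq.
have c0 : 0 <= c by rewrite divr_ge0// ltW.
have E : e = c * (l + m + 2) by rewrite /c divfK// gt_eqF.
have h1 : c * D <= c * ((l + 1) * n) by rewrite ler_wpM2l.
have h2 : m * q <= m * (c * n) by rewrite ler_wpM2l.
have cn : 0 <= c * n by rewrite mulr_ge0.
by rewrite E; nra.
Qed.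

Lemma near_small (T : Type) (F : set_system T) (FF : Filter F) (X N : T -> R) :
  (forall e, 0 < e -> e <= 1 -> \forall a \near F, X a <= e * N a) ->
  (forall a : T, 0 <= N a) ->
  forall e, 0 < e -> \forall a \near F, X a <= e * N a.
Proof.
move=> H N0 e e0; have m0 : 0 < Num.min e 1 by rewrite lt_min e0 ltr01.
have m1 : Num.min e 1 <= 1 by rewrite ge_min lexx orbT.
apply: filterS (H _ m0 m1) => y Hy; apply: (le_trans Hy).
by rewrite ler_wpM2r// ge_min lexx.
Qed.

Lemma cderiv_comp g h z l m :
  cderiv g z l -> cderiv h (g z) m -> cderiv (h \o g) z (m * l).
Proof.
move=> Hg Hh; apply: (@near_small _ (nbhs z) _) => // e e0 e1.
have s0 : 0 < e / (cabs l + cabs m + 2).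
  by rewrite divr_gt0//; have := cabs_ge0 l; have := cabs_ge0 m; lra.
near=> y.
have h1 : cabs (h (g y) - h (g z) - m * (g y - g z)) <= e / (cabs l + cabs m + 2) * cabs (g y - g z).
  by near: y; exact: (cderiv_continuous Hg) (Hh _ s0).
have h2 : cabs (g y - g z - l * (y - z)) <= e / (cabs l + cabs m + 2) * cabs (y - z).
  by near: y; exact: Hg.
apply: (chain_estimate (ltW e0) e1 _ _ h1 h2 (near (cderiv_lip Hg) y _)) => //=.
rewrite -cabsM; apply: le_trans (cabsD _ _).
by rewrite le_eqVlt; apply/orP; left; apply/eqP; congr cabs; ring.
Unshelve. all: by end_near. Qed.

Lemma cgrad_comp f h z l m :
  cderiv h z l -> cgrad f (h z) m -> cgrad (f \o h) z (m * l).
Proof.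
move=> Hg Hh; apply: (@near_small _ (nbhs z) _) => // e e0 e1.
have s0 : 0 < e / (cabs l + cabs m + 2).
  by rewrite divr_gt0//; have := cabs_ge0 l; have := cabs_ge0 m; lra.
near=> y.
have h1 : `|f (h y) - f (h z) - Re (m * (h y - h z))| <= e / (cabs l + cabs m + 2) * cabs (h y - h z).
  by near: y; exact: (cderiv_continuous Hg) (Hh _ s0).
have h2 : cabs (h y - h z - l * (y - z)) <= e / (cabs l + cabs m + 2) * cabs (y - z).
  by near: y; exact: Hg.
apply: (chain_estimate (ltW e0) e1 _ _ h1 h2 (near (cderiv_lip Hg) y _)) => //=.
rewrite -cabsM; apply: le_trans (lerD (lexx _) (Re_le_cabs _)).
apply: le_trans (ler_normD _ _).
rewrite le_eqVlt; apply/orP; left; apply/eqP; congr `|_|.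
have -> : m * l * (y - z) = m * (h y - h z) - m * (h y - h z - l * (y - z)) by ring.
by rewrite ReD ReN; ring.
Unshelve. all: by end_near. Qed.

Lemma vderiv_comp h u t l m :
  vderiv u t l -> cderiv h (u t) m -> vderiv (h \o u) t (m * l).
Proof.
move=> Hg Hh; apply: (@near_small _ (nbhs t) _) => // e e0 e1.
have s0 : 0 < e / (cabs l + cabs m + 2).
  by rewrite divr_gt0//; have := cabs_ge0 l; have := cabs_ge0 m; lra.
near=> y.
have h1 : cabs (h (u y) - h (u t) - m * (u y - u t)) <= e / (cabs l + cabs m + 2) * cabs (u y - u t).
  by near: y; exact: (vderiv_continuous Hg) (Hh _ s0).
have h2 : cabs (u y - u t - l * rc (y - t)) <= e / (cabs l + cabs m + 2) * `|y - t|.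
  by near: y; exact: Hg.
apply: (chain_estimate (ltW e0) e1 _ _ h1 h2 (near (vderiv_lip Hg) y _)) => //=.
rewrite -cabsM; apply: le_trans (cabsD _ _).
by rewrite le_eqVlt; apply/orP; left; apply/eqP; congr cabs; ring.
Unshelve. all: by end_near. Qed.

Lemma is_deriveP (f : R -> R) (t l : R) :
  (forall e, 0 < e -> \forall s \near t, `|f s - f t - l * (s - t)| <= e * `|s - t|) <->
  is_derive t 1 f l.
Proof.
split=> [H|[dfl <-] e e0].
  have cv : (fun k : R => k^-1 *: (f (k *: 1 + t) - f t)) @ 0^' --> l.
    apply/cvgrPdist_le => e e0.
    have /nbhs_ballP[d /= d0 hd] := H e e0.
    apply/nbhs_ballP; exists d => // k /=; rewrite /ball /= sub0r normrN => hd' h0.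
    have := hd (k + t); rewrite /ball /= opprD addrCA subrr addr0 normrN => /(_ hd').
    rewrite addrK [k *: 1]mulr1 distrC => H'.
    have hn : 0 < `|k| by rewrite normr_gt0.
    rewrite -(ler_pM2r hn) -normrM mulrBl /GRing.scale /= mulrAC mulVf// mul1r.
    by [].
  by split; [apply: cvgP cv | apply: cvg_lim cv].
have /cvgrPdist_le /(_ e e0) /nbhs_ballP[d /= d0 hd] := dfl.
apply/nbhs_ballP; exists d => // s; rewrite /ball /= distrC => sd.
have [->|st] := eqVneq s t; first by rewrite !subrr mulr0 subr0 normr0 mulr0.
have h0 : s - t != 0 by rewrite subr_eq0.
have := hd (s - t); rewrite /ball /= sub0r normrN => /(_ sd h0).
have hn : 0 < `|s - t| by rewrite normr_gt0.
rewrite -(ler_pM2r hn) -normrM mulrBl /GRing.scale /= [_ * 1]mulr1 subrK mulrAC mulVf// mul1r.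
rewrite /derive /= /GRing.scale /=.
set L := lim _; move=> H; rewrite -normrN; apply: le_trans H.
by rewrite opprB.
Qed.

Lemma is_derive_comp_cgrad f u t l m :
  vderiv u t l -> cgrad f (u t) m -> is_derive t 1 (f \o u) (Re (m * l)).
Proof.
move=> Hg Hh; apply/is_deriveP; apply: (@near_small _ (nbhs t) _) => // e e0 e1.
have s0 : 0 < e / (cabs l + cabs m + 2).
  by rewrite divr_gt0//; have := cabs_ge0 l; have := cabs_ge0 m; lra.
near=> y.
have h1 : `|f (u y) - f (u t) - Re (m * (u y - u t))| <= e / (cabs l + cabs m + 2) * cabs (u y - u t).
  by near: y; exact: (vderiv_continuous Hg) (Hh _ s0).
have h2 : cabs (u y - u t - l * rc (y - t)) <= e / (cabs l + cabs m + 2) * `|y - t|.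
  by near: y; exact: Hg.
apply: (chain_estimate (ltW e0) e1 _ _ h1 h2 (near (vderiv_lip Hg) y _)) => //=.
rewrite -cabsM; apply: le_trans (lerD (lexx _) (Re_le_cabs _)).
apply: le_trans (ler_normD _ _).
rewrite le_eqVlt; apply/orP; left; apply/eqP; congr `|_|.
have -> : Re (m * l) * (y - t) = Re (m * (u y - u t)) - Re (m * (u y - u t - l * rc (y - t))).
  rewrite -ReN -ReD; have -> : m * (u y - u t) - m * (u y - u t - l * rc (y - t)) = m * l * rc (y - t) by ring.
  by rewrite [Re (_ * rc _)]ReM Im_rc Re_rc; ring.
by ring.
Unshelve. all: by end_near. Qed.

Lemma cderiv_eq h z l m : cderiv h z l -> l = m -> cderiv h z m.
Proof. by move=> H <-. Qed.

Lemma cderiv_near h g z l : cderiv h z l -> (\forall y \near z, h y = g y) -> cderiv g z l.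
Proof.
move=> H E e e0; have Ez := nbhs_singleton E.
by apply: filterS2 E (H e e0) => y; rewrite Ez => <-.
Qed.

Lemma cgrad_near (f g : Cx R -> R) z l : cgrad f z l -> (\forall y \near z, f y = g y) -> cgrad g z l.
Proof.
move=> H E e e0; have Ez := nbhs_singleton E.
by apply: filterS2 E (H e e0) => y; rewrite Ez => <-.
Qed.

Lemma cderiv_cst c z : cderiv (fun=> c) z 0.
Proof.
move=> e e0; apply: (@nearW _ (nbhs z)) => y.
by rewrite subrr mul0r subr0 cabs0 mulr_ge0 ?cabs_ge0 ?ltW.
Qed.

Lemma cderiv_id z : cderiv id z 1.
Proof.
move=> e e0; apply: (@nearW _ (nbhs z)) => y.
by rewrite mul1r subrr cabs0 mulr_ge0 ?cabs_ge0 ?ltW.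
Qed.

Lemma cderivD g h z l m : cderiv g z l -> cderiv h z m -> cderiv (fun y => g y + h y) z (l + m).
Proof.
move=> Hg Hh e e0; have e20 : 0 < e / 2 by lra.
apply: filterS2 (Hg _ e20) (Hh _ e20) => y H1 H2.
have -> : g y + h y - (g z + h z) - (l + m) * (y - z) =
  (g y - g z - l * (y - z)) + (h y - h z - m * (y - z)) by ring.
apply: (le_trans (cabsD _ _)); lra.
Qed.

Lemma cderivM g h z l m : cderiv g z l -> cderiv h z m ->
  cderiv (fun y => g y * h y) z (l * h z + g z * m).
Proof.
move=> Hg Hh e e0.
set s := cabs (h z) + cabs (g z) + (cabs l + 1) * (cabs m + 1) + 1.
have s0 : 0 < s.
  by rewrite /s ltr_wpDl// ?ltr01// !addr_ge0// ?cabs_ge0// mulr_ge0// addr_ge0// ?cabs_ge0//.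
have es0 : 0 < e / s by rewrite divr_gt0.
near=> y.
have h1 : cabs (g y - g z - l * (y - z)) <= e / s * cabs (y - z) by near: y; exact: Hg.
have h2 : cabs (h y - h z - m * (y - z)) <= e / s * cabs (y - z) by near: y; exact: Hh.
have h3 : cabs (g y - g z) <= (cabs l + 1) * cabs (y - z) by near: y; exact: cderiv_lip.
have h4 : cabs (h y - h z) <= (cabs m + 1) * cabs (y - z) by near: y; exact: cderiv_lip.
have h5 : cabs (y - z) < e / s by near: y; exact: near_cabs.
have -> : g y * h y - g z * h z - (l * h z + g z * m) * (y - z) =
  (g y - g z - l * (y - z)) * h z + (g z * (h y - h z - m * (y - z)) + (g y - g z) * (h y - h z)) by ring.
apply: (le_trans (cabsD _ _)); apply: (le_trans (lerD (lexx _) (cabsD _ _))).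
rewrite !cabsM.
have H1 := ler_wpM2r (cabs_ge0 (h z)) h1.
have H2 := ler_wpM2l (cabs_ge0 (g z)) h2.
have H3 := ler_pM (cabs_ge0 _) (cabs_ge0 _) h3 h4.
have H4 : (cabs l + 1) * cabs (y - z) * ((cabs m + 1) * cabs (y - z)) <=
   (cabs l + 1) * (cabs m + 1) * (e / s) * cabs (y - z).
  rewrite (_ : _ * _ = (cabs l + 1) * (cabs m + 1) * cabs (y - z) * cabs (y - z)); last by ring.
  rewrite ler_wpM2r ?cabs_ge0//; apply: ler_wpM2l; last exact: ltW.
  by rewrite mulr_ge0// addr_ge0// ?cabs_ge0.
have -> : e * cabs (y - z) = s * (e / s) * cabs (y - z) by rewrite mulrC [s * _]mulrC divfK ?gt_eqF// mulrC.
have := mulr_ge0 (ltW es0) (cabs_ge0 (y - z)).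
rewrite /s in H1 H2 H3 H4 *; nra.
Unshelve. all: by end_near. Qed.

Lemma cderivZ c h z l : cderiv h z l -> cderiv (fun y => c * h y) z (c * l).
Proof. by move=> H; apply: cderiv_eq (cderivM (cderiv_cst c z) H) _; rewrite mul0r add0r. Qed.

Lemma cderivN h z l : cderiv h z l -> cderiv (fun y => - h y) z (- l).
Proof.
move=> H; have := cderivZ (-1) H; rewrite mulN1r.
by under eq_fun do rewrite mulN1r.
Qed.

Lemma cderivB g h z l m : cderiv g z l -> cderiv h z m -> cderiv (fun y => g y - h y) z (l - m).
Proof. by move=> Hg Hh; exact: cderivD Hg (cderivN Hh). Qed.

Lemma cderivX h z l n : cderiv h z l ->
  cderiv (fun y => h y ^+ n) z (n%:R * l * h z ^+ n.-1).
Proof.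
move=> H; elim: n => [|n IH].
  by rewrite !mul0r; under eq_fun do rewrite expr0; exact: cderiv_cst.
under eq_fun do rewrite exprS; apply: cderiv_eq (cderivM H IH) _.
by case: n {IH} => [|n] /=; rewrite ?expr0 -?[in RHS]natr1 ?exprS; ring.
Qed.

Lemma cderivV_id z : z != 0 -> cderiv (fun y => y^-1) z (- (z ^+ 2)^-1).
Proof.
move=> z0 e e0; have cz : 0 < cabs z by rewrite cabs_gt0.
(* The first bound keeps [cabs y] above [cabs z / 2]; with the second, the exact remainder
   [(y - z) ^ 2 / (y * z ^ 2)] is at most [e * cabs (y - z)] in modulus. *)
set d := Num.min (cabs z / 2) (e * (cabs z ^+ 3) / 2).
have d0 : 0 < d by rewrite lt_min !divr_gt0// mulr_gt0// exprn_gt0.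
apply: filterS (near_cabs z d0) => y; rewrite lt_min => /andP[y1 y2].
have cy : cabs z / 2 <= cabs y.
  by have := cabs_sub_ge z y; rewrite cabsBC; lra.
have y0 : y != 0 by rewrite -cabs_gt0; lra.
have -> : y^-1 - z^-1 - - (z ^+ 2)^-1 * (y - z) = (y - z) * (y - z) / (y * z ^+ 2).
  by field; rewrite y0 z0.
rewrite [cabs (_ / _)]cabsM [cabs ((y - z) * _)]cabsM cabsV [cabs (y * _)]cabsM cabsX.
rewrite -mulrA [_ * (cabs (y - z) / _)]mulrCA mulrA -[leLHS]mulrA mulrC ler_wpM2r ?cabs_ge0//.
rewrite ler_pdivrMr; last by rewrite mulr_gt0 ?exprn_gt0//; lra.
apply: (le_trans (ltW y2)).
rewrite -mulrA ler_pM2l//; have := ler_wpM2r (exprn_ge0 2 (ltW cz)) cy.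
by apply: le_trans; rewrite exprS mulrAC.
Qed.

Lemma cderivV h z l : h z != 0 -> cderiv h z l ->
  cderiv (fun y => (h y)^-1) z (- (h z ^+ 2)^-1 * l).
Proof. by move=> h0 H; exact: cderiv_comp H (cderivV_id h0). Qed.

Lemma cderiv_unique h z l m : cderiv h z l -> cderiv h z m -> l = m.
Proof.
move=> Hl Hm; apply/eqP; rewrite -subr_eq0 -cabs_eq0; apply/eqP/le_anti.
rewrite cabs_ge0 andbT; apply/ler_addgt0Pr => e e0; rewrite add0r.
have e20 : 0 < e / 2 by lra.
have /nbhs_cabsP [d d0 hd] := near_and (Hl _ e20) (Hm _ e20).
have := hd (z + rc (d / 2)); rewrite addrAC subrr add0r cabs_rc.
have -> : `|d / 2| = d / 2 by rewrite ger0_norm//; lra.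
move=> /(_ _)[|H1 H2]; first by lra.
set w := h _ - h _ in H1 H2.
have E : (l - m) * rc (d / 2) = (w - m * rc (d / 2)) - (w - l * rc (d / 2)) by ring.
have : cabs ((l - m) * rc (d / 2)) <= e * (d / 2).
  by rewrite E; apply: (le_trans (cabsD _ _)); rewrite cabsN; lra.
rewrite cabsM cabs_rc ger0_norm; last by lra.
by rewrite ler_pM2r//; lra.
Qed.

(** Tested in the direction conjugate to [l - m], where the real part of the product attains the
    full modulus. *)
Lemma cgrad_unique f z l m : cgrad f z l -> cgrad f z m -> l = m.
Proof.
move=> Hl Hm; apply/eqP; rewrite -subr_eq0 -cabs_eq0; apply/eqP/le_anti.
rewrite cabs_ge0 andbT; apply/ler_addgt0Pr => e e0; rewrite add0r.
have e20 : 0 < e / 2 by lra.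
have /nbhs_cabsP [d d0 hd] := near_and (Hl _ e20) (Hm _ e20).
have [->|lm] := eqVneq (l - m) 0; first by rewrite cabs0 ltW.
set c := l - m; have c0 : 0 < cabs c by rewrite cabs_gt0.
pose w : Cx R := rc (d / 2 / cabs c) * c^*%C.
have cw : cabs w = d / 2.
  have -> : cabs w = cabs (rc (d / 2 / cabs c)) * cabs c.
    by rewrite /w cabsM; congr (_ * _); exact: cabsJ.
  by rewrite cabs_rc ger0_norm ?divfK ?gt_eqF//; rewrite divr_ge0// ?ltW//; lra.
have := hd (z + w); rewrite addrAC subrr add0r cw.
move=> /(_ _)[|H1 H2]; first by lra.
have E : Re (c * w) = cabs c * (d / 2).
  have -> : c * w = rc (d / 2 / cabs c) * rc (cabs c ^+ 2).
    rewrite /w mulrCA; congr (_ * _).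
    exact: mul_conjc.
  by rewrite -rcM Re_rc; field; rewrite gt_eqF.
have : `|Re (c * w)| <= e * (d / 2).
  rewrite /c mulrBl ReD ReN.
  set X := f _ - f _ in H1 H2; rewrite (_ : _ - _ = (X - Re (m * w)) - (X - Re (l * w))); last by ring.
  by apply: (le_trans (ler_normB _ _)); lra.
rewrite E ger0_norm; last by rewrite mulr_ge0 ?cabs_ge0//; lra.
by rewrite ler_pM2r//; lra.
Qed.

(** The Cauchy-Riemann equations, in the packing of [cgrad]. *)
Lemma cderivP h z l :
  cgrad (fun y => Re (h y)) z l -> cgrad (fun y => Im (h y)) z (- ci R * l) -> cderiv h z l.
Proof.
move=> H1 H2 e e0; have e20 : 0 < e / 2 by lra.
apply: filterS2 (H1 _ e20) (H2 _ e20) => y h1 h2.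
apply: (le_trans (cabs_le_ReIm _)).
have -> : e * cabs (y - z) = e / 2 * cabs (y - z) + e / 2 * cabs (y - z) by field.
apply: lerD.
  by apply: le_trans h1; rewrite !ReD !ReN.
apply: le_trans h2; rewrite !ImD !ImN -mulrA [Re (- ci R * _)]ReM ReN ImN Re_ci Im_ci.
by rewrite oppr0 mul0r sub0r mulN1r opprK.
Qed.

Lemma cgrad_Re h z l : cderiv h z l -> cgrad (fun y => Re (h y)) z l.
Proof.
move=> H e e0; apply: filterS (H e e0) => y; apply: le_trans.
by rewrite -!ReN -!ReD; exact: Re_le_cabs.
Qed.

Lemma cgrad_Im h z l : cderiv h z l -> cgrad (fun y => Im (h y)) z (- ci R * l).
Proof.
move=> H; have := cgrad_Re (cderivZ (- ci R) H).
under eq_fun do rewrite ReM ReN ImN Re_ci Im_ci oppr0 mul0r sub0r mulN1r opprK.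
by [].
Qed.

Lemma vderiv_rc (t : R) : vderiv (@rc R) t 1.
Proof. by move=> e e0; apply: (@nearW _ (nbhs t)) => s; rewrite -rcB mul1r subrr cabs0 mulr_ge0// ltW. Qed.

Lemma vderiv_line (x v : Cx R) t : vderiv (fun s => x + rc s * v) t v.
Proof.
have H : cderiv (fun y => x + y * v) (rc t) v.
  apply: cderiv_eq (cderivD (cderiv_cst _ _) (cderivM (cderiv_id _) (cderiv_cst _ _))) _.
  by rewrite mulr0 add0r addr0 mul1r.
by have := vderiv_comp (vderiv_rc t) H; rewrite mulr1.
Qed.

Lemma vderiv_near u w t l : vderiv u t l -> (\forall s \near t, u s = w s) -> vderiv w t l.
Proof.
move=> H E e e0; have Ez := nbhs_singleton E.
by apply: filterS2 E (H e e0) => y; rewrite Ez => <-.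
Qed.

Lemma vderiv_Re u t l : vderiv u t l -> is_derive t 1 (fun s : R => Re (u s)) (Re l).
Proof.
move=> H; have := is_derive_comp_cgrad H (cgrad_Re (cderiv_id (u t))).
by rewrite mul1r.
Qed.

Lemma vderiv_Im u t l : vderiv u t l -> is_derive t 1 (fun s : R => Im (u s)) (Im l).
Proof.
move=> H; have := is_derive_comp_cgrad H (cgrad_Im (cderiv_id (u t))).
by rewrite mulr1 ReM ReN ImN Re_ci Im_ci oppr0 mul0r sub0r mulN1r opprK.
Qed.

Lemma vderivP (u : R -> Cx R) (t : R) l : is_derive t 1 (fun s : R => Re (u s)) (Re l) ->
  is_derive t 1 (fun s : R => Im (u s)) (Im l) -> vderiv u t l.
Proof.
move=> /is_deriveP H1 /is_deriveP H2 e e0; have e20 : 0 < e / 2 by lra.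
apply: filterS2 (H1 _ e20) (H2 _ e20) => y h1 h2.
apply: (le_trans (cabs_le_ReIm _)).
have -> : e * `|y - t| = e / 2 * `|y - t| + e / 2 * `|y - t| by field.
apply: lerD.
  by apply: le_trans h1; rewrite !ReD !ReN ReM Im_rc Re_rc mulr0 subr0.
by apply: le_trans h2; rewrite !ImD !ImN ImM Im_rc Re_rc mulr0 add0r.
Qed.

End Derivatives.

(** * Mean value inequality and maximum principle *)

Section OneVariable.
Variable R : realType.
Implicit Types (u : R -> Cx R) (h : Cx R -> Cx R).

Lemma is_derive_continuous (f : R -> R) (t l : R) : is_derive t 1 f l -> {for t, continuous f}.
Proof. by move=> [H _]; apply/differentiable_continuous/derivable1_diffP. Qed.

Lemma within_continuous (f : R -> R) (a b : R) :
  (forall s, a <= s <= b -> {for s, continuous f}) -> {within `[a, b], continuous f}.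
Proof.
move=> H; apply: continuous_in_subspaceT => s; rewrite inE /= in_itv /=; exact: H.
Qed.

Lemma mean_value (f df : R -> R) (a b : R) : a < b ->
  (forall s, a <= s <= b -> is_derive s 1 f (df s)) ->
  exists2 c, a < c < b & f b - f a = df c * (b - a).
Proof.
move=> ab H; have [s|c] := @MVT R f df a b ab _ (within_continuous (fun s hs => is_derive_continuous (H s hs))).
  by rewrite in_itv /= => /andP[h1 h2]; apply: H; rewrite !ltW.
by rewrite in_itv /= => hc E; exists c.
Qed.

(** The mean value theorem is applied to the real part of [u] times the conjugate of its total
    increment [d]; that real function grows by exactly [cabs d ^ 2]. *)
Lemma mean_value_vderiv u (l : R -> Cx R) (a b M : R) : a <= b ->
  (forall s, a <= s <= b -> vderiv u s (l s)) ->
  (forall s, a <= s <= b -> cabs (l s) <= M) ->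
  cabs (u b - u a) <= M * (b - a).
Proof.
move=> ab H HM.
set d := u b - u a; set c := d^*%C : Cx R.
have [d0|d0] := eqVneq d 0.
  rewrite d0 cabs0 mulr_ge0 ?subr_ge0//.
  by apply: le_trans (HM a _); rewrite ?lexx ?cabs_ge0.
have H2 s : a <= s <= b -> is_derive s 1 (fun s : R => Re (c * u s)) (Re (c * l s)).
  move=> hs; have := vderiv_Re (vderiv_comp (H s hs) (cderivZ c (cderiv_id (u s)))).
  by rewrite mulr1.
have ab' : a < b.
  by rewrite lt_neqAle ab andbT; apply: contra d0 => /eqP E; rewrite /d E subrr.
have [s /andP[s1 s2]] := mean_value ab' H2.
have hs : a <= s <= b by rewrite !ltW.
rewrite -ReN -ReD -mulrBr -/d [c * d]mulrC mul_conjc Re_rc => E.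
have : cabs d ^+ 2 <= cabs d * M * (b - a).
  rewrite E ler_wpM2r ?subr_ge0//; apply: (le_trans (ler_norm _)).
  apply: (le_trans (Re_le_cabs _)); rewrite cabsM cabsJ ler_wpM2l ?cabs_ge0//.
  exact: HM.
by rewrite expr2 -mulrA ler_pM2l// cabs_gt0.
Qed.

Lemma mean_value_cderiv h (l : Cx R -> Cx R) (x y : Cx R) (M : R) :
  (forall s : R, 0 <= s <= 1 -> cderiv h (x + rc s * (y - x)) (l (x + rc s * (y - x)))) ->
  (forall s : R, 0 <= s <= 1 -> cabs (l (x + rc s * (y - x))) <= M) ->
  cabs (h y - h x) <= M * cabs (y - x).
Proof.
move=> H HM.
have := @mean_value_vderiv (h \o (fun s : R => x + rc s * (y - x)))
  (fun s => l (x + rc s * (y - x)) * (y - x)) 0 1 (M * cabs (y - x)) ler01.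
rewrite /= rc0 rc1 mul0r addr0 mul1r [x + _]addrC subrK subr0 mulr1; apply=> s hs.
  exact: vderiv_comp (vderiv_line _ _ _) (H s hs).
by rewrite cabsM ler_wpM2r ?cabs_ge0// HM.
Qed.

Lemma segment_in_ball (a x y : Cx R) (r s : R) : cabs (x - a) < r -> cabs (y - a) < r ->
  0 <= s <= 1 -> cabs (x + rc s * (y - x) - a) < r.
Proof.
move=> hx hy /andP[s0 s1].
have -> : x + rc s * (y - x) - a = rc (1 - s) * (x - a) + rc s * (y - a).
  by rewrite rcB rc1; ring.
apply: (le_lt_trans (cabsD _ _)); rewrite !cabsM !cabs_rc !ger0_norm ?subr_ge0//.
have [->|sp] := eqVneq s 0; first by rewrite subr0 mul1r mul0r addr0.
have sg : 0 < s by rewrite lt0r sp.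
have h1 : (1 - s) * cabs (x - a) <= (1 - s) * r by rewrite ler_wpM2l ?subr_ge0// ltW.
have h2 : s * cabs (y - a) < s * r by rewrite ltr_pM2l.
by lra.
Qed.

Lemma mean_value_ball h (l : Cx R -> Cx R) (a x y : Cx R) (r M : R) :
  (forall w, cabs (w - a) < r -> cderiv h w (l w)) ->
  (forall w, cabs (w - a) < r -> cabs (l w) <= M) ->
  cabs (x - a) < r -> cabs (y - a) < r ->
  cabs (h y - h x) <= M * cabs (y - x).
Proof.
move=> H HM hx hy; apply: (@mean_value_cderiv h l) => s hs.
  exact/H/segment_in_ball.
exact/HM/segment_in_ball.
Qed.

Lemma cderiv0_cst h (a x y : Cx R) (r : R) :
  (forall w, cabs (w - a) < r -> cderiv h w 0) ->
  cabs (x - a) < r -> cabs (y - a) < r -> h y = h x.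
Proof.
move=> H hx hy.
have E : cabs (h y - h x) <= 0 * cabs (y - x).
  by apply: (@mean_value_ball h (fun=> 0) a x y r 0) => // *; rewrite cabs0.
rewrite mul0r in E.
by apply/eqP; rewrite -subr_eq0 -cabs_eq0; apply/eqP/le_anti; rewrite E cabs_ge0.
Qed.

Lemma is_derive_max_le0 (f : R -> R) (c d : R) : 0 < d -> is_derive (0 : R) 1 f c ->
  (forall s, 0 <= s < d -> f s <= f 0) -> c <= 0.
Proof.
move=> d0 /is_deriveP H Hm; rewrite leNgt; apply/negP => c0.
have c2 : 0 < c / 2 by lra.
have /nbhs_ballP [e /= e0 he] := H _ c2.
set s := Num.min e d / 2.
have m0 : 0 < Num.min e d by rewrite lt_min e0.
have me : Num.min e d <= e by rewrite ge_min lexx.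
have md : Num.min e d <= d by rewrite ge_min lexx orbT.
have s0 : 0 < s by rewrite /s; lra.
have hes : ball (0 : R) e s by rewrite /ball /= sub0r normrN gtr0_norm// /s; lra.
have := he s hes; rewrite subr0 [`|s|]gtr0_norm//.
rewrite ler_norml => /andP[h1 _].
have sd : 0 <= s < d by rewrite ltW//= /s; lra.
have h2 := Hm s sd.
by have := mulr_gt0 c2 s0; lra.
Qed.

(** If [c > 0], then [f1] exceeds [f1 0] just to the right of [0] and lies below it just to the
    left. Hence [f] rises to the right when [f1 0 >= 0] and to the left otherwise. *)
Lemma second_derivative_max (f f1 : R -> R) (c d : R) : 0 < d ->
  (forall s : R, `|s| < d -> is_derive s 1 f (f1 s)) -> is_derive (0 : R) 1 f1 c ->
  (forall s, `|s| < d -> f s <= f 0) -> c <= 0.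
Proof.
move=> d0 Hf /is_deriveP H Hm; rewrite leNgt; apply/negP => c0.
have c2 : 0 < c / 2 by lra.
have /nbhs_ballP [e /= e0 he] := H _ c2.
set s := Num.min e d / 2.
have m0 : 0 < Num.min e d by rewrite lt_min e0.
have me : Num.min e d <= e by rewrite ge_min lexx.
have md : Num.min e d <= d by rewrite ge_min lexx orbT.
have s0 : 0 < s by rewrite /s; lra.
have hl t : `|t| <= s -> `|f1 t - f1 0 - c * t| <= c / 2 * `|t|.
  move=> ht; have := he t; rewrite subr0; apply.
  by rewrite /ball /= sub0r normrN; apply: (le_lt_trans ht); rewrite /s; lra.
have sd : s < d by rewrite /s; lra.
have [f10|f10] := leP 0 (f1 0).
  have [t /andP[t0 ts]] : exists2 t, 0 < t < s & f s - f 0 = f1 t * (s - 0).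
    apply: mean_value => // t /andP[t0 ts]; apply: Hf.
    by rewrite ger0_norm//; exact: le_lt_trans sd.
  rewrite subr0 => E; have := hl t; rewrite gtr0_norm// ltW// => /(_ isT).
  rewrite ler_norml => /andP[h1 _].
  have ft : 0 < f1 t by have := mulr_gt0 c2 t0; lra.
  by have := mulr_gt0 ft s0; have := Hm s; rewrite gtr0_norm// => /(_ sd); lra.
have [t /andP[t0 ts]] : exists2 t, - s < t < 0 & f 0 - f (- s) = f1 t * (0 - - s).
  apply: mean_value; first by lra.
  by move=> t /andP[t0 ts]; apply: Hf; rewrite ler0_norm//; lra.
rewrite sub0r opprK => E; have tn := ltr0_norm ts; have ts' : `|t| <= s by rewrite tn; lra.
have := hl t ts'; rewrite tn.
rewrite ler_norml => /andP[_ h1].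
have t0' : 0 < - t by lra.
have ft : f1 t < 0 by have := mulr_gt0 c2 t0'; lra.
have ft' : 0 < - f1 t by lra.
have := mulr_gt0 ft' s0; have := Hm (- s); rewrite normrN gtr0_norm// => /(_ sd); lra.
Qed.

Lemma is_derive_dot u (l : R -> Cx R) (t : R) (m v : Cx R) :
  vderiv u t v -> vderiv l t m ->
  is_derive t 1 (fun s : R => Re (u s) * Re (l s) + Im (u s) * Im (l s))
    ((Re v * Re (l t) + Im v * Im (l t)) + (Re (u t) * Re m + Im (u t) * Im m)).
Proof.
move=> Hu Hl.
have := is_deriveD (is_deriveM (vderiv_Re Hu) (vderiv_Re Hl)) (is_deriveM (vderiv_Im Hu) (vderiv_Im Hl)).
by move=> H; apply: is_derive_eq H _; rewrite /GRing.scale /=; ring.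
Qed.

Lemma is_derive_sqr_cabs u (t : R) (v : Cx R) : vderiv u t v ->
  is_derive t 1 (fun s : R => cabs (u s) ^+ 2) (2 * (Re (u t) * Re v + Im (u t) * Im v)).
Proof.
move=> Hu; have H := is_derive_dot Hu Hu.
under eq_fun do rewrite sqr_cabs !expr2.
by apply: is_derive_eq H _; ring.
Qed.

End OneVariable.

(** * Rectangles and the maximum principle *)

Section Boxes.
Variable R : realType.
Implicit Types (h : Cx R -> Cx R) (w z : Cx R).

Definition box (x1 x2 y1 y2 : R) : set (Cx R) :=
  [set w | x1 <= Re w <= x2 /\ y1 <= Im w <= y2].

Definition box_edge (x1 x2 y1 y2 : R) (w : Cx R) :=
  [\/ Re w = x1, Re w = x2, Im w = y1 | Im w = y2].

Lemma Cx_of_pair_continuous : continuous (@Cx_of_pair R).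
Proof.
move=> x; apply/continuous_cabsP => e e0.
have e2 : 0 < e / 2 by lra.
apply/nbhs_ballP; exists (e / 2) => //= y [/= h1 h2].
apply: (le_lt_trans (cabs_le_ReIm (Cx_of_pair y - Cx_of_pair x))) => /=.
move: h1 h2; rewrite /ball /= => h1 h2.
by rewrite distrC [`|y.2 - _|]distrC; lra.
Qed.

Lemma continuous_cabs_comp (T : topologicalType) (x : T) (h : T -> Cx R) :
  {for x, continuous h} -> {for x, continuous (fun y => cabs (h y))}.
Proof.
move=> /continuous_cabsP H; apply/(@cvgrPdist_lt _ _ _ (nbhs x)) => e e0.
apply: filterS (H e e0) => y; apply: le_lt_trans.
by rewrite ler_norml lerNl opprB cabs_sub_ge /= cabsBC cabs_sub_ge.
Qed.

Lemma Re_continuous : continuous (fun w : Cx R => Re w).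
Proof. by move=> z; apply: (cgrad_continuous (cgrad_Re (cderiv_id z))). Qed.

Lemma Im_continuous : continuous (fun w : Cx R => Im w).
Proof. by move=> z; apply: (cgrad_continuous (cgrad_Im (cderiv_id z))). Qed.

Lemma box_max (f : Cx R -> R) (x1 x2 y1 y2 : R) : x1 <= x2 -> y1 <= y2 ->
  (forall w, box x1 x2 y1 y2 w -> {for w, continuous f}) ->
  exists2 w, box x1 x2 y1 y2 w & forall z, box x1 x2 y1 y2 z -> f z <= f w.
Proof.
move=> hx hy Hf.
pose A : set (R * R) := `[x1, x2] `*` `[y1, y2].
have AE x : A x <-> box x1 x2 y1 y2 (Cx_of_pair x).
  by rewrite /A /box /= !in_itv /=.
have [|||c cA cm] := @compact_EVT_max (R * R)%type R (f \o @Cx_of_pair R) A.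
- by exists (x1, y1); rewrite /A /= !in_itv /= !lexx hx hy.
- by apply: compact_setX; exact: segment_compact.
- apply: continuous_in_subspaceT => x; rewrite inE => /AE hxb.
  by apply: continuous_comp; [exact: Cx_of_pair_continuous | exact: Hf].
exists (Cx_of_pair c); first by apply/AE; rewrite inE in cA.
move=> z hz; have := cm (Re z, Im z); rewrite inE /= /Cx_of_pair /=.
by move=> H; case: z hz H => a b hz; apply; apply/AE.
Qed.

Lemma box_interior x1 x2 y1 y2 w : box x1 x2 y1 y2 w -> ~ box_edge x1 x2 y1 y2 w ->
  exists2 d, 0 < d & forall z, cabs (z - w) < d -> box x1 x2 y1 y2 z.
Proof.
move=> [/andP[a1 a2] /andP[b1 b2]] ne.
have {}a1 : x1 < Re w by rewrite lt_neqAle a1 andbT; apply/eqP => E; apply: ne; constructor 1.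
have {}a2 : Re w < x2 by rewrite lt_neqAle a2 andbT; apply/eqP => E; apply: ne; constructor 2.
have {}b1 : y1 < Im w by rewrite lt_neqAle b1 andbT; apply/eqP => E; apply: ne; constructor 3.
have {}b2 : Im w < y2 by rewrite lt_neqAle b2 andbT; apply/eqP => E; apply: ne; constructor 4.
exists (Num.min (Num.min (Re w - x1) (x2 - Re w)) (Num.min (Im w - y1) (y2 - Im w))).
  by rewrite !lt_min !subr_gt0 a1 a2 b1 b2.
move=> z; rewrite !lt_min => /andP[/andP[c1 c2] /andP[c3 c4]].
have := Re_le_cabs (z - w); have := Im_le_cabs (z - w).
rewrite !ReD !ImD !ReN !ImN !ler_norml => /andP[d1 d2] /andP[d3 d4].
by split; apply/andP; split; lra.
Qed.

(** The Laplacian of [cabs (h w) ^ 2] is [4 * cabs (h1 w) ^ 2]. Adding [e * (Re w - x1) ^ 2] makes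
    it positive, which excludes an interior maximum; [e] is small enough that the perturbed function
    stays below its value at [w0] on all edges. *)
Lemma maximum_principle h h1 (x1 x2 y1 y2 M : R) :
  (forall w, box x1 x2 y1 y2 w -> cderiv h w (h1 w)) ->
  (forall w, box x1 x2 y1 y2 w -> exists l, cderiv h1 w l) ->
  (forall w, box x1 x2 y1 y2 w -> box_edge x1 x2 y1 y2 w -> cabs (h w) ^+ 2 <= M) ->
  forall w, box x1 x2 y1 y2 w -> cabs (h w) ^+ 2 <= M.
Proof.
move=> H1 H2 He w0 hw0; rewrite leNgt; apply/negP => hM.
have [hx hy] : x1 <= x2 /\ y1 <= y2.
  by case: hw0 => /andP[a b] /andP[c d]; split; [exact: le_trans b | exact: le_trans d].
set L := (x2 - x1) ^+ 2 + 1.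
have L0 : 0 < L by rewrite /L ltr_wpDl// sqr_ge0.
set e := (cabs (h w0) ^+ 2 - M) / L.
have e0 : 0 < e by rewrite divr_gt0// subr_gt0.
pose g w := cabs (h w) ^+ 2 + e * (Re w - x1) ^+ 2.
have [|wm hwm gm] := @box_max g x1 x2 y1 y2 hx hy.
  move=> w hw.
  have c1 : {for w, continuous (fun z => cabs (h z))}.
    exact: continuous_cabs_comp (cderiv_continuous (H1 w hw)).
  have c2 : {for w, continuous (fun z : Cx R => Re z - x1)}.
    by apply: (@cvgB _ _ _ (nbhs w)); [exact: Re_continuous | exact: cvg_cst].
  apply: (@cvgD _ _ _ (nbhs w)); first exact: (@cvgM _ _ (nbhs w) _ _ _ _ _ c1 c1).
  apply: (@cvgM _ _ (nbhs w)); first exact: cvg_cst.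
  exact: (@cvgM _ _ (nbhs w) _ _ _ _ _ c2 c2).
have ge w : box x1 x2 y1 y2 w -> box_edge x1 x2 y1 y2 w -> g w < g w0.
  move=> hw ew; have h3 := He w hw ew.
  have h4 : (Re w - x1) ^+ 2 <= (x2 - x1) ^+ 2.
    by case: hw => /andP[a b] _; rewrite ler_pXn2r// ?nnegrE; lra.
  have h5 : e * (Re w - x1) ^+ 2 <= e * (x2 - x1) ^+ 2 by rewrite ler_pM2l.
  have h6 : cabs (h w0) ^+ 2 - M = e * L by rewrite divfK// gt_eqF.
  have h7 : 0 <= e * (Re w0 - x1) ^+ 2 by rewrite mulr_ge0 ?sqr_ge0// ltW.
  by rewrite /g /L in h6 *; lra.
have ne : ~ box_edge x1 x2 y1 y2 wm.
  by move=> ew; have := ge _ hwm ew; rewrite ltNge gm.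
have [d d0 hd] := box_interior hwm ne.
have [h2 Hh2] := H2 _ hwm.
(* Along both axes through [wm]; the two second derivatives add up to [4 |h1 wm|^2 + 2 e]. *)
have key (v : Cx R) : cabs v = 1 ->
    2 * (cabs (h1 wm * v) ^+ 2 + (Re (h wm) * Re (h2 * v * v) + Im (h wm) * Im (h2 * v * v)))
      + 2 * e * Re v ^+ 2 <= 0.
  move=> v1.
  pose p (s : R) := wm + rc s * v.
  have pd s : vderiv p s v by exact: vderiv_line.
  have p0 : p 0 = wm by rewrite /p rc0 mul0r addr0.
  have pb s : `|s| < d -> box x1 x2 y1 y2 (p s).
    by move=> hs; apply: hd; rewrite /p addrAC subrr add0r cabsM v1 mulr1 cabs_rc.
  pose f1 s := 2 * (Re (h (p s)) * Re (h1 (p s) * v) + Im (h (p s)) * Im (h1 (p s) * v))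
     + 2 * e * ((Re (p s) - x1) * Re v).
  have D1 (s : R) : `|s| < d -> is_derive s 1 (g \o p) (f1 s).
    move=> hs; have A1 := is_derive_sqr_cabs (vderiv_comp (pd s) (H1 _ (pb s hs))).
    have A2 := vderiv_Re (pd s).
    have A3 := is_deriveX 2 (is_deriveB A2 (is_derive_cst x1 s 1)).
    have A4 := is_deriveD A1 (is_deriveZ e A3).
    by apply: is_derive_eq A4 _; rewrite /f1 !fctE /GRing.scale /= expr1; ring.
  have D2 : is_derive (0 : R) 1 f1 (2 * (cabs (h1 wm * v) ^+ 2 +
      (Re (h wm) * Re (h2 * v * v) + Im (h wm) * Im (h2 * v * v))) + 2 * e * Re v ^+ 2).
    have A0 : box x1 x2 y1 y2 (p 0) by apply: pb; rewrite normr0.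
    have A1 := vderiv_comp (pd 0) (H1 _ A0).
    have Hh2' : cderiv h1 (p 0) h2 by rewrite p0.
    have A2 : vderiv (fun s => h1 (p s) * v) 0 (h2 * v * v).
      have := vderiv_comp (vderiv_comp (pd 0) Hh2') (cderivM (cderiv_id _) (cderiv_cst v _)).
      by rewrite mul1r mulr0 addr0 [v * _]mulrC.
    have A3 := vderiv_Re (pd 0).
    have A4 := is_deriveZ (2 * e * Re v) (is_deriveB A3 (is_derive_cst x1 (0 : R) 1)).
    have A5 := is_deriveD (is_deriveZ 2 (is_derive_dot A1 A2)) A4.
    have -> : f1 = 2 \*: (fun s : R => Re ((h \o p) s) * Re (h1 (p s) * v) + Im ((h \o p) s) * Im (h1 (p s) * v)) +
       (2 * e * Re v) \*: ((fun s => Re (p s)) - cst x1).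
      by apply/funext => s; rewrite /f1 !fctE /= /GRing.scale /=; ring.
    by apply: is_derive_eq A5 _; rewrite /GRing.scale /= p0 sqr_cabs; ring.
  apply: second_derivative_max d0 D1 D2 _ => s hs /=; rewrite p0.
  exact/gm/pb.
have k1 := key 1 (cabs1 R); have k2 := key (ci R) (cabs_ci R).
have E : h2 * ci R * ci R = - h2 by rewrite -mulrA ci_sqr mulrN1.
rewrite E ReN ImN cabsM cabs_ci mulr1 Re_ci in k2.
rewrite !mulr1 /= in k1; have := sqr_ge0 (cabs (h1 wm)).
by clearbody e; nra.
Qed.

End Boxes.

(** * Identity theorem, primitives and local inverses *)

Section Identity.
Variable R : realType.
Implicit Types (h : Cx R -> Cx R) (w z p : Cx R).

Lemma le0_geometric (x M q : R) : 0 <= q < 1 -> 0 <= M ->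
  (forall n, x <= M * q ^+ n) -> x <= 0.
Proof.
move=> /andP[q0 q1] M0 H.
have cv : M * q ^+ n @[n --> \oo] --> M * 0.
  by apply: cvgMr; apply: cvg_expr; rewrite ger0_norm.
rewrite mulr0 in cv.
by apply: (ler_cvg_to (cvg_cst x) cv); exact: nearW.
Qed.

(* Maximum principle for [h / (w - p)^n] with [n] large. If [p] lies in the box,
   [h] vanishes around it, so the quotient has no pole. *)
Lemma eq0_of_far_boundary h h1 p (x1 x2 y1 y2 m : R) : 0 < m ->
  (forall w, box x1 x2 y1 y2 w -> cderiv h w (h1 w)) ->
  (forall w, box x1 x2 y1 y2 w -> exists l, cderiv h1 w l) ->
  (forall w, box x1 x2 y1 y2 w -> w = p -> \forall z \near p, h z = 0 /\ h1 z = 0) ->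
  (forall w, box x1 x2 y1 y2 w -> box_edge x1 x2 y1 y2 w -> h w = 0 \/ m <= cabs (w - p)) ->
  forall w, box x1 x2 y1 y2 w -> cabs (w - p) < m -> h w = 0.
Proof.
move=> m0 H1 H2 Hp He w hw wm.
have [wp|wp] := eqVneq w p.
  by have [] := nbhs_singleton (Hp w hw wp); rewrite wp.
have [hx hy] : x1 <= x2 /\ y1 <= y2.
  by case: hw => /andP[a b] /andP[c d]; split; [exact: le_trans b | exact: le_trans d].
have [|wM hwM hM] := @box_max R (fun z => cabs (h z)) x1 x2 y1 y2 hx hy.
  by move=> z hz; apply: continuous_cabs_comp; exact: cderiv_continuous (H1 z hz).
set M := cabs (h wM) in hM.
pose q n z := ((z - p)^-1) ^+ n.
pose q1 n z := n%:R * (- (((z - p) ^+ 2)^-1)) * ((z - p)^-1) ^+ n.-1.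
have dB z : cderiv (fun y => y - p) z 1.
  by apply: cderiv_eq (cderivB (cderiv_id z) (cderiv_cst p z)) _; rewrite subr0.
have dq n z : z != p -> cderiv (q n) z (q1 n z).
  rewrite -subr_eq0 => zp; apply: cderiv_eq (cderivX n (@cderivV _ (fun y => y - p) z 1 zp (dB z))) _.
  by rewrite mulr1.
have dq1 n z : z != p -> exists l, cderiv (q1 n) z l.
  rewrite -subr_eq0 => zp; eexists; apply: cderivM.
    by apply: cderivZ; apply: cderivN; apply: (@cderivV _ (fun y => (y - p) ^+ 2) z _ _ (cderivX 2 (dB z))); rewrite expf_neq0.
  by apply: cderivX; exact: (@cderivV _ (fun y => y - p) z 1 zp (dB z)).
(* On an edge the quotient [g] is zero or at most [M / m ^ n] in modulus; at [w] this becomes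
   geometric decay because [cabs (w - p) < m]. *)
have key n : cabs (h w) <= M * (cabs (w - p) / m) ^+ n.
  pose g z := h z * q n z.
  pose g1 z := h1 z * q n z + h z * q1 n z.
  have bd z : box x1 x2 y1 y2 z -> box_edge x1 x2 y1 y2 z -> cabs (g z) ^+ 2 <= (M / m ^+ n) ^+ 2.
    move=> hz ez; have Mm : 0 <= M / m ^+ n by rewrite divr_ge0 ?cabs_ge0// exprn_ge0// ltW.
    rewrite ler_pXn2r ?nnegrE ?cabs_ge0//.
    case: (He z hz ez) => [hz0|hz0]; first by rewrite /g hz0 mul0r cabs0.
    rewrite /g /q cabsM cabsX cabsV exprVn ler_pM ?cabs_ge0 ?invr_ge0 ?exprn_ge0 ?cabs_ge0 ?hM//.
    have cz : 0 < cabs (z - p) by exact: lt_le_trans hz0.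
    by rewrite lef_pV2 ?posrE ?exprn_gt0// lerXn2r ?nnegrE ?cabs_ge0// ltW.
  have zero z (f : Cx R -> Cx R) : (\forall y \near z, f y = 0) -> cderiv f z 0.
    by move=> f0; apply: cderiv_near (cderiv_cst 0 z) _; apply: filterS f0 => y ->.
  have := @maximum_principle R g g1 x1 x2 y1 y2 ((M / m ^+ n) ^+ 2) _ _ bd w hw.
  have Dg z : box x1 x2 y1 y2 z -> cderiv g z (g1 z).
    move=> hz; have [zp|zp] := eqVneq z p; last exact: cderivM (H1 z hz) (dq n z zp).
    have h0 := Hp z hz zp; rewrite -zp in h0; have [e1 e2] := nbhs_singleton h0.
    apply: cderiv_eq (zero z g _) _; last by rewrite /g1 e1 e2 !mul0r addr0.
    by apply: filterS h0 => y [y0 _]; rewrite /g y0 mul0r.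
  have Dg1 z : box x1 x2 y1 y2 z -> exists l, cderiv g1 z l.
    move=> hz; have [zp|zp] := eqVneq z p.
      have h0 := Hp z hz zp; rewrite -zp in h0; exists 0; apply: zero.
      by apply: filterS h0 => y [e1 e2]; rewrite /g1 e1 e2 !mul0r addr0.
    have [l Hl] := H2 z hz; have [l' Hl'] := dq1 n z zp.
    eexists; exact: cderivD (cderivM Hl (dq n z zp)) (cderivM (H1 z hz) Hl').
  move=> /(_ Dg Dg1); rewrite ler_pXn2r ?nnegrE ?cabs_ge0//; last first.
    by rewrite divr_ge0 ?cabs_ge0// exprn_ge0// ltW.
  rewrite /g /q cabsM cabsX cabsV exprVn => gw.
  have wp0 : 0 < cabs (w - p) ^+ n by rewrite exprn_gt0// cabs_gt0 subr_eq0.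
  by move: gw; rewrite ler_pdivrMr// => /le_trans; apply; rewrite expr_div_n mulrAC mulrA.
apply/eqP; rewrite -cabs_eq0 eq_le cabs_ge0 andbT.
apply: (le0_geometric _ (cabs_ge0 _) key).
by rewrite divr_ge0 ?cabs_ge0 ?ltW//= ltr_pdivrMr// mul1r.
Qed.

(** The pole is placed at the centre [a]: all edges of the square of half-side [r] are at distance
    at least [r]. The corners of the square are at distance [sqrt 2 * r], whence the radius [2 * r]
    in the hypotheses. *)
Lemma identity_ball h h1 (a : Cx R) (r : R) : 0 < r ->
  (forall w, cabs (w - a) < 2 * r -> cderiv h w (h1 w)) ->
  (forall w, cabs (w - a) < 2 * r -> exists l, cderiv h1 w l) ->
  (\forall w \near a, h w = 0) ->
  forall w, cabs (w - a) < r -> h w = 0.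
Proof.
move=> r0 H1 H2 h0 w hw.
have sub z : box (Re a - r) (Re a + r) (Im a - r) (Im a + r) z -> cabs (z - a) < 2 * r.
  move=> [/andP[b1 b2] /andP[b3 b4]].
  have hh : cabs (z - a) ^+ 2 < (2 * r) ^+ 2.
    rewrite sqr_cabs !ReD !ImD !ReN !ImN.
    by have := mulr_gt0 r0 r0; nra.
  by rewrite -(ltr_pXn2r (n := 2)) ?nnegrE ?cabs_ge0//; lra.
have h10 : \forall z \near a, h1 z = 0.
  have r20 : 0 < 2 * r by lra.
  apply: filterS2 (nbhs_interior h0) (near_cabs a r20) => y hy hb.
  apply: (@cderiv_unique _ h y) (H1 y hb) _.
  by apply: cderiv_near (cderiv_cst 0 y) _; apply: filterS hy => t ->.
apply: (@eq0_of_far_boundary h h1 a (Re a - r) (Re a + r) (Im a - r) (Im a + r) r) => //.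
- by move=> z /sub; exact: H1.
- by move=> z /sub; exact: H2.
- by move=> z _ _; exact: near_and.
- move=> z _ ez; right.
  have h1' := Re_le_cabs (z - a); have h2' := Im_le_cabs (z - a).
  rewrite ReD ReN in h1'; rewrite ImD ImN in h2'.
  case: ez => E; [apply: le_trans h1'|apply: le_trans h1'|apply: le_trans h2'|apply: le_trans h2'];
   by rewrite E ?[_ - r - _]addrAC ?[_ + r - _]addrAC subrr add0r ?normrN ger0_norm// ltW.
- have := Re_le_cabs (w - a); have := Im_le_cabs (w - a).
  by rewrite ReD ReN ImD ImN !ler_norml => /andP[? ?] /andP[? ?]; split; apply/andP; split; lra.
Qed.

(** The pole [p] sits at depth [r / 8] below the real segment. Of the rectangle above the segment,
    the bottom edge carries [h = 0] and the other edges are at distance at least [r / 2] from [p];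
    so [h] vanishes around the mirror point [b], from where [identity_ball] carries the zero back to
    [t]. *)
Lemma identity_segment h h1 (t r : R) : 0 < r ->
  (forall w, cabs (w - rc t) < 2 * r -> cderiv h w (h1 w)) ->
  (forall w, cabs (w - rc t) < 2 * r -> exists l, cderiv h1 w l) ->
  (forall s : R, `|s - t| <= r -> h (rc s) = 0) ->
  \forall w \near rc t, h w = 0.
Proof.
move=> r0 H1 H2 h0.
pose b : Cx R := rc t + ci R * rc (r / 8).
pose p : Cx R := rc t - ci R * rc (r / 8).
have sub z : box (t - r) (t + r) 0 (r / 2) z -> cabs (z - rc t) < 2 * r.
  move=> [/andP[b1 b2] /andP[b3 b4]].
  apply: (le_lt_trans (cabs_le_ReIm _)).
  rewrite !ReD !ImD !ReN !ImN Re_rc Im_rc subr0 [`|Im z|]ger0_norm//.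
  by have : `|Re z - t| <= r; [rewrite ler_norml; lra | lra].
have zb z : cabs (z - b) < r / 16 -> h z = 0.
  move=> hz; have hz1 := Re_le_cabs (z - b); have hz2 := Im_le_cabs (z - b).
  move: hz1 hz2; rewrite /b !ReD !ImD !ReN !ImN !ReD !ImD !ReM !ImM !Re_ci !Im_ci !Re_rc !Im_rc.
  rewrite !ler_norml => /andP[d1 d2] /andP[d3 d4].
  apply: (@eq0_of_far_boundary h h1 p (t - r) (t + r) 0 (r / 2) (r / 2)).
  - by lra.
  - by move=> w /sub; exact: H1.
  - by move=> w /sub; exact: H2.
  - move=> w [_ /andP[w1 _]] wp; move: w1; rewrite wp /p !ImD !ImN !ImM !Re_ci !Im_ci !Re_rc !Im_rc.
    by lra.
  - move=> w [/andP[w1 w2] /andP[w3 w4]] ew.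
    have e1 := Re_le_cabs (w - p); have e2 := Im_le_cabs (w - p).
    move: e1 e2; rewrite /p !ReD !ImD !ReN !ImN !ReD !ImD !ReN !ImN !ReM !ImM !Re_ci !Im_ci !Re_rc !Im_rc.
    rewrite !ler_norml => /andP[f1 f2] /andP[f3 f4].
    case: ew => E; [right; lra|right; lra|left|right; lra].
    have -> : w = rc (Re w) by apply: Cx_eq; rewrite ?Re_rc// E.
    by apply: h0; rewrite ler_norml; lra.
  - by split; apply/andP; split; lra.
  - have -> : z - p = (z - b) + ci R * rc (r / 4).
      have -> : rc (r / 4) = rc (r / 8) + rc (r / 8) by rewrite -rcD; congr rc; lra.
      by rewrite /b /p; ring.
    apply: (le_lt_trans (cabsD _ _)); rewrite cabsM cabs_ci mul1r cabs_rc ger0_norm; lra.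
have bt : cabs (b - rc t) = r / 8.
  by rewrite /b addrAC subrr add0r cabsM cabs_ci mul1r cabs_rc ger0_norm//; lra.
have nb : \forall w \near b, h w = 0.
  by apply/nbhs_cabsP; exists (r / 16); [lra | exact: zb].
have r2 : 0 < r / 2 by lra.
have sub2 w : cabs (w - b) < 2 * (r / 2) -> cabs (w - rc t) < 2 * r.
  by move=> hw; apply: (le_lt_trans (cabsB_le w b (rc t))); rewrite bt; lra.
have Z := @identity_ball h h1 b (r / 2) r2 (fun w hw => H1 w (sub2 w hw)) (fun w hw => H2 w (sub2 w hw)) nb.
apply/nbhs_cabsP; exists (r / 4); first by lra.
move=> w hw; apply: Z; apply: (le_lt_trans (cabsB_le w (rc t) b)).
by rewrite [cabs (rc t - b)]cabsBC bt; lra.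
Qed.

End Identity.

(** * Primitives of holomorphic functions on disks *)

Section Primitives.
Variable R : realType.
Implicit Types (u v : R -> Cx R) (h : Cx R -> Cx R) (a w y : Cx R).

Lemma vderivD u v (t : R) (l m : Cx R) : vderiv u t l -> vderiv v t m ->
  vderiv (fun s => u s + v s) t (l + m).
Proof.
move=> Hg Hh e e0; have e20 : 0 < e / 2 by lra.
apply: filterS2 (Hg _ e20) (Hh _ e20) => y H1 H2.
have -> : u y + v y - (u t + v t) - (l + m) * rc (y - t) =
  (u y - u t - l * rc (y - t)) + (v y - v t - m * rc (y - t)) by ring.
apply: (le_trans (cabsD _ _)); lra.
Qed.

Lemma vderivM u v (t : R) (l m : Cx R) : vderiv u t l -> vderiv v t m ->
  vderiv (fun s => u s * v s) t (l * v t + u t * m).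
Proof.
move=> Hu Hv; apply: vderivP.
  have := is_deriveB (is_deriveM (vderiv_Re Hu) (vderiv_Re Hv)) (is_deriveM (vderiv_Im Hu) (vderiv_Im Hv)).
  have -> : (fun s : R => Re (u s * v s)) = (fun s : R => Re (u s)) * (fun s : R => Re (v s)) -
    (fun s : R => Im (u s)) * (fun s : R => Im (v s)) by apply/funext => s; rewrite ReM.
  by move=> H; apply: is_derive_eq H _; rewrite ReD !ReM /GRing.scale /=; ring.
have := is_deriveD (is_deriveM (vderiv_Re Hu) (vderiv_Im Hv)) (is_deriveM (vderiv_Im Hu) (vderiv_Re Hv)).
have -> : (fun s : R => Im (u s * v s)) = (fun s : R => Re (u s)) * (fun s : R => Im (v s)) +
  (fun s : R => Im (u s)) * (fun s : R => Re (v s)) by apply/funext => s; rewrite ImM.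
by move=> H; apply: is_derive_eq H _; rewrite ImD !ImM /GRing.scale /=; ring.
Qed.

Lemma vderivZ c u (t : R) (l : Cx R) : vderiv u t l -> vderiv (fun s => c * u s) t (c * l).
Proof.
move=> H; have := vderiv_comp H (cderivZ c (cderiv_id (u t))).
by rewrite mulr1.
Qed.

(** The margin [eta] on both sides makes the derivatives at [0] and [1] two-sided. *)
Lemma antiderivative (g : R -> R) (eta : R) : 0 < eta ->
  (forall t, - eta <= t <= 1 + eta -> {for t, continuous g}) ->
  exists G : R -> R, forall s : R, 0 <= s <= 1 -> is_derive s 1 G (g s).
Proof.
move=> e0 gc.
have int : lebesgue_measure.-integrable [set` `[- eta, 1 + eta]] (EFin \o g).
  apply: (@continuous_compact_integrable R g _ (@segment_compact R _ _)).
  exact: within_continuous gc.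
exists (fun x => \int[lebesgue_measure]_(t in [set` Interval (BLeft (- eta)) (BRight x)]) g t) => s /andP[s0 s1].
have su : s < 1 + eta by lra.
have hs : - eta < s by lra.
have [|dF FE] := continuous_FTC1_closed su int hs; first by apply: gc; lra.
by split; [exact: dF | rewrite -FE derive1E].
Qed.

Lemma antiderivative_Cx u (eta : R) : 0 < eta ->
  (forall t, - eta <= t <= 1 + eta -> {for t, continuous u}) ->
  exists U : R -> Cx R, U 0 = 0 /\ forall s, 0 <= s <= 1 -> vderiv U s (u s).
Proof.
move=> e0 uc.
have c1 t : - eta <= t <= 1 + eta -> {for t, continuous (fun s : R => Re (u s))}.
  move=> /uc ut; exact: (@continuous_comp _ _ _ u (fun z : Cx R => Re z) t ut (@Re_continuous R (u t))).
have c2 t : - eta <= t <= 1 + eta -> {for t, continuous (fun s : R => Im (u s))}.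
  move=> /uc ut; exact: (@continuous_comp _ _ _ u (fun z : Cx R => Im z) t ut (@Im_continuous R (u t))).
have [G1 H1] := antiderivative e0 c1; have [G2 H2] := antiderivative e0 c2.
pose U (s : R) : Cx R := (G1 s - G1 0) +i* (G2 s - G2 0).
exists U; split; first by apply: Cx_eq; rewrite /= subrr.
move=> s hs; apply: vderivP => /=.
  have := is_deriveB (H1 s hs) (is_derive_cst (G1 0) s 1).
  by rewrite subr0.
have := is_deriveB (H2 s hs) (is_derive_cst (G2 0) s 1).
by rewrite subr0.
Qed.

Lemma ray_in_ball a w (r : R) : cabs (w - a) < r ->
  exists2 eta, 0 < eta & forall s, - eta <= s <= 1 + eta -> cabs (a + rc s * (w - a) - a) < r.
Proof.
move=> hw; set c := cabs (w - a) in hw.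
have c0 : 0 <= c by exact: cabs_ge0.
have c1 : 0 < 2 * (c + 1) by lra.
exists ((r - c) / (2 * (c + 1))); first by rewrite divr_gt0//; lra.
set eta := _ / _ => s /andP[s1 s2].
have eE : eta * (2 * (c + 1)) = r - c by rewrite divfK// gt_eqF.
have e0 : 0 < eta by rewrite divr_gt0//; lra.
rewrite addrAC subrr add0r cabsM cabs_rc -/c.
have : `|s| <= 1 + eta by rewrite ler_norml; lra.
by move=> /(ler_wpM2r c0); nra.
Qed.

(** [G w 1] is the integral over [[0, 1]] of [h] along the ray from [a] to [w], and the primitive is
    [(w - a) * G w 1]. Differentiation under the integral sign gives [K 1], the integral of
    [s * h1], as the derivative of [G w 1] in [w]; integration by parts then yields [h w]. *)
Lemma primitive_ball h h1 a (r : R) : 0 < r ->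
  (forall w, cabs (w - a) < r -> cderiv h w (h1 w)) ->
  (forall w, cabs (w - a) < r -> {for w, continuous h1}) ->
  exists F : Cx R -> Cx R, F a = 0 /\ forall w, cabs (w - a) < r -> cderiv F w (h w).
Proof.
move=> r0 H1 C1.
pose pt w s := a + rc s * (w - a).
have ptc w s : {for s, continuous (pt w)} by exact: vderiv_continuous (vderiv_line _ _ _).
have ptb w s : cabs (w - a) < r -> 0 <= s <= 1 -> cabs (pt w s - a) < r.
  by move=> hw hs; have [eta e0] := ray_in_ball hw; apply; lra.
have /choice [G HG] : forall w, exists U : R -> Cx R, cabs (w - a) < r ->
    U 0 = 0 /\ forall s, 0 <= s <= 1 -> vderiv U s (h (pt w s)).
  move=> w; have [hw|hw] := pselect (cabs (w - a) < r); last by exists (fun=> 0).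
  have [eta e0 he] := ray_in_ball hw.
  have [U HU] := @antiderivative_Cx (h \o pt w) eta e0 (fun t ht =>
    @continuous_comp _ _ _ (pt w) h t (ptc w t) (cderiv_continuous (H1 _ (he t ht)))).
  by exists U.
exists (fun w => (w - a) * G w 1); split; first by rewrite subrr mul0r.
move=> w hw.
have [eta e0 he] := ray_in_ball hw.
have [K [K0 HK]] : exists K : R -> Cx R, K 0 = 0 /\ forall s, 0 <= s <= 1 -> vderiv K s (rc s * h1 (pt w s)).
  apply: (@antiderivative_Cx (fun s => rc s * h1 (pt w s)) eta e0) => t ht.
  apply: (@cvgM _ _ (nbhs t)); first exact: vderiv_continuous (vderiv_rc t).
  exact: (@continuous_comp _ _ _ (pt w) h1 t (ptc w t) (C1 _ (he t ht))).
have [G0 GD] := HG w hw.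
(* Integration by parts: along the ray, [s * h (pt w s)] has derivative [h + s * h1 * (w - a)]. *)
have GE : G w 1 + (w - a) * K 1 = h w.
  pose k s := G w s + (w - a) * K s + (-1) * (rc s * h (pt w s)).
  have A : cabs (k 1 - k 0) <= 0 * (1 - 0).
    apply: (@mean_value_vderiv _ k (fun=> 0)) => // s hs; last by rewrite cabs0.
    have A1 := vderivM (vderiv_rc s) (vderiv_comp (vderiv_line a (w - a) s) (H1 _ (ptb w s hw hs))).
    have := vderivD (vderivD (GD s hs) (vderivZ (w - a) (HK s hs))) (vderivZ (-1) A1).
    by congr vderiv; rewrite /pt /=; ring.
  have k0 : k 0 = 0 by rewrite /k G0 K0 rc0; ring.
  have pt1 : pt w 1 = w by rewrite /pt rc1; ring.
  have /eqP : cabs (k 1) == 0 by rewrite eq_le cabs_ge0 andbT -[k 1]subr0 -k0; rewrite mul0r in A.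
  move/eqP; rewrite cabs_eq0 /k pt1 rc1 mul1r mulN1r subr_eq0 => /eqP; exact.
suff DG : cderiv (fun y => G y 1) w (K 1).
  apply: cderiv_eq (cderivM (cderivB (cderiv_id w) (cderiv_cst a w)) DG) _.
  by rewrite subr0 mul1r.
move=> e ep.
(* The first-order expansion of [h] must hold uniformly along the ray: continuity of [h1] gives it
   near each [s], and compactness of [[0, 1]] gives one neighbourhood of [w] for all [s]. *)
pose P y (s : R) := 0 <= s <= 1 ->
    cabs (h (pt y s) - h (pt w s) - rc s * h1 (pt w s) * (y - w)) <= e * cabs (y - w).
have near1 : \forall y \near w, `[0, 1] `<=` P y.
  have /compact_near_coveringP cov := @segment_compact R 0 1.
  apply: (cov _ (nbhs w) P _) => s; rewrite /= in_itv /= => hs.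
  have hp : cabs (pt w s - a) < r by exact: ptb.
  have e2 : 0 < e / 2 by lra.
  have /nbhs_cabsP [d1 d10 hd1] := (continuous_cabsP _ _).2 (C1 _ hp) _ e2.
  pose d := Num.min d1 (r - cabs (pt w s - a)).
  have d0 : 0 < d by rewrite lt_min d10 subr_gt0.
  have c1 : 0 < 2 * (cabs (w - a) + 1) by have := cabs_ge0 (w - a); lra.
  have dd : 0 < d / (2 * (cabs (w - a) + 1)) by rewrite divr_gt0.
  have d2 : 0 < d / 2 by lra.
  exists (ball s (d / (2 * (cabs (w - a) + 1))), [set y | cabs (y - w) < d / 2]).
    by split; [exact: nbhsx_ballx | exact: near_cabs].
  move=> [t y] [/= ht hy] t01.
  have near_pt z : cabs (z - w) < d / 2 -> cabs (pt z t - pt w s) < d.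
    move=> hz; have -> : pt z t - pt w s = rc t * (z - w) + rc (t - s) * (w - a).
      by rewrite /pt rcB; ring.
    apply: (le_lt_trans (cabsD _ _)); rewrite !cabsM !cabs_rc.
    have A1 : `|t| * cabs (z - w) <= cabs (z - w).
      by rewrite ler_piMl ?cabs_ge0// ger0_norm; lra.
    have A2 : `|t - s| * cabs (w - a) <= d / 2.
      move: ht; rewrite /ball /= distrC => ht.
      have := ler_wpM2r (cabs_ge0 (w - a)) (ltW ht) => /le_trans; apply.
      rewrite mulrAC ler_pdivrMr//; have := cabs_ge0 (w - a); nra.
    by lra.
  have p1 := near_pt y hy.
  have p2 : cabs (pt w t - pt w s) < d by apply: near_pt; rewrite subrr cabs0.
  have inb x : cabs (x - pt w s) < d -> cabs (x - a) < r.
    rewrite /d lt_min => /andP[_ hx].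
    by apply: (le_lt_trans (cabsB_le x (pt w s) a)); lra.
  have A : cabs ((h (pt y t) - h1 (pt w t) * pt y t) - (h (pt w t) - h1 (pt w t) * pt w t)) <=
      e * cabs (pt y t - pt w t).
    apply: (@mean_value_ball R (fun x => h x - h1 (pt w t) * x) (fun x => h1 x - h1 (pt w t))
      (pt w s) (pt w t) (pt y t) d e) => // x hx.
      apply: cderivB; first exact/H1/inb.
      by apply: cderiv_eq (cderivZ _ (cderiv_id x)) _; rewrite mulr1.
    have B1 := hd1 x; have B2 := hd1 (pt w t).
    move: hx p2; rewrite /d !lt_min => /andP[/B1 {}B1 _] /andP[/B2 {}B2 _].
    have := cabsB_le (h1 x) (h1 (pt w s)) (h1 (pt w t)).
    by rewrite [cabs (h1 (pt w s) - _)]cabsBC; lra.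
  move: A; have -> : h (pt y t) - h1 (pt w t) * pt y t - (h (pt w t) - h1 (pt w t) * pt w t) =
    h (pt y t) - h (pt w t) - rc t * h1 (pt w t) * (y - w) by rewrite /pt; ring.
  move=> A; apply: (le_trans A); apply: ler_wpM2l; first exact: ltW.
    have -> : pt y t - pt w t = rc t * (y - w) by rewrite /pt; ring.
    by rewrite cabsM cabs_rc ler_piMl ?cabs_ge0// ger0_norm; lra.
have nearb : \forall y \near w, cabs (y - a) < r.
  apply/nbhs_cabsP; exists (r - cabs (w - a)); first by rewrite subr_gt0.
  by move=> y hy; apply: (le_lt_trans (cabsB_le y w a)); lra.
apply: filterS2 near1 nearb => y hy1 hyb.
have [Gy0 GyD] := HG y hyb.
pose k s := G y s + (-1) * G w s + (- (y - w)) * K s.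
have A : cabs (k 1 - k 0) <= e * cabs (y - w) * (1 - 0).
  apply: (@mean_value_vderiv R k
    (fun s => h (pt y s) + (-1) * h (pt w s) + (- (y - w)) * (rc s * h1 (pt w s)))) => // s hs.
    exact: vderivD (vderivD (GyD s hs) (vderivZ _ (GD s hs))) (vderivZ _ (HK s hs)).
  have -> : h (pt y s) + -1 * h (pt w s) + - (y - w) * (rc s * h1 (pt w s)) =
    h (pt y s) - h (pt w s) - rc s * h1 (pt w s) * (y - w) by ring.
  by apply: hy1 => //=; rewrite in_itv.
rewrite subr0 mulr1 in A; apply: le_trans A.
rewrite le_eqVlt; apply/orP; left; apply/eqP; congr cabs.
by rewrite /k Gy0 G0 K0; ring.
Qed.

End Primitives.

(** * The holomorphic inverse function theorem *)

Section InverseFunction.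
Variable R : realType.
Implicit Types (h : Cx R -> Cx R) (a w y z : Cx R).

(* Near [a] the map [h] is [h1 a] times a perturbation of the identity, hence
   expanding; a preimage of [y] minimises [|h - y|] on a box around [a]. *)
Lemma inverse_function h h1 a (r : R) : 0 < r ->
  (forall w, cabs (w - a) < r -> cderiv h w (h1 w)) ->
  {for a, continuous h1} -> h1 a != 0 ->
  exists G : Cx R -> Cx R, exists d e : R, [/\ 0 < d, 0 < e, e <= r,
    forall y, cabs (y - h a) < d ->
      [/\ cabs (G y - a) < e, h (G y) = y, h1 (G y) != 0 & cderiv G y (h1 (G y))^-1] &
    forall w, cabs (w - a) < e -> cabs (h w - h a) < d -> G (h w) = w].
Proof.
move=> r0 H1 C1 h1a.
set m := cabs (h1 a); have m0 : 0 < m by rewrite cabs_gt0.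
have m2 : 0 < m / 2 by lra.
have /nbhs_cabsP [e1 e10 he1] := (continuous_cabsP _ _).2 C1 _ m2.
pose e := Num.min e1 r.
have e0 : 0 < e by rewrite lt_min e10.
have er : e <= r by rewrite ge_min lexx orbT.
have hh1 w : cabs (w - a) < e -> cabs (h1 w - h1 a) <= m / 2.
  by rewrite lt_min => /andP[/he1 /ltW].
have hr w : cabs (w - a) < e -> cderiv h w (h1 w).
  by move=> hw; apply: H1; exact: lt_le_trans er.
have h1n w : cabs (w - a) < e -> h1 w != 0.
  move=> /hh1 hw; rewrite -cabs_gt0; have := cabs_sub_ge (h1 a) (h1 w).
  by rewrite cabsBC -/m; lra.
have expand w z : cabs (w - a) < e -> cabs (z - a) < e ->
    m / 2 * cabs (z - w) <= cabs (h z - h w).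
  move=> hw hz.
  have A : cabs ((h z - h1 a * z) - (h w - h1 a * w)) <= m / 2 * cabs (z - w).
    apply: (@mean_value_ball R (fun x => h x - h1 a * x) (fun x => h1 x - h1 a) a w z e) => // x hx.
    apply: cderivB; first exact: hr.
    by apply: cderiv_eq (cderivZ _ (cderiv_id x)) _; rewrite mulr1.
  have := cabs_sub_ge (h1 a * (z - w)) (h z - h w).
  have -> : h1 a * (z - w) - (h z - h w) = - ((h z - h1 a * z) - (h w - h1 a * w)) by ring.
  by rewrite cabsN cabsM -/m; lra.
pose q := e / 2; have q0 : 0 < q by rewrite /q; lra.
have sub z : box (Re a - q) (Re a + q) (Im a - q) (Im a + q) z -> cabs (z - a) < e.
  move=> [/andP[b1 b2] /andP[b3 b4]].
  have hh : cabs (z - a) ^+ 2 < e ^+ 2.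
    have eq : e = 2 * q by rewrite /q; lra.
    rewrite eq sqr_cabs !ReD !ImD !ReN !ImN.
    by have := mulr_gt0 q0 q0; nra.
  by rewrite -(ltr_pXn2r (n := 2)) ?nnegrE ?cabs_ge0// ltW.
have edge z : box_edge (Re a - q) (Re a + q) (Im a - q) (Im a + q) z -> q <= cabs (z - a).
  have h1' := Re_le_cabs (z - a); have h2' := Im_le_cabs (z - a).
  rewrite ReD ReN in h1'; rewrite ImD ImN in h2'.
  case=> E; [apply: le_trans h1'|apply: le_trans h1'|apply: le_trans h2'|apply: le_trans h2'];
   by rewrite E ?[_ - q - _]addrAC ?[_ + q - _]addrAC subrr add0r ?normrN ger0_norm// ltW.
(* By [expand], [h] moves every edge point at least [2 * d] away from [h a]; so for [y] within [d]
   of [h a], the minimiser of [cabs (h z - y)], at least as good as [a], is not on an edge. *)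
pose d := m / 2 * q / 2.
have d0 : 0 < d by rewrite /d; have := mulr_gt0 m2 q0; lra.
have inva : cabs (a - a) < e by rewrite subrr cabs0.
have /choice [G HG] : forall y, exists w, cabs (y - h a) < d -> cabs (w - a) < e /\ h w = y.
  move=> y; have [hy|hy] := pselect (cabs (y - h a) < d); last by exists a.
  have [| | |wm hwm wmin] := @box_max R (fun z => - cabs (h z - y))
      (Re a - q) (Re a + q) (Im a - q) (Im a + q).
  - by lra.
  - by lra.
  - move=> z /sub hz.
    have cz := continuous_cabs_comp (cderiv_continuous (cderivB (hr z hz) (cderiv_cst y z))).
    exact: (@cvgN R R^o _ (nbhs z) _ (fun w => cabs (h w - y)) _ cz).
  exists wm => _; have we := sub _ hwm; split=> //.
  have boxa : box (Re a - q) (Re a + q) (Im a - q) (Im a + q) a.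
    by split; apply/andP; split; lra.
  have ne : ~ box_edge (Re a - q) (Re a + q) (Im a - q) (Im a + q) wm.
    move=> /edge qe; have := wmin a boxa; rewrite lerN2.
    have := expand _ _ inva we; have := cabsB_le (h wm) y (h a).
    rewrite [cabs (h a - y)]cabsBC.
    have := ler_wpM2l (ltW m2) qe; rewrite /d in hy *; lra.
  have [d1 d10 hd1] := box_interior hwm ne.
  have [//|hn] := eqVneq (h wm) y.
  exfalso.
  (* The Newton direction: moving along [v] decreases [cabs (h z - y) ^ 2] at the rate
     [2 * cabs (h wm - y) ^ 2], against minimality. *)
  pose v := - (h wm - y) / h1 wm.
  have vn : v != 0 by rewrite mulf_neq0 ?oppr_eq0 ?subr_eq0// invr_eq0 h1n.
  have D : is_derive (0 : R) 1 (fun s : R => - cabs (h (wm + rc s * v) - y) ^+ 2)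
      (2 * cabs (h wm - y) ^+ 2).
    have p0 : wm + rc 0 * v = wm by rewrite rc0 mul0r addr0.
    have A1 : cderiv (fun z => h z - y) (wm + rc 0 * v) (h1 wm).
      by rewrite p0; apply: cderiv_eq (cderivB (hr _ we) (cderiv_cst y _)) _; rewrite subr0.
    have A2 := is_deriveN (is_derive_sqr_cabs (vderiv_comp (vderiv_line wm v 0) A1)).
    apply: is_derive_eq A2 _; rewrite /= p0.
    have -> : h1 wm * v = - (h wm - y) by rewrite /v mulrCA divff ?h1n// mulr1.
    by rewrite sqr_cabs (ReN (h wm - y)) (ImN (h wm - y)); ring.
  have v0 : 0 < cabs v by rewrite cabs_gt0.
  have := @is_derive_max_le0 R _ _ (d1 / cabs v) _ D.
  rewrite divr_gt0// => /(_ isT) H.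
  have : 2 * cabs (h wm - y) ^+ 2 <= 0.
    apply: H => s /andP[s0 s1]; rewrite rc0 mul0r addr0 lerN2.
    rewrite ler_pXn2r ?nnegrE ?cabs_ge0// -lerN2; apply/wmin/hd1.
    by rewrite addrAC subrr add0r cabsM cabs_rc ger0_norm// -ltr_pdivlMr.
  have : 0 < cabs (h wm - y) ^+ 2 by rewrite exprn_gt0// cabs_gt0 subr_eq0.
  by lra.
exists G, d, e; split=> //; last first.
  move=> w hw hd; have [g1 g2] := HG _ hd.
  have := expand _ _ hw g1; rewrite g2 subrr cabs0 => A.
  apply/eqP; rewrite -subr_eq0 -cabs_eq0 eq_le cabs_ge0 andbT.
  by rewrite -(ler_pM2l m2) mulr0.
move=> y hy; have [g1 g2] := HG y hy; split=> //; first exact: h1n.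
move=> e' e'0.
set l := h1 (G y); have ln : l != 0 by exact: h1n.
have l0 : 0 < cabs l by rewrite cabs_gt0.
have lip : \forall y' \near y, cabs (y' - h a) < d /\ cabs (G y' - G y) <= 2 / m * cabs (y' - y).
  apply/nbhs_cabsP; exists (d - cabs (y - h a)); first by rewrite subr_gt0.
  move=> y' hy'; have yd : cabs (y' - h a) < d.
    by apply: (le_lt_trans (cabsB_le y' y (h a))); lra.
  split=> //; have [g1' g2'] := HG y' yd.
  have := expand _ _ g1 g1'; rewrite g2 g2' => A.
  by rewrite mulrAC ler_pdivlMr// mulrC; lra.
pose e2 := e' * cabs l * m / 2.
have e20 : 0 < e2 by rewrite /e2 divr_gt0// !mulr_gt0.
have D : \forall w \near G y, cabs (h w - h (G y) - l * (w - G y)) <= e2 * cabs (w - G y).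
  exact: (hr _ g1) e2 e20.
have cG : {for y, continuous G}.
  apply/continuous_cabsP => e3 e30.
  have e4 : 0 < e3 * m / 2 by rewrite divr_gt0// mulr_gt0.
  apply: filterS2 lip (near_cabs y e4) => y' [_ A] B; apply: (le_lt_trans A).
  by rewrite mulrAC ltr_pdivrMr//; lra.
apply: filterS2 lip (cG _ D) => y' [yd A]; rewrite /=.
have [_ g2'] := HG y' yd; rewrite g2 g2' => B.
have -> : G y' - G y - l^-1 * (y' - y) = - (l^-1 * (y' - y - l * (G y' - G y))) by field.
rewrite cabsN cabsM cabsV mulrC ler_pdivrMr//; apply: (le_trans B).
have := ler_wpM2l (ltW e20) A => /le_trans; apply.
by rewrite le_eqVlt; apply/orP; left; apply/eqP; rewrite /e2; field; rewrite gt_eqF.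
Qed.

End InverseFunction.

(** * Conformal minimal immersions in a chart *)

Section Plane.
Variable R : realType.
Implicit Types (a au av auv avu : R * R -> R) (x y : R * R).

Definition grad (p q : R) : Cx R := rc p - ci R * rc q.

Lemma Re_grad p q : Re (grad p q) = p.
Proof. by rewrite /grad !ReImE; ring. Qed.

Lemma Im_grad p q : Im (grad p q) = - q.
Proof. by rewrite /grad !ReImE; ring. Qed.

Lemma Nci_grad p q : - ci R * grad p q = grad (- q) p.
Proof. by rewrite /grad; apply: Cx_eq; rewrite !ReImE; ring. Qed.

(** The form in which Cauchy-Riemann is checked for the gradients of the coordinates: [q = p'] will
    be the symmetry of mixed partials, [p = - q'] harmonicity. *)
Lemma grad_rot p q p' q' : q = p' -> p = - q' -> - ci R * grad p q = grad (- p') (- q').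
Proof. by move=> -> ->; exact: Nci_grad. Qed.

Lemma cgrad_eq f (z l m : Cx R) : cgrad f z l -> l = m -> cgrad f z m.
Proof. by move=> H <-. Qed.

Lemma ltr_half (p q e : R) : p < e / 2 -> q < e / 2 -> p + q < e.
Proof. by lra. Qed.

Lemma entryN (M : 'rV[R]_3) j : (- M) 0 j = - M 0 j.
Proof. by rewrite mxE. Qed.

Lemma cabs_grad_sub p q p' q' : cabs (grad p q - grad p' q') <= `|p' - p| + `|q' - q|.
Proof.
apply: (le_trans (cabs_le_ReIm _)); rewrite ReD ImD ReN ImN !Re_grad !Im_grad.
by rewrite distrC lerD2l opprK addrC.
Qed.

Lemma continuous_grad (p q : Cx R -> R) z : {for z, continuous p} -> {for z, continuous q} ->
  {for z, continuous (fun w : Cx R => grad (p w) (q w))}.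
Proof.
move=> /(@cvgrPdist_lt _ _ _ (nbhs z)) cp /(@cvgrPdist_lt _ _ _ (nbhs z)) cq.
apply/continuous_cabsP => e e0; have e2 : 0 < e / 2 by lra.
apply: filterS2 (cp _ e2) (cq _ e2) => y h1 h2.
by apply: (le_lt_trans (cabs_grad_sub _ _ _ _)); exact: ltr_half.
Qed.

Lemma pair_of_CxK : cancel (@pair_of_Cx R) (@Cx_of_pair R).
Proof. by case. Qed.

Lemma Cx_of_pairK : cancel (@Cx_of_pair R) (@pair_of_Cx R).
Proof. by case. Qed.

Lemma is_derive_fst a (s t l : R) : is_derive (s, t) (1, 0) a l ->
  is_derive s 1 (fun s : R => a (s, t)) l.
Proof.
have E (k : R) : k *: (1, 0) + (s, t) = (k *: 1 + s, t) :> R * R.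
  by congr pair; rewrite /= ?scaler0 ?add0r.
by case=> [df dl]; split; [move: df | move: dl]; rewrite /derivable /derive /=;
  under eq_fun do rewrite E.
Qed.

Lemma is_derive_snd a (s t l : R) : is_derive (s, t) (0, 1) a l ->
  is_derive t 1 (fun t : R => a (s, t)) l.
Proof.
have E (k : R) : k *: (0, 1) + (s, t) = (s, k *: 1 + t) :> R * R.
  by congr pair; rewrite /= ?scaler0 ?add0r.
by case=> [df dl]; split; [move: df | move: dl]; rewrite /derivable /derive /=;
  under eq_fun do rewrite E.
Qed.

Lemma is_derive_line a x (v : R * R) (l : R) :
  is_derive (0 : R) 1 (fun s : R => a (s *: v + x)) l -> is_derive x v a l.
Proof.
case=> [df dl]; split; [move: df | move: dl]; rewrite /derivable /derive /=;
  under eq_fun do rewrite [_ *: 1]mulr1 addr0 scale0r add0r; exact.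
Qed.

Lemma mean_value_sym (f df : R -> R) (a b : R) :
  (forall s : R, `|s - a| <= `|b - a| -> is_derive s 1 f (df s)) ->
  exists2 c, `|c - a| <= `|b - a| & f b - f a = df c * (b - a).
Proof.
move=> H; have [ab|ba|->] := ltgtP a b.
- have [|c /andP[c1 c2] E] := @mean_value R f df a b ab.
    by move=> s /andP[s1 s2]; apply: H; rewrite !ger0_norm; lra.
  by exists c => //; rewrite !ger0_norm; lra.
- have [|c /andP[c1 c2] E] := @mean_value R f df b a ba.
    by move=> s /andP[s1 s2]; apply: H; rewrite !ler0_norm; lra.
  by exists c => //; [rewrite !ler0_norm; lra | rewrite -opprB E; ring].
- by exists b; rewrite ?subrr// mulr0.
Qed.

Lemma nbhs_pairP x (P : set (R * R)) : nbhs x P <->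
  exists2 d : R, 0 < d & forall y, `|y.1 - x.1| < d -> `|y.2 - x.2| < d -> P y.
Proof.
split=> [/nbhs_ballP [d /= d0 hd]|[d d0 hd]].
  by exists d => // y h1 h2; apply: hd; split; rewrite /ball /= distrC.
apply/nbhs_ballP; exists d => //= y [/= h1 h2]; apply: hd; rewrite distrC.
  exact: h1.
exact: h2.
Qed.

Lemma continuous_pairP a x (e : R) : {for x, continuous a} -> 0 < e ->
  exists2 d : R, 0 < d & forall y, `|y.1 - x.1| < d -> `|y.2 - x.2| < d -> `|a y - a x| < e.
Proof.
move=> /(@cvgrPdist_lt _ _ _ (nbhs x)) H e0.
have /nbhs_pairP [d d0 hd] := H e e0.
by exists d => // y h1 h2; rewrite distrC; exact: hd.
Qed.

(** The increment is split along a horizontal and a vertical leg, with the mean value theorem on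
    each. *)
Lemma C1_cgrad a au av (D : set (R * R)) x : open D -> D x ->
  (forall y, D y -> is_derive y (1, 0) a (au y)) ->
  (forall y, D y -> is_derive y (0, 1) a (av y)) ->
  {for x, continuous au} -> {for x, continuous av} ->
  cgrad (fun z => a (pair_of_Cx z)) (Cx_of_pair x) (grad (au x) (av x)).
Proof.
move=> oD Dx Hu Hv Cu Cv e e0; have e2 : 0 < e / 2 by lra.
have /nbhs_pairP [d d0 hd] : nbhs x D by exact: open_nbhs_nbhs.
have [du du0 hu] := continuous_pairP Cu e2.
have [dv dv0 hv] := continuous_pairP Cv e2.
apply/nbhs_cabsP; exists (Num.min d (Num.min du dv)).
  by rewrite !lt_min d0 du0 dv0.
case: x Dx Cu Cv hd hu hv => x1 x2 Dx Cu Cv hd hu hv [y1 y2]; rewrite !lt_min => /and3P[k1 k2 k3].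
set n := cabs _ in k1 k2 k3 *.
have n1 : `|y1 - x1| <= n by have := Re_le_cabs ((y1 +i* y2 : Cx R) - Cx_of_pair (x1, x2)).
have n2 : `|y2 - x2| <= n by have := Im_le_cabs ((y1 +i* y2 : Cx R) - Cx_of_pair (x1, x2)).
have [c hc E1] := @mean_value_sym (fun s => a (s, y2)) (fun s => au (s, y2)) x1 y1 (fun s hs =>
  is_derive_fst (Hu _ (hd (s, y2) (le_lt_trans hs (le_lt_trans n1 k1)) (le_lt_trans n2 k1)))).
have sx : `|x1 - x1| < d by rewrite subrr normr0.
have [c' hc' E2] := @mean_value_sym (fun t => a (x1, t)) (fun t => av (x1, t)) x2 y2 (fun s hs =>
  is_derive_snd (Hv _ (hd (x1, s) sx (le_lt_trans hs (le_lt_trans n2 k1))))).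
have A1 := hu (c, y2) (le_lt_trans hc (le_lt_trans n1 k2)) (le_lt_trans n2 k2).
have sx' : `|x1 - x1| < dv by rewrite subrr normr0.
have A2 := hv (x1, c') sx' (le_lt_trans hc' (le_lt_trans n2 k3)).
rewrite /pair_of_Cx /=.
have -> : a (y1, y2) - a (x1, x2) - Re (grad (au (x1, x2)) (av (x1, x2)) * ((y1 +i* y2 : Cx R) - Cx_of_pair (x1, x2))) =
  (au (c, y2) - au (x1, x2)) * (y1 - x1) + (av (x1, c') - av (x1, x2)) * (y2 - x2).
  have -> : Re (grad (au (x1, x2)) (av (x1, x2)) * ((y1 +i* y2 : Cx R) - Cx_of_pair (x1, x2))) =
      au (x1, x2) * (y1 - x1) + av (x1, x2) * (y2 - x2) by rewrite ReM Re_grad Im_grad !ReImE /=; ring.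
  by rewrite [(au (c, _) - _) * _]mulrBl [(av (_, c') - _) * _]mulrBl -E1 -E2; ring.
apply: (le_trans (ler_normD _ _)); rewrite !normrM.
have B1 := ler_pM (normr_ge0 _) (normr_ge0 _) (ltW A1) n1.
have B2 := ler_pM (normr_ge0 _) (normr_ge0 _) (ltW A2) n2.
by lra.
Qed.

(** The second difference of [a] over a square of side [h], evaluated in either order, is [h ^ 2]
    times a value of [auv] and [h ^ 2] times a value of [avu] near [x]; continuity at [x] closes the
    gap. *)
Lemma schwarz a au av auv avu (D : set (R * R)) x : open D -> D x ->
  (forall y, D y -> is_derive y (1, 0) a (au y)) ->
  (forall y, D y -> is_derive y (0, 1) a (av y)) ->
  (forall y, D y -> is_derive y (0, 1) au (auv y)) ->
  (forall y, D y -> is_derive y (1, 0) av (avu y)) ->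
  {for x, continuous auv} -> {for x, continuous avu} -> auv x = avu x.
Proof.
move=> oD Dx Hu Hv Huv Hvu Cu Cv.
apply/eqP; rewrite -subr_eq0 -normr_eq0 eq_le normr_ge0 andbT.
apply/ler_addgt0Pr => e e0; rewrite add0r; have e2 : 0 < e / 2 by lra.
have /nbhs_pairP [d d0 hd] : nbhs x D by exact: open_nbhs_nbhs.
have [du du0 hu] := continuous_pairP Cu e2.
have [dv dv0 hv] := continuous_pairP Cv e2.
pose m := Num.min d (Num.min du dv).
have m0 : 0 < m by rewrite !lt_min d0 du0 dv0.
have [md mu mv] : [/\ m <= d, m <= du & m <= dv].
  by rewrite /m !ge_min !lexx !orbT.
case: x Dx Cu Cv hd hu hv => x1 x2 Dx Cu Cv hd hu hv.
pose h := m / 2; have h0 : 0 < h by rewrite /h; lra.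
have hm : h < m by rewrite /h; lra.
have hE (t : R) : `|t + h - t| = h by rewrite addrAC subrr add0r gtr0_norm.
have hE2 (t : R) : t + h - t = h by ring.
have inD s t : `|s - x1| <= h -> `|t - x2| <= h -> D (s, t).
  by move=> ? ?; apply: hd => /=; lra.
have x10 : `|x1 - x1| <= h by rewrite subrr normr0 ltW.
have x20 : `|x2 - x2| <= h by rewrite subrr normr0 ltW.
have x1h : `|x1 + h - x1| <= h by rewrite hE.
have x2h : `|x2 + h - x2| <= h by rewrite hE.
have [c hc E1] : exists2 c, `|c - x1| <= h & (a (x1 + h, x2 + h) - a (x1 + h, x2)) - (a (x1, x2 + h) - a (x1, x2)) =
    (au (c, x2 + h) - au (c, x2)) * h.
  have [s hs|c] := @mean_value_sym (fun s => a (s, x2 + h) - a (s, x2)) (fun s => au (s, x2 + h) - au (s, x2)) x1 (x1 + h).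
    rewrite hE in hs.
    by apply: is_deriveB; apply: is_derive_fst; apply: Hu; exact: inD.
  by rewrite hE2 (gtr0_norm h0) => ? ?; exists c.
have [c' hc' E2] : exists2 c', `|c' - x2| <= h & au (c, x2 + h) - au (c, x2) = auv (c, c') * h.
  have [s hs|c'] := @mean_value_sym (fun t => au (c, t)) (fun t => auv (c, t)) x2 (x2 + h).
    by rewrite hE in hs; apply: is_derive_snd; apply: Huv; exact: inD.
  by rewrite hE2 (gtr0_norm h0) => ? ?; exists c'.
have [b hb E3] : exists2 b, `|b - x2| <= h & (a (x1 + h, x2 + h) - a (x1, x2 + h)) - (a (x1 + h, x2) - a (x1, x2)) =
    (av (x1 + h, b) - av (x1, b)) * h.
  have [s hs|c''] := @mean_value_sym (fun t => a (x1 + h, t) - a (x1, t)) (fun t => av (x1 + h, t) - av (x1, t)) x2 (x2 + h).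
    rewrite hE in hs.
    by apply: is_deriveB; apply: is_derive_snd; apply: Hv; exact: inD.
  by rewrite hE2 (gtr0_norm h0) => ? ?; exists c''.
have [b' hb' E4] : exists2 b', `|b' - x1| <= h & av (x1 + h, b) - av (x1, b) = avu (b', b) * h.
  have [s hs|c''] := @mean_value_sym (fun s => av (s, b)) (fun s => avu (s, b)) x1 (x1 + h).
    by rewrite hE in hs; apply: is_derive_fst; apply: Hvu; exact: inD.
  by rewrite hE2 (gtr0_norm h0) => ? ?; exists c''.
have E : auv (c, c') = avu (b', b).
  have hh : h * h != 0 by rewrite mulf_neq0// gt_eqF.
  have E' : auv (c, c') * h * h = avu (b', b) * h * h by rewrite -E2 -E1 -E4 -E3; ring.
  by rewrite -!(mulrA _ h h) in E'; exact: (mulIf hh E').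
have A1 : `|auv (c, c') - auv (x1, x2)| < e / 2 by apply: hu => /=; lra.
have A2 : `|avu (b', b) - avu (x1, x2)| < e / 2 by apply: hv => /=; lra.
have -> : auv (x1, x2) - avu (x1, x2) = (avu (b', b) - avu (x1, x2)) - (auv (c, c') - auv (x1, x2)).
  by rewrite E; ring.
by apply: (le_trans (ler_normB _ _)); lra.
Qed.

Lemma dotE (u v : 'rV[R]_3) : dot u v = u 0 0 * v 0 0 + u 0 1 * v 0 1 + u 0 2%:R * v 0 2%:R.
Proof.
rewrite /dot mxE !big_ord_recr big_ord0 /= add0r !mxE.
by congr (_ * _ + _ * _ + _ * _); congr (_ _ _); apply: val_inj.
Qed.

Lemma crossE (u v : 'rV[R]_3) :
  [/\ cross u v 0 0 = u 0 1 * v 0 2%:R - u 0 2%:R * v 0 1,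
      cross u v 0 1 = u 0 2%:R * v 0 0 - u 0 0 * v 0 2%:R &
      cross u v 0 2%:R = u 0 0 * v 0 1 - u 0 1 * v 0 0].
Proof.
by rewrite /cross !mxE; split; congr (_ * _ - _ * _); congr (_ _ _); apply: val_inj.
Qed.


Lemma vec3P (u v : 'rV[R]_3) : u 0 0 = v 0 0 -> u 0 1 = v 0 1 -> u 0 2%:R = v 0 2%:R -> u = v.
Proof.
move=> h0 h1 h2; apply/rowP => j.
have [->|[->|->]] : j = 0 \/ j = 1 \/ j = 2%:R; rewrite ?h0 ?h1 ?h2 //.
by case: j => [[|[|[|//]]]] ij; [left|right; left|right; right]; apply: val_inj.
Qed.

(** The determinant of [u], [v], [cross u v] is the squared length of the cross product, which
    Lagrange's identity turns into [E2]; [K] is Cramer's rule for one coordinate. *)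
Lemma orthogonal_eq0 (u v w : 'rV[R]_3) : dot u u = dot v v -> dot u v = 0 -> dot u u != 0 ->
  dot w u = 0 -> dot w v = 0 -> dot w (cross u v) = 0 -> w = 0.
Proof.
have [c0 c1 c2] := crossE u v.
rewrite !dotE c0 c1 c2 => h1 h2 h3 h4 h5 h6.
set E := _ + _ in h3; pose E2 := E * E.
have E20 : E2 != 0 by rewrite mulf_neq0.
pose n0 := u 0 1 * v 0 2%:R - u 0 2%:R * v 0 1.
pose n1 := u 0 2%:R * v 0 0 - u 0 0 * v 0 2%:R.
pose n2 := u 0 0 * v 0 1 - u 0 1 * v 0 0.
have EE : E2 = n0 ^+ 2 + n1 ^+ 2 + n2 ^+ 2.
  have -> : E2 = E * (v 0 0 * v 0 0 + v 0 1 * v 0 1 + v 0 2%:R * v 0 2%:R) -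
     (u 0 0 * v 0 0 + u 0 1 * v 0 1 + u 0 2%:R * v 0 2%:R) ^+ 2.
    by rewrite h2 expr0n subr0 -h1.
  by rewrite /E /n0 /n1 /n2; ring.
have K j (p q s : R) : E2 * w 0 j = (w 0 0 * u 0 0 + w 0 1 * u 0 1 + w 0 2%:R * u 0 2%:R) * p +
   (w 0 0 * v 0 0 + w 0 1 * v 0 1 + w 0 2%:R * v 0 2%:R) * q + (w 0 0 * n0 + w 0 1 * n1 + w 0 2%:R * n2) * s ->
   w 0 j = 0.
  by rewrite h4 h5 h6 !mul0r !addr0 => /eqP; rewrite mulf_eq0 (negPf E20) => /eqP.
apply: vec3P; rewrite mxE.
- by apply: (K 0 (v 0 1 * n2 - v 0 2%:R * n1) (n1 * u 0 2%:R - n2 * u 0 1) n0); rewrite EE /n0 /n1 /n2; ring.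
- by apply: (K 1 (v 0 2%:R * n0 - v 0 0 * n2) (n2 * u 0 0 - n0 * u 0 2%:R) n1); rewrite EE /n0 /n1 /n2; ring.
- by apply: (K 2%:R (v 0 0 * n1 - v 0 1 * n0) (n0 * u 0 1 - n1 * u 0 0) n2); rewrite EE /n0 /n1 /n2; ring.
Qed.

Lemma dot_cross (u v : 'rV[R]_3) :
  dot (cross u v) (cross u v) = dot u u * dot v v - dot u v ^+ 2.
Proof. by have [c0 c1 c2] := crossE u v; rewrite !dotE c0 c1 c2; ring. Qed.

Lemma dotDl (u v w : 'rV[R]_3) : dot (u + v) w = dot u w + dot v w.
Proof. by rewrite /dot mulmxDl mxE. Qed.

Lemma dotZr (u v : 'rV[R]_3) (c : R) : dot u (c *: v) = c * dot u v.
Proof. by rewrite !dotE !mxE; ring. Qed.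

Lemma dotC (u v : 'rV[R]_3) : dot u v = dot v u.
Proof. by rewrite !dotE; ring. Qed.

Lemma dot_self_eq0 (u : 'rV[R]_3) : dot u u = 0 -> u = 0.
Proof.
rewrite dotE => H; have h0 := sqr_ge0 (u 0 0); have h1 := sqr_ge0 (u 0 1); have h2 := sqr_ge0 (u 0 2%:R).
rewrite !expr2 in h0 h1 h2.
by apply: vec3P; rewrite mxE; apply/eqP; rewrite -sqrf_eq0 expr2; apply/eqP; lra.
Qed.

Lemma dot_leibniz (y z y' z' : 'rV[R]_3) :
  y' 0 0 * z 0 0 + y 0 0 * z' 0 0 + (y' 0 1 * z 0 1 + y 0 1 * z' 0 1) +
  (y' 0 2%:R * z 0 2%:R + y 0 2%:R * z' 0 2%:R) = dot y' z + dot y z'.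
Proof. by rewrite !dotE; ring. Qed.

(** The sum of squares has real part [dot a a - dot b b] and imaginary part [- 2 * dot a b]. *)
Lemma complex_null (a b : 'rV[R]_3) : dot a a = dot b b -> dot a b = 0 ->
  grad (a 0 0) (b 0 0) ^+ 2 + grad (a 0 1) (b 0 1) ^+ 2 +
  grad (a 0 2%:R) (b 0 2%:R) ^+ 2 = 0.
Proof. by rewrite !dotE => c1 c2; apply: Cx_eq; rewrite !expr2 !(ReD, ImD, ReM, ImM, Re_grad, Im_grad) /=; lra. Qed.

(* Differentiating [E = G], [F = 0] makes the Laplacian orthogonal to the
   tangent plane, and [H = 0] makes it orthogonal to the normal. *)
Lemma conformal_minimal_harmonic (a b uu uv vu vv : 'rV[R]_3) : uv = vu ->
  dot uu a + dot a uu = dot vu b + dot b vu ->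
  dot uv a + dot a uv = dot vv b + dot b vv ->
  dot uu b + dot a vu = 0 -> dot uv b + dot a vv = 0 ->
  dot a a = dot b b -> dot a b = 0 -> dot a a != 0 ->
  (let n := (enorm (cross a b))^-1 *: cross a b in
   (dot uu n * dot b b - 2 * dot uv n * dot a b + dot vv n * dot a a)
     / (2 * (dot a a * dot b b - dot a b ^+ 2)) = 0) ->
  uu = - vv.
Proof.
move=> <- EGu EGv Fu Fv c1 c2 E0 H.
have cn : enorm (cross a b) != 0.
  rewrite /enorm dot_cross -c1 c2 expr0n subr0 -expr2 sqrtr_sqr normr_eq0.
  exact: E0.
have H' : dot (uu + vv) (cross a b) = 0.
  move: H; rewrite /= c2 expr0n subr0 mulr0 subr0 -c1 -mulrDl -dotDl dotZr => /eqP.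
  rewrite mulf_eq0 invr_eq0 (mulf_eq0 2) pnatr_eq0 /= (mulf_eq0 (dot a a)) orbb (negPf E0) orbF.
  by rewrite mulf_eq0 (negPf E0) orbF mulf_eq0 invr_eq0 (negPf cn) => /eqP.
apply/eqP; rewrite -subr_eq0 opprK; apply/eqP.
apply: (orthogonal_eq0 c1 c2 E0) => //; rewrite dotDl.
- by move: EGu Fv; rewrite [dot b uv]dotC [dot a uu]dotC [dot a vv]dotC; lra.
- by move: EGv Fu; rewrite [dot b vv]dotC [dot a uv]dotC; lra.
Qed.

End Plane.

Section ConformalMinimal.
Variables (R : realType) (X : R * R -> 'rV[R]_3) (D : set (R * R)).
Hypothesis oD : open D.
Hypothesis smX : forall n, Cn n D X.

Lemma is_derive_entry (Y : R * R -> 'rV[R]_3) x (v : R * R) j : derivable Y x v ->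
  is_derive x v (fun y => Y y 0 j) ('D_v Y x 0 j).
Proof.
move=> dY; have dYj := (derivable_mxP _ _ _).1 dY 0 j.
by apply: DeriveDef => //; rewrite derive_mx// mxE.
Qed.

Lemma continuous_entry (Y : R * R -> 'rV[R]_3) x j : {for x, continuous Y} ->
  {for x, continuous (fun y => Y y 0 j)}.
Proof. by move=> cY; apply: (@continuous_comp _ _ _ Y (fun M : 'rV[R]_3 => M 0 j)) => //; exact: coord_continuous. Qed.

Lemma derivable1 v x : D x -> derivable X x v.
Proof. by have [_ /(_ v)[d1 _]] := smX 1; exact: d1. Qed.

Lemma continuous1 v x : D x -> {for x, continuous ('D_v X)}.
Proof. by have [_ /(_ v)[_ c1]] := smX 1; exact: c1.1. Qed.

Lemma derivable2 v w x : D x -> derivable ('D_v X) x w.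
Proof. by have [_ /(_ v)[_ [_ /(_ w)[d2 _]]]] := smX 2; exact: d2. Qed.

Lemma continuous2 v w x : D x -> {for x, continuous ('D_w ('D_v X))}.
Proof. by have [_ /(_ v)[_ [_ /(_ w)[_ c2]]]] := smX 2; exact: c2.1. Qed.

#[local] Arguments derivable1 v [x] _.
#[local] Arguments continuous1 v [x] _.
#[local] Arguments derivable2 v w [x] _.
#[local] Arguments continuous2 v w [x] _.
#[local] Arguments continuous_entry [Y x] j _.
#[local] Arguments is_derive_entry [Y x v] j _.

(** Twice the Wirtinger derivative of the [j]-th coordinate: the Weierstrass data of the
    immersion. *)
Definition phi (j : 'I_3) (z : Cx R) : Cx R :=
  grad ('D_(1, 0) X (pair_of_Cx z) 0 j) ('D_(0, 1) X (pair_of_Cx z) 0 j).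

(** The derivative of a holomorphic function is its derivative in [u], so the second partials [X_uu]
    and [X_uv] suffice. *)
Definition dphi (j : 'I_3) (z : Cx R) : Cx R :=
  grad ('D_(1, 0) ('D_(1, 0) X) (pair_of_Cx z) 0 j) ('D_(0, 1) ('D_(1, 0) X) (pair_of_Cx z) 0 j).

Lemma phiE j x : phi j (Cx_of_pair x) = grad ('D_(1, 0) X x 0 j) ('D_(0, 1) X x 0 j).
Proof. by rewrite /phi Cx_of_pairK. Qed.

Lemma phi_cgrad j x : D x ->
  cgrad (fun z => X (pair_of_Cx z) 0 j) (Cx_of_pair x) (phi j (Cx_of_pair x)).
Proof.
move=> Dx; rewrite /phi Cx_of_pairK.
apply: (@C1_cgrad R (fun y => X y 0 j) (fun y => 'D_(1, 0) X y 0 j) (fun y => 'D_(0, 1) X y 0 j) D x oD Dx).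
- by move=> y Dy; apply: is_derive_entry; exact: derivable1.
- by move=> y Dy; apply: is_derive_entry; exact: derivable1.
- by apply: continuous_entry; exact: continuous1.
- by apply: continuous_entry; exact: continuous1.
Qed.

Lemma mixed_partials x : D x -> 'D_(0, 1) ('D_(1, 0) X) x = 'D_(1, 0) ('D_(0, 1) X) x.
Proof.
move=> Dx; apply/rowP => j.
apply: (@schwarz R (fun y => X y 0 j) (fun y => 'D_(1, 0) X y 0 j) (fun y => 'D_(0, 1) X y 0 j)
  (fun y => 'D_(0, 1) ('D_(1, 0) X) y 0 j) (fun y => 'D_(1, 0) ('D_(0, 1) X) y 0 j) D x oD Dx).
- by move=> y Dy; apply: is_derive_entry; exact: derivable1.
- by move=> y Dy; apply: is_derive_entry; exact: derivable1.
- by move=> y Dy; apply: is_derive_entry; exact: derivable2.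
- by move=> y Dy; apply: is_derive_entry; exact: derivable2.
- by apply: continuous_entry; exact: continuous2.
- by apply: continuous_entry; exact: continuous2.
Qed.

Lemma derive_phi j x v : D x -> 'D_v X x 0 j = Re (phi j (Cx_of_pair x) * Cx_of_pair v).
Proof.
move=> Dx.
have p0 : Cx_of_pair x + rc 0 * Cx_of_pair v = Cx_of_pair x by rewrite rc0 mul0r addr0.
have gr : cgrad (fun z => X (pair_of_Cx z) 0 j) (Cx_of_pair x + rc 0 * Cx_of_pair v) (phi j (Cx_of_pair x)).
  by rewrite p0; exact: phi_cgrad.
have H := is_derive_comp_cgrad (vderiv_line (Cx_of_pair x) (Cx_of_pair v) 0) gr.
have E : (fun z => X (pair_of_Cx z) 0 j) \o (fun s : R => Cx_of_pair x + rc s * Cx_of_pair v) =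
    fun s : R => (fun y => X y 0 j) (s *: v + x).
  apply/funext => s /=; congr (X _ 0 j); rewrite /pair_of_Cx !ReImE; congr pair; rewrite /= /GRing.scale /=; ring.
rewrite E in H; have [_ <-] := @is_derive_line _ (fun y => X y 0 j) x v _ H.
by have [_ <-] := is_derive_entry j (derivable1 v Dx).
Qed.

Hypothesis confX : forall x, D x ->
  dot ('D_(1, 0) X x) ('D_(1, 0) X x) = dot ('D_(0, 1) X x) ('D_(0, 1) X x) /\
  dot ('D_(1, 0) X x) ('D_(0, 1) X x) = 0.
Hypothesis immX : forall x, D x -> forall v, 'D_v X x = 0 -> v = 0.
Hypothesis minX : forall x, D x -> mean_curvature X x = 0.

Lemma Xu_neq0 x : D x -> dot ('D_(1, 0) X x) ('D_(1, 0) X x) != 0.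
Proof.
move=> Dx; apply/eqP => /dot_self_eq0 /(immX Dx) [] /eqP.
by rewrite oner_eq0.
Qed.

Lemma dot_deriv (Y Z : R * R -> 'rV[R]_3) x v : derivable Y x v -> derivable Z x v ->
  is_derive x v (fun y => dot (Y y) (Z y)) (dot ('D_v Y x) (Z x) + dot (Y x) ('D_v Z x)).
Proof.
move=> dY dZ.
have A j : is_derive x v (fun y => Y y 0 j * Z y 0 j) ('D_v Y x 0 j * Z x 0 j + Y x 0 j * 'D_v Z x 0 j).
  have := is_deriveM (is_derive_entry j dY) (is_derive_entry j dZ).
  by move=> H; apply: is_derive_eq H _; rewrite /GRing.scale /=; ring.
have H := is_deriveD (is_deriveD (A 0) (A 1)) (A 2%:R).
under [X in is_derive _ _ X _]eq_fun do rewrite dotE.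
exact: is_derive_eq H (dot_leibniz _ _ _ _).
Qed.

Lemma is_derive_eq_on (g h : R * R -> R) x v (l m : R) : D x -> (forall y, D y -> g y = h y) ->
  is_derive x v g l -> is_derive x v h m -> l = m.
Proof.
move=> Dx E [_ <-] [_ <-]; apply: near_eq_derive.
by apply: filterS (open_nbhs_nbhs (conj oD Dx)) => y; exact: E.
Qed.

Lemma harmonic x : D x -> 'D_(1, 0) ('D_(1, 0) X) x = - 'D_(0, 1) ('D_(0, 1) X) x.
Proof.
move=> Dx.
have EGu := is_derive_eq_on Dx (fun y Dy => (confX Dy).1)
  (dot_deriv (derivable2 (1, 0) (1, 0) Dx) (derivable2 (1, 0) (1, 0) Dx))
  (dot_deriv (derivable2 (0, 1) (1, 0) Dx) (derivable2 (0, 1) (1, 0) Dx)).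
have EGv := is_derive_eq_on Dx (fun y Dy => (confX Dy).1)
  (dot_deriv (derivable2 (1, 0) (0, 1) Dx) (derivable2 (1, 0) (0, 1) Dx))
  (dot_deriv (derivable2 (0, 1) (0, 1) Dx) (derivable2 (0, 1) (0, 1) Dx)).
have Fu := is_derive_eq_on Dx (fun y Dy => (confX Dy).2)
  (dot_deriv (derivable2 (1, 0) (1, 0) Dx) (derivable2 (0, 1) (1, 0) Dx)) (is_derive_cst 0 x (1, 0)).
have Fv := is_derive_eq_on Dx (fun y Dy => (confX Dy).2)
  (dot_deriv (derivable2 (1, 0) (0, 1) Dx) (derivable2 (0, 1) (0, 1) Dx)) (is_derive_cst 0 x (0, 1)).
have [c1 c2] := confX Dx.
exact: (conformal_minimal_harmonic (mixed_partials Dx) EGu EGv Fu Fv c1 c2 (Xu_neq0 Dx) (minX Dx)).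
Qed.

Lemma phi_cderiv j x : D x -> cderiv (phi j) (Cx_of_pair x) (dphi j (Cx_of_pair x)).
Proof.
move=> Dx; rewrite /dphi Cx_of_pairK; apply: cderivP.
  have H := @C1_cgrad R (fun y => 'D_(1, 0) X y 0 j) (fun y => 'D_(1, 0) ('D_(1, 0) X) y 0 j)
    (fun y => 'D_(0, 1) ('D_(1, 0) X) y 0 j) D x oD Dx
    (fun y Dy => is_derive_entry j (derivable2 _ _ Dy)) (fun y Dy => is_derive_entry j (derivable2 _ _ Dy))
    (continuous_entry j (continuous2 _ _ Dx)) (continuous_entry j (continuous2 _ _ Dx)).
  apply: cgrad_near H _; apply: (@nearW _ (nbhs (Cx_of_pair x))) => z.
  by rewrite /phi Re_grad.
have H := @C1_cgrad R (fun y => - 'D_(0, 1) X y 0 j) (fun y => - 'D_(1, 0) ('D_(0, 1) X) y 0 j)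
  (fun y => - 'D_(0, 1) ('D_(0, 1) X) y 0 j) D x oD Dx
  (fun y Dy => is_deriveN (is_derive_entry j (derivable2 _ _ Dy)))
  (fun y Dy => is_deriveN (is_derive_entry j (derivable2 _ _ Dy))).
have E1 := congr1 (fun M : 'rV[R]_3 => M 0 j) (mixed_partials Dx).
have E2 := etrans (congr1 (fun M : 'rV[R]_3 => M 0 j) (harmonic Dx)) (entryN _ _).
apply: cgrad_eq (esym (grad_rot E1 E2)).
apply: cgrad_near (H _ _) _.
- exact: (@cvgN R R^o _ (nbhs x) _ _ _ (continuous_entry j (continuous2 _ _ Dx))).
- exact: (@cvgN R R^o _ (nbhs x) _ _ _ (continuous_entry j (continuous2 _ _ Dx))).
- by apply: (@nearW _ (nbhs (Cx_of_pair x))) => z; rewrite /phi Im_grad.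
Qed.

Lemma pair_of_Cx_continuous : continuous (@pair_of_Cx R).
Proof.
move=> z A /nbhs_pairP [d d0 hd]; apply/nbhs_cabsP; exists d => // y hy; apply: hd.
  by apply: le_lt_trans hy; rewrite -ReN -ReD Re_le_cabs.
by apply: le_lt_trans hy; rewrite -ImN -ImD Im_le_cabs.
Qed.

Lemma dphi_continuous j x : D x -> {for Cx_of_pair x, continuous (dphi j)}.
Proof.
move=> Dx.
have cc v w : {for Cx_of_pair x, continuous (fun z => 'D_w ('D_v X) (pair_of_Cx z) 0 j)}.
  have cw := continuous_entry j (continuous2 v w Dx).
  by apply: (@continuous_comp _ _ _ (@pair_of_Cx R) (fun y => 'D_w ('D_v X) y 0 j));
    [exact: pair_of_Cx_continuous | rewrite Cx_of_pairK].
exact: continuous_grad (cc (1, 0) (1, 0)) (cc (1, 0) (0, 1)).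
Qed.

Lemma phi_null x : D x ->
  phi 0 (Cx_of_pair x) ^+ 2 + phi 1 (Cx_of_pair x) ^+ 2 + phi 2%:R (Cx_of_pair x) ^+ 2 = 0.
Proof.
by move=> Dx; have [c1 c2] := confX Dx; rewrite !phiE; exact: complex_null.
Qed.

Lemma phi_neq0 x : D x -> ~ (forall j, phi j (Cx_of_pair x) = 0).
Proof.
move=> Dx p0; have := Xu_neq0 Dx; rewrite dotE.
by rewrite !derive_phi// !p0 !mul0r !addr0 eqxx.
Qed.

End ConformalMinimal.

(** * The holomorphic forms of the immersion in the charts of the surface *)

Section Surface.
Variables (R : realType) (M : riemannSurface R) (f : M -> 'rV[R]_3).
Hypotheses (sm : smooth_map f) (im : immersion f) (co : conformal f) (mi : minimal f).
Implicit Types (e : chart R M) (z w l : Cx R) (s : R -> M) (p q : M).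

Definition cdom e : set (Cx R) := chart_map e @` chart_dom e.

Lemma cdom_map e p : chart_dom e p -> cdom e (chart_map e p).
Proof. by move=> ep; exists p. Qed.

Lemma cdom_open e : open (cdom e). Proof. exact: chart_im_open. Qed.

Lemma cdom_near e z : cdom e z -> \forall w \near z, cdom e w.
Proof. by move=> ez; apply: open_nbhs_nbhs; split => //; exact: cdom_open. Qed.

Lemma dom_near e p : chart_dom e p -> \forall q \near p, chart_dom e q.
Proof. by move=> ep; apply: open_nbhs_nbhs; split => //; exact: chart_dom_open. Qed.

Lemma chart_invK e z : cdom e z -> chart_map e (chart_inv e z) = z.
Proof. by move=> [p ep <-]; rewrite chart_mapK. Qed.

Lemma chart_inv_dom e z : cdom e z -> chart_dom e (chart_inv e z).
Proof. by move=> [p ep <-]; rewrite chart_mapK. Qed.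

Lemma coord_dom_open e : open (coord_dom e).
Proof.
rewrite openE => x; rewrite /coord_dom /= => ex.
exact: (@Cx_of_pair_continuous R x _ (cdom_near ex)).
Qed.

#[local] Arguments coord_dom_open : clear implicits.

Lemma coord_domE e z : cdom e z -> coord_dom e (pair_of_Cx z).
Proof. by rewrite /coord_dom /= pair_of_CxK. Qed.

Definition ph e (j : 'I_3) : Cx R -> Cx R := phi (in_chart f e) j.
Definition dph e (j : 'I_3) : Cx R -> Cx R := dphi (in_chart f e) j.

Lemma ph_cgrad e j z : atlas e -> cdom e z ->
  cgrad (fun w => f (chart_inv e w) 0 j) z (ph e j z).
Proof.
move=> ae ez; have := phi_cgrad (coord_dom_open e) (sm ae) j (coord_domE ez).
rewrite pair_of_CxK => H; apply: cgrad_near H _.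
by apply: (@nearW _ (nbhs z)) => w; rewrite /in_chart pair_of_CxK.
Qed.

Lemma ph_cderiv e j z : atlas e -> cdom e z -> cderiv (ph e j) z (dph e j z).
Proof.
move=> ae ez.
by have := phi_cderiv (coord_dom_open e) (sm ae) (co ae) (im ae) (mi ae) j (coord_domE ez); rewrite pair_of_CxK.
Qed.

Lemma dph_continuous e j z : atlas e -> cdom e z -> {for z, continuous (dph e j)}.
Proof.
by move=> ae ez; have := dphi_continuous (sm ae) (j := j) (coord_domE ez); rewrite pair_of_CxK.
Qed.

Lemma ph_null e z : atlas e -> cdom e z -> ph e 0 z ^+ 2 + ph e 1 z ^+ 2 + ph e 2%:R z ^+ 2 = 0.
Proof.
by move=> ae ez; have := phi_null (co ae) (coord_domE ez); rewrite pair_of_CxK.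
Qed.

Lemma ph_neq0 e z : atlas e -> cdom e z -> ~ (forall j, ph e j z = 0).
Proof.
by move=> ae ez; have := phi_neq0 (coord_dom_open e) (sm ae) (im ae) (coord_domE ez); rewrite pair_of_CxK.
Qed.

Lemma derive_ph e j p v : atlas e -> chart_dom e p ->
  'D_v (in_chart f e) (coords e p) 0 j = Re (ph e j (chart_map e p) * Cx_of_pair v).
Proof.
by move=> ae ep; have := derive_phi (coord_dom_open e) (sm ae) j v (coord_domE (cdom_map ep)); rewrite pair_of_CxK.
Qed.

(* [phA] and [phB] are the complex gradients of x + iy and x - iy along the surface. *)
Definition phA e z := ph e 0 z + ci R * ph e 1 z.
Definition phB e z := ph e 0 z - ci R * ph e 1 z.

Lemma phAB e z : atlas e -> cdom e z -> phA e z * phB e z = - ph e 2%:R z ^+ 2.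
Proof.
move=> ae ez; have H := ph_null ae ez.
have -> : phA e z * phB e z = ph e 0 z ^+ 2 - (ci R * ci R) * ph e 1 z ^+ 2 by rewrite /phA /phB; ring.
by apply/eqP; rewrite ci_sqr mulN1r opprK -addr_eq0; apply/eqP.
Qed.

(** If both vanish, so do the first two components, and the null relation kills the third, against
    immersion. Positivity of the conformal factor and invertibility of [zeta] both come from
    here. *)
Lemma phAB_neq0 e z : atlas e -> cdom e z -> ~ (phA e z = 0 /\ phB e z = 0).
Proof.
move=> ae ez [a0 b0]; apply: (ph_neq0 ae ez).
have two : (2 : Cx R) != 0 by rewrite pnatr_eq0.
have p0 : ph e 0 z = 0.
  by apply: (mulfI two); rewrite mulr0 -[RHS](addr0 0) -{1}a0 -b0 /phA /phB; ring.
have p1 : ph e 1 z = 0.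
  by move: a0; rewrite /phA p0 add0r => /eqP; rewrite mulf_eq0 (negPf (ci_neq0 R)) => /eqP.
have p2 : ph e 2%:R z = 0.
  have := phAB ae ez; rewrite a0 mul0r => /esym/eqP.
  by rewrite oppr_eq0 expf_eq0 => /eqP.
move=> j; have [->|[->|->]] : j = 0 \/ j = 1 \/ j = 2%:R => //.
by case: j => [[|[|[|//]]]] ij; [left|right; left|right; right]; apply: val_inj.
Qed.

Definition dphA e z := dph e 0 z + ci R * dph e 1 z.
Definition dphB e z := dph e 0 z - ci R * dph e 1 z.

Lemma phA_cderiv e z : atlas e -> cdom e z -> cderiv (phA e) z (dphA e z).
Proof. by move=> ae ez; apply: cderivD (ph_cderiv _ ae ez) (cderivZ _ (ph_cderiv _ ae ez)). Qed.

Lemma phB_cderiv e z : atlas e -> cdom e z -> cderiv (phB e) z (dphB e z).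
Proof. by move=> ae ez; apply: cderivB (ph_cderiv _ ae ez) (cderivZ _ (ph_cderiv _ ae ez)). Qed.

Lemma continuousD_Cx (T : topologicalType) (x : T) (g h : T -> Cx R) :
  {for x, continuous g} -> {for x, continuous h} -> {for x, continuous (fun y => g y + h y)}.
Proof.
move=> /continuous_cabsP cg /continuous_cabsP ch; apply/continuous_cabsP => d d0.
have d2 : 0 < d / 2 by lra.
apply: filterS2 (cg _ d2) (ch _ d2) => y h1 h2.
have -> : g y + h y - (g x + h x) = (g y - g x) + (h y - h x) by ring.
by apply: (le_lt_trans (cabsD _ _)); exact: ltr_half.
Qed.

Lemma continuousM_Cx (T : topologicalType) (x : T) (g h : T -> Cx R) :
  {for x, continuous g} -> {for x, continuous h} -> {for x, continuous (fun y => g y * h y)}.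
Proof. by move=> cg ch; exact: (@cvgM _ _ (nbhs x) _ _ _ _ _ cg ch). Qed.

Lemma continuousV_Cx (T : topologicalType) (x : T) (g : T -> Cx R) : g x != 0 ->
  {for x, continuous g} -> {for x, continuous (fun y => (g y)^-1)}.
Proof.
move=> g0 cg; have cV := cderiv_continuous (cderivV_id g0).
exact: (@continuous_comp _ _ _ g (fun z : Cx R => z^-1) x cg cV).
Qed.

Lemma dphB_continuous e z : atlas e -> cdom e z -> {for z, continuous (dphB e)}.
Proof.
move=> ae ez; apply: continuousD_Cx; first exact: dph_continuous.
have -> : (fun y => - (ci R * dph e 1 y)) = (fun y => (- ci R) * dph e 1 y) by apply/funext => y; ring.
by apply: continuousM_Cx; [exact: (cderiv_continuous (cderiv_cst _ z)) | exact: dph_continuous].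
Qed.

Lemma dphA_continuous e z : atlas e -> cdom e z -> {for z, continuous (dphA e)}.
Proof.
move=> ae ez; apply: continuousD_Cx; first exact: dph_continuous.
by apply: continuousM_Cx; [exact: (cderiv_continuous (cderiv_cst _ z)) | exact: dph_continuous].
Qed.

Lemma derivable_cderiv (h : Cx R -> Cx R) z : derivable h z 1 -> cderiv h z ('D_1 h z).
Proof.
move=> dh k k0.
have : k^-1 *: (h (k *: 1 + z) - h z) @[k --> 0^'] --> ('D_1 h z : Cx R) by exact: dh.
rewrite /dnbhs => cv.
have /nbhs_cabsP [d d0 hd] := cv _ (near_cabs ('D_1 h z) k0).
apply/nbhs_cabsP; exists d => // y hy.
have [->|yz] := eqVneq y z; first by rewrite !subrr mulr0 subr0 cabs0 mulr0.
have yz0 : y - z != 0 by rewrite subr_eq0.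
have := hd (y - z); rewrite subr0 => /(_ hy yz0) /=.
rewrite [_ *: 1]mulr1 subrK /GRing.scale /= => H.
have -> : h y - h z - 'D_1 h z * (y - z) = ((y - z)^-1 * (h y - h z) - 'D_1 h z) * (y - z).
  by rewrite mulrBl mulrAC mulVf// mul1r.
by rewrite cabsM ler_wpM2r ?cabs_ge0// ltW.
Qed.

Definition trans e1 e2 : Cx R -> Cx R := chart_map e2 \o chart_inv e1.

Definition overlap e1 e2 : set (Cx R) := chart_map e1 @` (chart_dom e1 `&` chart_dom e2).

Lemma overlapP e1 e2 z : overlap e1 e2 z <-> cdom e1 z /\ chart_dom e2 (chart_inv e1 z).
Proof.
split=> [[p [p1 p2] <-]|[ez e2z]]; first by rewrite chart_mapK//; split=> //; exact: cdom_map.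
by exists (chart_inv e1 z); [split => //; exact: chart_inv_dom | exact: chart_invK].
Qed.

Lemma overlap_near e1 e2 z : overlap e1 e2 z -> \forall w \near z, overlap e1 e2 w.
Proof.
move=> /overlapP [ez e2z].
have n1 := chart_inv_continuous ez (dom_near e2z).
by apply: filterS2 (cdom_near ez) n1 => w h1 h2; apply/overlapP.
Qed.

Definition dtrans e1 e2 z : Cx R := 'D_1 (trans e1 e2) z.

Lemma continuous_near_eq (T : topologicalType) (x : T) (g h : T -> Cx R) :
  (\forall y \near x, g y = h y) -> {for x, continuous g} -> {for x, continuous h}.
Proof.
move=> E /continuous_cabsP cg; apply/continuous_cabsP => d d0.
have Ex := nbhs_singleton E.
by apply: filterS2 E (cg _ d0) => y Ey; rewrite Ey Ex.
Qed.

Lemma trans_cderiv e1 e2 z : atlas e1 -> atlas e2 -> overlap e1 e2 z ->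
  cderiv (trans e1 e2) z (dtrans e1 e2 z).
Proof. by move=> a1 a2 oz; apply: derivable_cderiv; exact: atlas_holomorphic. Qed.

(** The chain rule for gradients; it says that [ph e j dz] is a one-form on the surface, so that
    germs can be moved between charts. *)
Lemma ph_trans e1 e2 j z : atlas e1 -> atlas e2 -> overlap e1 e2 z ->
  ph e1 j z = ph e2 j (trans e1 e2 z) * dtrans e1 e2 z.
Proof.
move=> a1 a2 oz; have /overlapP [ez e2z] := oz.
have H := cgrad_comp (trans_cderiv a1 a2 oz) (ph_cgrad j a2 (cdom_map e2z)).
apply: cgrad_unique (ph_cgrad j a1 ez) _.
apply: cgrad_near H _; apply: filterS (overlap_near oz) => w /overlapP [ew e2w].
by rewrite /trans /= chart_mapK.
Qed.

(** The atlas asserts only differentiability of transition maps. Continuity of the derivative is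
    read off the surface: near [z], [dtrans] is a quotient of components [ph], for an index [j] at
    which the denominator is nonzero. *)
Lemma trans_continuous e1 e2 z : atlas e1 -> atlas e2 -> overlap e1 e2 z ->
  {for z, continuous (dtrans e1 e2)}.
Proof.
move=> a1 a2 oz; have /overlapP [ez e2z] := oz.
have [j pj] : exists j, ph e2 j (trans e1 e2 z) != 0.
  apply: contrapT => H; apply: (ph_neq0 a2 (cdom_map e2z)) => j.
  by apply/eqP; apply: contrapT => /negP pj; apply: H; exists j.
have c2 : {for z, continuous (fun w => ph e2 j (trans e1 e2 w))}.
  apply: (@continuous_comp _ _ _ (trans e1 e2) (ph e2 j)).
    exact: cderiv_continuous (trans_cderiv a1 a2 oz).
  exact: cderiv_continuous (ph_cderiv j a2 (cdom_map e2z)).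
have c3 : {for z, continuous (fun w => ph e1 j w * (ph e2 j (trans e1 e2 w))^-1)}.
  apply: continuousM_Cx; first exact: cderiv_continuous (ph_cderiv j a1 ez).
  exact: continuousV_Cx.
have nz : \forall w \near z, ph e2 j (trans e1 e2 w) != 0.
  have := c2 [set w | w != 0]; apply; apply/nbhs_cabsP.
  exists (cabs (ph e2 j (trans e1 e2 z))); first by rewrite cabs_gt0.
  move=> y hy /=; apply/eqP => y0; move: hy; rewrite y0 sub0r cabsN; lra.
have E : \forall w \near z, ph e1 j w * (ph e2 j (trans e1 e2 w))^-1 = dtrans e1 e2 w.
  apply: filterS2 nz (overlap_near oz) => w w0 ow.
  by rewrite (ph_trans j a1 a2 ow) mulrAC divff// mul1r.
exact: continuous_near_eq E c3.
Qed.

End Surface.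

Section PlaneCurves.
Variable R : realType.

Lemma derivable_pair (c : R -> R * R) (t : R) : derivable c t 1 ->
  is_derive t 1 (fun s : R => (c s).1) ('D_1 c t).1 /\ is_derive t 1 (fun s : R => (c s).2) ('D_1 c t).2.
Proof.
move=> dc.
have cv : k^-1 *: (c (k *: 1 + t) - c t) @[k --> 0^'] --> ('D_1 c t : R * R) by exact: dc.
have H (d : R) : 0 < d -> \forall k \near 0^', `|(k^-1 *: (c (k *: 1 + t) - c t)).1 - ('D_1 c t).1| < d /\
    `|(k^-1 *: (c (k *: 1 + t) - c t)).2 - ('D_1 c t).2| < d.
  move=> d0; apply: (cv [set x : R * R | `|x.1 - ('D_1 c t).1| < d /\ `|x.2 - ('D_1 c t).2| < d]).
  by apply/nbhs_pairP; exists d => //.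
have c1 : k^-1 *: ((c (k *: 1 + t)).1 - (c t).1) @[k --> 0^'] --> (('D_1 c t).1 : R).
  by apply/cvgrPdist_lt => d d0; apply: filterS (H d d0) => k [h _]; rewrite distrC.
have c2 : k^-1 *: ((c (k *: 1 + t)).2 - (c t).2) @[k --> 0^'] --> (('D_1 c t).2 : R).
  by apply/cvgrPdist_lt => d d0; apply: filterS (H d d0) => k [_ h]; rewrite distrC.
by split; (split; [apply: cvgP; first exact: c1 || exact: c2 | by apply: cvg_lim; first exact: Rhausdorff; exact: c1 || exact: c2]).
Qed.

Lemma is_derive_pair (c : R -> R * R) (t a b : R) : is_derive t 1 (fun s : R => (c s).1) a ->
  is_derive t 1 (fun s : R => (c s).2) b -> is_derive t 1 c (a, b).
Proof.
move=> /is_deriveP H1 /is_deriveP H2.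
have cv : k^-1 *: (c (k *: 1 + t) - c t) @[k --> 0^'] --> ((a, b) : R * R).
  move=> A /nbhs_pairP [d d0 hd].
  have d2 : 0 < d / 2 by lra.
  have /nbhs_ballP [r /= r0 hr] := near_and (H1 _ d2) (H2 _ d2).
  apply/nbhs_ballP; exists r => // k /= hk k0; apply: hd => /=.
    have [|+ _] := hr (k + t).
      by move: hk; rewrite /ball /= sub0r normrN opprD addrCA subrr addr0 normrN.
    have kn : 0 < `|k| by rewrite normr_gt0.
    rewrite addrK [k *: 1]mulr1 => H; rewrite -(ltr_pM2r kn) -normrM mulrBl /GRing.scale /=.
    rewrite mulrAC mulVf// mul1r; apply: (le_lt_trans H).
    by rewrite ltr_pM2r//; lra.
  have [|_ +] := hr (k + t).
    by move: hk; rewrite /ball /= sub0r normrN opprD addrCA subrr addr0 normrN.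
  have kn : 0 < `|k| by rewrite normr_gt0.
  rewrite addrK [k *: 1]mulr1 => H; rewrite -(ltr_pM2r kn) -normrM mulrBl /GRing.scale /=.
  rewrite mulrAC mulVf// mul1r; apply: (le_lt_trans H).
  by rewrite ltr_pM2r//; lra.
split; first exact: cvgP cv.
exact: cvg_lim cv.
Qed.

(* [A = a0 + i a1] and [B = a0 - i a1] for an isotropic vector [a]. *)
Lemma isotropic_Re_norm (a0 a1 a2 : Cx R) : a0 ^+ 2 + a1 ^+ 2 + a2 ^+ 2 = 0 ->
  Re a0 ^+ 2 + Re a1 ^+ 2 + Re a2 ^+ 2 = ((cabs (a0 + ci R * a1) + cabs (a0 - ci R * a1)) / 2) ^+ 2.
Proof.
move=> H.
have AB : cabs (a0 + ci R * a1) * cabs (a0 - ci R * a1) = cabs a2 ^+ 2.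
  rewrite -cabsM -cabsX -cabsN; congr cabs.
  have -> : (a0 + ci R * a1) * (a0 - ci R * a1) = a0 ^+ 2 - (ci R * ci R) * a1 ^+ 2 by ring.
  by apply/eqP; rewrite ci_sqr mulN1r opprK eq_sym -addr_eq0 addrC H.
have -> : ((cabs (a0 + ci R * a1) + cabs (a0 - ci R * a1)) / 2) ^+ 2 =
    (cabs (a0 + ci R * a1) ^+ 2 + cabs (a0 - ci R * a1) ^+ 2) / 4 +
    (cabs (a0 + ci R * a1) * cabs (a0 - ci R * a1)) / 2 by field.
rewrite AB !sqr_cabs.
have HR := congr1 (fun z : Cx R => Re z) H; rewrite !expr2 !ReImE /= in HR.
rewrite !ReImE !expr2; lra.
Qed.

End PlaneCurves.

Lemma continuousZ_Cx (R : realType) (T : topologicalType) (x : T) (g : T -> Cx R) (c : Cx R) :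
  {for x, continuous g} -> {for x, continuous (fun y => c * g y)}.
Proof.
have cc := cderiv_continuous (cderivZ c (cderiv_id (g x))).
by move=> cg; exact: (@continuous_comp _ _ _ g (fun z => c * z) x cg cc).
Qed.

(** * Length of curves on the surface *)

Section Curves.
Variables (R : realType) (M : riemannSurface R) (f : M -> 'rV[R]_3).
Hypotheses (sm : smooth_map f) (im : immersion f) (co : conformal f) (mi : minimal f).
Implicit Types (e : chart R M) (z w l : Cx R) (s : R -> M) (p q : M) (I : set R).

Definition vel e s (t : R) : Cx R := Cx_of_pair ('D_1 (coords e \o s) t).

Lemma C1_curve e I s t : atlas e -> curve_Cn 1 I s -> I t -> chart_dom e (s t) ->
  vderiv (chart_map e \o s) t (vel e s t) /\ {for t, continuous (vel e s)}.
Proof.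
move=> ae [cs /(_ e ae) [_ /(_ 1) [ds [cds _]]]] It et.
have It' : (I `&` s @^-1` chart_dom e) t by [].
have [d1 d2] := derivable_pair (ds t It').
split; first exact: (@vderivP _ (chart_map e \o s) t (vel e s t) d1 d2).
apply: (@continuous_comp _ _ _ ('D_1 (coords e \o s)) (@Cx_of_pair R)); first exact: cds.
exact: Cx_of_pair_continuous.
Qed.

Lemma chart_curve_continuous e s t : chart_dom e (s t) -> {for t, continuous s} ->
  {for t, continuous (chart_map e \o s)}.
Proof. by move=> et cs; apply: continuous_comp => //; exact: chart_map_continuous. Qed.

Definition fvel e z l : 'rV[R]_3 := \row_j Re (ph f e j z * l).

Lemma deriv_f e s t l : atlas e -> chart_dom e (s t) -> {for t, continuous s} ->
  vderiv (chart_map e \o s) t l -> is_derive t 1 (f \o s) (fvel e (chart_map e (s t)) l).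
Proof.
move=> ae et cs ds.
have H j : is_derive t 1 (fun t' : R => (f \o s) t' 0 j) (Re (ph f e j (chart_map e (s t)) * l)).
  have ds' := is_derive_comp_cgrad ds (ph_cgrad sm j ae (cdom_map et)).
  have E : \forall t' \near t, ((fun w => f (chart_inv e w) 0 j) \o (chart_map e \o s)) t' = (f \o s) t' 0 j.
    have nt := cs _ (dom_near et).
    by apply: (@filterS _ (nbhs t) _ _ _ _ nt) => t' /= et'; rewrite chart_mapK.
  exact: near_eq_is_derive E ds'.
have df : derivable (f \o s) t 1.
  by apply/derivable_mxP => i j; rewrite (ord1 i); have [dfj _] := H j.
split => //; rewrite derive_mx//; apply/rowP => j; rewrite !mxE.
by have [_ <-] := H j.
Qed.

(** Isotropy eliminates the third coordinate from the length element, which becomes the mean of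
    [|A dw|] and [|B dw|]. Lower bounds in charts and upper bounds along complex times both rest on
    this formula. *)
Lemma fvel_norm e z l : atlas e -> cdom e z ->
  enorm (fvel e z l) = (cabs (phA f e z * l) + cabs (phB f e z * l)) / 2.
Proof.
move=> ae ez; rewrite /enorm dotE /fvel !mxE -!expr2.
have N : (ph f e 0 z * l) ^+ 2 + (ph f e 1 z * l) ^+ 2 + (ph f e 2%:R z * l) ^+ 2 = 0.
  by rewrite !exprMn -!mulrDl (ph_null co ae ez) mul0r.
rewrite (isotropic_Re_norm N) sqrtr_sqr ger0_norm; last by rewrite divr_ge0// addr_ge0// cabs_ge0.
by congr ((cabs _ + cabs _) / 2); rewrite /phA /phB; ring.
Qed.

Lemma speedE e I s t : atlas e -> curve_Cn 1 I s -> I t -> chart_dom e (s t) ->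
  enorm (derive1 (f \o s) t) =
  (cabs (phA f e (chart_map e (s t)) * vel e s t) + cabs (phB f e (chart_map e (s t)) * vel e s t)) / 2.
Proof.
move=> ae cs It et; have [dv _] := C1_curve ae cs It et.
have [_ E] := deriv_f ae et (cs.1 t It) dv.
by rewrite derive1E E fvel_norm//; exact: cdom_map.
Qed.

Lemma continuous_half_sum (a b : R -> Cx R) t : {for t, continuous a} -> {for t, continuous b} ->
  {for t, continuous (fun r => (cabs (a r) + cabs (b r)) / 2)}.
Proof.
move=> /continuous_cabs_comp ca /continuous_cabs_comp cb.
apply: (@cvgM _ _ (nbhs t)); last exact: cvg_cst.
exact: (@cvgD _ R^o _ (nbhs t) _ _ _ _ _ ca cb).
Qed.

Lemma speed_continuous I s t : open I -> curve_Cn 1 I s -> I t ->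
  {for t, continuous (fun r => enorm (derive1 (f \o s) r))}.
Proof.
move=> oI cs It; have [e ae et] := atlas_cover (s t).
have [dv cv] := C1_curve ae cs It et.
have cw := chart_curve_continuous et (cs.1 t It).
have cA : {for t, continuous (fun r => phA f e (chart_map e (s r)) * vel e s r)}.
  apply: continuousM_Cx cv; apply: (@continuous_comp _ _ _ (chart_map e \o s) (phA f e)); first exact: cw.
  exact: cderiv_continuous (phA_cderiv sm im co mi ae (cdom_map et)).
have cB : {for t, continuous (fun r => phB f e (chart_map e (s r)) * vel e s r)}.
  apply: continuousM_Cx cv; apply: (@continuous_comp _ _ _ (chart_map e \o s) (phB f e)); first exact: cw.
  exact: cderiv_continuous (phB_cderiv sm im co mi ae (cdom_map et)).
have E : \forall r \near t, enorm (derive1 (f \o s) r) =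
   (cabs (phA f e (chart_map e (s r)) * vel e s r) + cabs (phB f e (chart_map e (s r)) * vel e s r)) / 2.
  have nI : \forall r \near t, I r by exact: open_nbhs_nbhs.
  apply: filterS2 nI (cs.1 t It _ (dom_near et)) => r Ir er.
  exact: speedE cs Ir er.
have := continuous_half_sum cA cB.
move=> /(@cvgrPdist_lt _ _ _ (nbhs t)) c; apply/(@cvgrPdist_lt _ _ _ (nbhs t)) => d d0.
have Et := nbhs_singleton E.
by apply: filterS2 E (c d d0) => r Er; rewrite Et Er.
Qed.

Lemma speed_ge0 (v : 'rV[R]_3) : 0 <= enorm v. Proof. exact: sqrtr_ge0. Qed.

Lemma speed_integrable I s (a b : R) : open I -> curve_Cn 1 I s -> `[a, b] `<=` I ->
  lebesgue_measure.-integrable `[a, b] (EFin \o (fun r => enorm (derive1 (f \o s) r))).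
Proof.
move=> oI cs sub; apply: continuous_compact_integrable; first exact: segment_compact.
apply: within_continuous => r hr; apply: speed_continuous oI cs _.
by apply: sub; rewrite /= in_itv.
Qed.

Lemma arc_length_ge0 s (a b : R) : (0 <= arc_length f s a b)%E.
Proof. by apply: integral_ge0 => r _; rewrite lee_fin speed_ge0. Qed.

Lemma arc_length_mono I s (a a' b : R) : open I -> curve_Cn 1 I s -> `[a, b] `<=` I ->
  a <= a' -> (arc_length f s a' b <= arc_length f s a b)%E.
Proof.
move=> oI cs sub aa'; apply: ge0_subset_integral => //.
- by apply: measurable_int; exact: speed_integrable oI cs sub.
- by move=> r _; rewrite lee_fin speed_ge0.
- by move=> r /=; rewrite !in_itv /= => /andP[r1 ->]; rewrite andbT (le_trans aa').
Qed.

Lemma arc_length_le I s (a b K : R) : open I -> curve_Cn 1 I s -> `[a, b] `<=` I -> a <= b ->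
  (forall t, a <= t <= b -> enorm (derive1 (f \o s) t) <= K) ->
  (arc_length f s a b <= (K * (b - a))%:E)%E.
Proof.
move=> oI cs sub ab HK.
have -> : (K * (b - a))%:E = (\int[lebesgue_measure]_(x in `[a, b]) cst K%:E x)%E.
  rewrite integral_cst//= lebesgue_measure_itv /= lte_fin.
  have [|ba] := ltP a b; first by rewrite -EFinB -EFinM.
  have E : b = a :> R by apply: le_anti; rewrite ba ab.
  by rewrite E subrr mulr0 mule0.
apply: le_integral => //.
- exact: speed_integrable oI cs sub.
- apply: continuous_compact_integrable; first exact: segment_compact.
  by apply: within_continuous => r _; exact: cvg_cst.
- by move=> r; rewrite inE /= in_itv /= => hr; rewrite lee_fin HK.
Qed.

(** The chart displacement is the integral of the velocity projected on the direction of that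
    displacement, and [c] times this projection is at most the speed. *)
Lemma arc_length_ge e I s (a b c : R) : atlas e -> open I -> curve_Cn 1 I s -> `[a, b] `<=` I ->
  a <= b -> 0 <= c ->
  (forall t, a <= t <= b -> chart_dom e (s t)) ->
  (forall t, a <= t <= b ->
    c <= (cabs (phA f e (chart_map e (s t))) + cabs (phB f e (chart_map e (s t)))) / 2) ->
  ((c * cabs (chart_map e (s b) - chart_map e (s a)))%:E <= arc_length f s a b)%E.
Proof.
move=> ae oI cs sub ab c0 hd hc.
have [<-|aneb] := eqVneq a b.
  by rewrite subrr cabs0 mulr0 arc_length_ge0.
have altb : a < b by rewrite lt_neqAle aneb.
have It t : a <= t <= b -> I t by move=> ht; apply: sub; rewrite /= in_itv.
set d := chart_map e (s b) - chart_map e (s a).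
have [d0|dn] := eqVneq d 0; first by rewrite d0 cabs0 mulr0 arc_length_ge0.
have cd : 0 < cabs d by rewrite cabs_gt0.
(* [u] has modulus [c] and turns the displacement [d] onto the positive real axis. *)
pose u : Cx R := rc (c / cabs d) * d^*%C.
have cu : cabs u = c by rewrite /u cabsM cabs_rc cabsJ ger0_norm ?divfK ?gt_eqF// divr_ge0// ltW.
have ud : Re (u * d) = c * cabs d.
  rewrite /u -mulrA [_^*%C * d]mulrC mul_conjc -rcM Re_rc.
  by field; rewrite gt_eqF.
pose g t := Re (u * chart_map e (s t)).
pose g' t := Re (u * vel e s t).
have dg t : a <= t <= b -> is_derive t 1 g (g' t).
  move=> ht; have [dv _] := C1_curve ae cs (It t ht) (hd t ht).
  exact: vderiv_Re (vderivZ u dv).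
have cg' t : a <= t <= b -> {for t, continuous g'}.
  move=> ht; have [_ cv] := C1_curve ae cs (It t ht) (hd t ht).
  have cc : {for t, continuous (fun r => u * vel e s r)}.
    exact: continuousZ_Cx cv.
  exact: (@continuous_comp _ _ _ (fun r => u * vel e s r) (fun z : Cx R => Re z) t cc (@Re_continuous R _)).
have FTC := @continuous_FTC2 R g' g a b altb (within_continuous cg') _ _.
have -> : (c * cabs d)%:E = ((g b)%:E - (g a)%:E)%E.
  by rewrite -EFinB /g -ReN -ReD -mulrBr ud.
rewrite -FTC; first last.
- by move=> t; rewrite in_itv /= => /andP[t1 t2]; rewrite derive1E; have [|_ ->] := dg t; first by rewrite !ltW.
- split.
  + by move=> t; rewrite in_itv /= => /andP[t1 t2]; have [|? _] := dg t; first by rewrite !ltW.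
  + by apply: cvg_at_right_filter; apply: is_derive_continuous (dg a _); rewrite lexx.
  + by apply: cvg_at_left_filter; apply: is_derive_continuous (dg b _); rewrite lexx andbT.
apply: le_integral => //.
- apply: continuous_compact_integrable; first exact: segment_compact.
  exact: within_continuous cg'.
- exact: speed_integrable oI cs sub.
- move=> t; rewrite inE /= in_itv /= => ht; rewrite lee_fin.
  rewrite (speedE ae cs (It t ht) (hd t ht)) /g'.
  apply: (le_trans (ler_norm _)); apply: (le_trans (Re_le_cabs _)).
  rewrite (cabsM u) cu [cabs (phA _ _ _ * _)]cabsM [cabs (phB _ _ _ * _)]cabsM -mulrDl mulrAC ler_wpM2r ?cabs_ge0//.
  exact: hc.
Qed.

End Curves.

Section PlaneSets.
Variable R : realType.

Lemma closed_disk_compact (w0 : Cx R) (rho : R) :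
  compact [set x : R * R | cabs (Cx_of_pair x - w0) <= rho].
Proof.
pose B : set (R * R) := `[Re w0 - rho, Re w0 + rho] `*` `[Im w0 - rho, Im w0 + rho].
have cB : compact B by apply: compact_setX; exact: segment_compact.
apply: (subclosed_compact _ cB).
  have -> : [set x : R * R | cabs (Cx_of_pair x - w0) <= rho] =
      (fun x => cabs (Cx_of_pair x - w0)) @^-1` [set y : R | y <= rho] by [].
  have cc (x : R * R) : {for x, continuous (fun x => cabs (Cx_of_pair x - w0))}.
    apply: (@continuous_cabs_comp _ _ x (fun x => Cx_of_pair x - w0)).
    apply: (@continuous_comp _ _ _ (@Cx_of_pair R) (fun z => z - w0)); first exact: Cx_of_pair_continuous.
    exact: cderiv_continuous (cderivB (cderiv_id _) (cderiv_cst w0 _)).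
  by apply: closed_comp => [x _|]; [exact: cc | exact: closed_le].
move=> x /= hx; have h1 := Re_le_cabs (Cx_of_pair x - w0); have h2 := Im_le_cabs (Cx_of_pair x - w0).
rewrite ReD ReN /= in h1; rewrite ImD ImN /= in h2.
by move: h1 h2; rewrite /B /= !in_itv /= !ler_norml => /andP[? ?] /andP[? ?]; split; apply/andP; split; lra.
Qed.

Lemma near_ge_half (T : topologicalType) (x : T) (g : T -> R) : 0 < g x -> {for x, continuous g} ->
  \forall y \near x, g x / 2 <= g y.
Proof.
move=> g0 /(@cvgrPdist_lt _ _ _ (nbhs x)) cg; have g2 : 0 < g x / 2 by lra.
apply: filterS (cg _ g2) => y; rewrite ltr_norml => /andP[_]; lra.
Qed.

(** On a one-dimensional domain the derivative in direction [v] is [v] times the ordinary one. *)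
Lemma Cn1_R (D : set R) (c d : R -> R * R) : open D -> (forall x, D x -> is_derive x 1 c (d x)) ->
  (forall x, D x -> {for x, continuous d}) -> Cn 1 D c.
Proof.
move=> oD Hc Hd.
have df x : D x -> differentiable c x by move=> /Hc [h _]; apply/derivable1_diffP.
have DE x v : D x -> 'D_v c x = v *: d x.
  move=> Dx; have [_ <-] := Hc x Dx.
  have dx := df x Dx; rewrite (deriveE _ dx) (deriveE _ dx).
  have E : v = v *: (1 : R^o) by rewrite /GRing.scale /= mulr1.
  by rewrite {1}E linearZ.
split; first by move=> x /df; exact: differentiable_continuous.
move=> v; split; first by move=> x /df; exact: diff_derivable.
split => // x Dx.
have nD : \forall y \near x, D y by exact: open_nbhs_nbhs.
have cd : {for x, continuous (fun y => v *: d y)}.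
  by apply: (@cvgZr _ _ _ (nbhs x)); exact: Hd.
have E : \forall y \near x, v *: d y = 'D_v c y by apply: filterS nD => y Dy; rewrite DE.
move=> A; rewrite -(nbhs_singleton E) => /cd nA.
by apply: filterS2 E nA => y /= <-.
Qed.

End PlaneSets.

(** * Induced distance and chart topology *)

Section Metric.
Variables (R : realType) (M : riemannSurface R) (f : M -> 'rV[R]_3).
Hypotheses (sm : smooth_map f) (im : immersion f) (co : conformal f) (mi : minimal f).
Implicit Types (e : chart R M) (z w l : Cx R) (s : R -> M) (p q : M) (I : set R).

(** The disk is compact as a continuous image, hence closed because [M] is Hausdorff. This prevents
    a curve from leaving the chart domain while its coordinate converges inside the disk. *)
Lemma chart_disk_closed e (w0 : Cx R) (rho : R) : (forall w, cabs (w - w0) <= rho -> cdom e w) ->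
  closed [set p | chart_dom e p /\ cabs (chart_map e p - w0) <= rho].
Proof.
move=> hd.
have -> : [set p | chart_dom e p /\ cabs (chart_map e p - w0) <= rho] =
   (chart_inv e \o @Cx_of_pair R) @` [set x : R * R | cabs (Cx_of_pair x - w0) <= rho].
  apply/seteqP; split=> [p [ep hp]|_ [x hx <-]] /=.
    exists (pair_of_Cx (chart_map e p)); rewrite /= pair_of_CxK//.
    by rewrite chart_mapK.
  have ex := hd _ hx; split; first exact: chart_inv_dom.
  by rewrite chart_invK.
apply: compact_closed; first exact: rs_hausdorff.
apply: continuous_compact; last exact: closed_disk_compact.
apply: continuous_in_subspaceT => x; rewrite inE /= => hx.
apply: (@continuous_comp _ _ _ (@Cx_of_pair R) (chart_inv e)); first exact: Cx_of_pair_continuous.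
exact: chart_inv_continuous (hd _ hx).
Qed.

(** The conformal factor: the ratio of Euclidean speed to the modulus of the chart velocity. *)
Definition mlow e w : R := (cabs (phA f e w) + cabs (phB f e w)) / 2.

(* Going backwards from [s b], the arc cannot leave the disk: it would first
   have to cross a compact smaller disk, and its length is too small for that. *)
Lemma arc_stays e I s (a b c r L : R) (w0 : Cx R) : atlas e -> open I -> curve_Cn 1 I s ->
  `[a, b] `<=` I -> a <= b -> 0 < c ->
  (forall w, cabs (w - w0) < r -> cdom e w /\ c <= mlow e w) ->
  chart_dom e (s b) -> (arc_length f s a b <= L%:E)%E ->
  c * cabs (chart_map e (s b) - w0) + L < c * r ->
  [/\ chart_dom e (s a), cabs (chart_map e (s a) - w0) < r &
      c * cabs (chart_map e (s b) - chart_map e (s a)) <= L].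
Proof.
move=> ae oI cs sub ab c0 hw eb hL hr.
have L0 : 0 <= L by rewrite -lee_fin; apply: le_trans hL; exact: arc_length_ge0.
have It t : a <= t <= b -> I t by move=> ht; apply: sub; rewrite /= in_itv.
pose U p := chart_dom e p /\ cabs (chart_map e p - w0) < r.
(* Connectedness argument: [S] is an interval ending at [b]; its infimum belongs to it because the
   smaller closed disk is closed in [M], and equals [a] because [U] is open. *)
pose S := [set t | a <= t <= b /\ forall t', t <= t' <= b -> U (s t')].
have Ub : U (s b).
  split=> //; rewrite -(ltr_pM2l c0); lra.
have Sb : S b.
  split; first by rewrite ab lexx.
  by move=> t' bt; have -> : t' = b by apply/le_anti; rewrite andbC.
have SU t : S t -> U (s t).
  by move=> [/andP[_ tb] h]; apply: h; rewrite lexx tb.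
(* Distance of the endpoint from the centre, plus the largest chart displacement that length [L]
   allows; the last hypothesis says that this is below [r]. *)
pose rho := cabs (chart_map e (s b) - w0) + L / c.
have rhor : rho < r.
  by rewrite -(ltr_pM2l c0) /rho mulrDr [c * (L / c)]mulrC divfK ?gt_eqF.
have Sbound t : S t -> c * cabs (chart_map e (s b) - chart_map e (s t)) <= L.
  move=> [/andP[at' tb] hS]; rewrite -lee_fin.
  have subt : `[t, b] `<=` I.
    by move=> t'; rewrite /= in_itv /= => /andP[h1 h2]; apply: It; rewrite h2 (le_trans at').
  have H := @arc_length_ge R M f sm im co mi e I s t b c ae oI cs subt tb (ltW c0) _ _.
  apply: (le_trans (H _ _)).
  - by move=> t' ht'; have [] := hS t' ht'.
  - move=> t' ht'; have [h1 h2] := hS t' ht'; have [_] := hw _ h2; exact.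
  - exact: le_trans (arc_length_mono sm im co mi oI cs sub at') hL.
have Srho t : S t -> cabs (chart_map e (s t) - w0) <= rho.
  move=> St; apply: (le_trans (cabsB_le _ (chart_map e (s b)) _)).
  rewrite cabsBC addrC /rho lerD2l ler_pdivlMr// mulrC; exact: Sbound.
have hS : has_inf S.
  by split; [exists b | exists a => t [/andP[]]].
have infa : a <= inf S by apply: lb_le_inf; [exists b | move=> t [/andP[]]].
have infb : inf S <= b by apply: ge_inf => //; case: hS.
have Sgt t : inf S < t <= b -> S t.
  move=> /andP[it tb]; have tp : 0 < t - inf S by rewrite subr_gt0.
  have [t1 [/andP[a1 b1] h1] t1t] := inf_adherent tp hS.
  have t1t' : t1 < t by move: t1t; rewrite addrC subrK.
  split; first by rewrite tb andbT; apply: le_trans infa (ltW it).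
  move=> t' /andP[tt' t'b]; apply: h1; rewrite t'b andbT.
  exact: ltW (lt_le_trans t1t' tt').
set m := inf S in infa infb Sgt.
have Sm : U (s m).
  have [mb|mb] := eqVneq m b; first by rewrite mb.
  have mltb : m < b by rewrite lt_neqAle mb.
  suff [] : chart_dom e (s m) /\ cabs (chart_map e (s m) - w0) <= rho.
    by move=> h1 h2; split => //; exact: le_lt_trans rhor.
  have Kc := @chart_disk_closed e w0 rho (fun w hw' => (hw w (le_lt_trans hw' rhor)).1).
  apply: contrapT => nK.
  have : \forall t \near m, ~ (chart_dom e (s t) /\ cabs (chart_map e (s t) - w0) <= rho).
    have nb : \forall p \near s m, ~ (chart_dom e p /\ cabs (chart_map e p - w0) <= rho).
      by apply: open_nbhs_nbhs; split => //; exact: closed_openC Kc.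
    have ms : {for m, continuous s} by apply: cs.1; apply: It; rewrite infa.
    exact: ms nb.
  move=> /nbhs_ballP [d /= d0 hd].
  have m0 : 0 < Num.min (d / 2) (b - m) by rewrite lt_min subr_gt0 mltb andbT divr_gt0.
  have m1 : Num.min (d / 2) (b - m) <= d / 2 by rewrite ge_min lexx.
  have m2 : Num.min (d / 2) (b - m) <= b - m by rewrite ge_min lexx orbT.
  have St : S (m + Num.min (d / 2) (b - m)) by apply: Sgt; apply/andP; split; lra.
  apply: (hd (m + Num.min (d / 2) (b - m))).
    by rewrite /ball /= opprD addrA subrr sub0r normrN gtr0_norm//; lra.
  by split; [have [] := SU _ St | exact: Srho].
have SSm : S m.
  split; first by rewrite infa infb.
  move=> t' /andP[]; rewrite le_eqVlt => /orP[/eqP <- //|mt' t'b].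
  by apply/SU/Sgt; rewrite mt' t'b.
have am : a = m.
  apply: contrapT => /eqP am; have {am} altm : a < m by rewrite lt_neqAle am.
  have ms : {for m, continuous s} by apply: cs.1; apply: It; rewrite infa.
  have [em rm] := Sm.
  have n1 : \forall t \near m, chart_dom e (s t) by exact: ms (dom_near em).
  have cm := chart_curve_continuous em ms.
  have rm0 : 0 < r - cabs (chart_map e (s m) - w0) by rewrite subr_gt0.
  have /continuous_cabsP /(_ _ rm0) n2 := cm.
  have /nbhs_ballP [d /= d0 hd] := near_and n1 n2.
  have m0 : 0 < Num.min (d / 2) (m - a) by rewrite lt_min subr_gt0 altm andbT divr_gt0.
  have m1 : Num.min (d / 2) (m - a) <= d / 2 by rewrite ge_min lexx.
  have m2 : Num.min (d / 2) (m - a) <= m - a by rewrite ge_min lexx orbT.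
  have : S (m - Num.min (d / 2) (m - a)).
    split; first by apply/andP; split; lra.
    move=> t' /andP[t1 t2]; have [tm|mt] := ltP t' m.
      have [|h1 h2] := hd t'; first by rewrite /ball /= gtr0_norm; lra.
      split => //; apply: (le_lt_trans (cabsB_le _ (chart_map e (s m)) _)).
      by move: h2; rewrite /=; lra.
    have [_] := SSm; apply; rewrite mt t2 //.
  move=> /(ge_inf hS.2); rewrite -/m; lra.
rewrite am; split; [by case: Sm|by case: Sm|exact: Sbound].
Qed.

Lemma pwC1_path_ge0 p q (l : \bar R) : pwC1_path f p q l -> (0 <= l)%E.
Proof.
elim=> // s a b I q' l' ab oI sub cs _ h; apply: adde_ge0 => //.
exact: arc_length_ge0.
Qed.

Lemma pwC1_path_cat p q p' (l l' : \bar R) : pwC1_path f p q l -> pwC1_path f q p' l' ->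
  pwC1_path f p p' (l + l')%E.
Proof.
move=> H; elim: H p' l' => [q' p' l' h|s a b I q' l1 ab oI sub cs _ IH p' l' h].
  by rewrite add0e.
by rewrite -addeA; apply: pwC1_cons ab oI sub cs (IH _ _ h).
Qed.

(** Induction along the chain with its last point fixed: the tail confines [s b], then [arc_stays]
    confines [s a], the budget [L] being shared between the two lengths. *)
Lemma path_stays e p q (l : \bar R) (c r L : R) (w0 : Cx R) : atlas e -> 0 < c ->
  (forall w, cabs (w - w0) < r -> cdom e w /\ c <= mlow e w) ->
  pwC1_path f p q l -> (l <= L%:E)%E -> chart_dom e q ->
  c * cabs (chart_map e q - w0) + L < c * r ->
  [/\ chart_dom e p, cabs (chart_map e p - w0) < r &
      c * cabs (chart_map e q - chart_map e p) <= L].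
Proof.
move=> ae c0 hw H; elim: H L => [q' L L0 eq hr|s a b I q' l' ab oI sub cs H IH L hl eq hr].
  have {}L0 : 0 <= L by rewrite -lee_fin.
  split=> //; first by rewrite -(ltr_pM2l c0); lra.
  by rewrite subrr cabs0 mulr0.
have a0 := arc_length_ge0 f s a b; have l0 := pwC1_path_ge0 H.
have fa : arc_length f s a b \is a fin_num.
  rewrite ge0_fin_numE//; apply: le_lt_trans (ltry L); apply: le_trans hl.
  by rewrite leeDl.
have fl : l' \is a fin_num.
  rewrite ge0_fin_numE//; apply: le_lt_trans (ltry L); apply: le_trans hl.
  by rewrite leeDr.
have hl' : fine (arc_length f s a b) + fine l' <= L.
  by rewrite -lee_fin EFinD !fineK.
have la : 0 <= fine (arc_length f s a b) by rewrite fine_ge0.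
have lq : 0 <= fine l' by rewrite fine_ge0.
have [|//||h1 h2 h3] := IH (fine l').
- by rewrite fineK.
- by lra.
have h4 := cabsB_le (chart_map e (s b)) (chart_map e q') w0.
rewrite cabsBC in h4; have h5 := ler_wpM2l (ltW c0) h4; rewrite cabsBC mulrDr [X in _ <= X + _]mulrC in h5.
have ha : (arc_length f s a b <= (fine (arc_length f s a b))%:E)%E by rewrite fineK.
have hb : c * cabs (chart_map e (s b) - w0) + fine (arc_length f s a b) < c * r.
  by move: h5; rewrite [_ * c]mulrC [cabs (_ - chart_map e q')]cabsBC; lra.
have [g1 g2 g3] := arc_stays ae oI cs sub ab c0 hw h1 ha hb.
split=> //.
have := cabsB_le (chart_map e q') (chart_map e (s b)) (chart_map e (s a)).
by move=> /(ler_wpM2l (ltW c0)); rewrite mulrDr; lra.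
Qed.

Lemma mlow_gt0 e w : atlas e -> cdom e w -> 0 < mlow e w.
Proof.
move=> ae ew; rewrite /mlow divr_gt0// lt_neqAle addr_ge0 ?cabs_ge0// andbT eq_sym.
apply/negP; rewrite paddr_eq0 ?cabs_ge0// !cabs_eq0 => /andP[/eqP A0 /eqP B0].
exact: (phAB_neq0 sm im co ae ew).
Qed.

(* The intrinsic distance controls the topology of the surface. *)
Lemma path_limit e p : atlas e -> chart_dom e p -> forall d : R, 0 < d ->
  exists2 L : R, 0 < L & forall q (l : \bar R), pwC1_path f q p l -> (l < L%:E)%E ->
    chart_dom e q /\ cabs (chart_map e q - chart_map e p) < d.
Proof.
move=> ae ep d d0; set w0 := chart_map e p.
have e0 : cdom e w0 by exact: cdom_map.
set c := mlow e w0 / 2.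
have c0 : 0 < c by rewrite divr_gt0// mlow_gt0.
have cm : {for w0, continuous (mlow e)}.
  have cA := continuous_cabs_comp (cderiv_continuous (phA_cderiv sm im co mi ae e0)).
  have cB := continuous_cabs_comp (cderiv_continuous (phB_cderiv sm im co mi ae e0)).
  apply: (@cvgM _ _ (nbhs w0)); last exact: cvg_cst.
  exact: (@cvgD _ R^o _ (nbhs w0) _ _ _ _ _ cA cB).
have nc : \forall w \near w0, c <= mlow e w by exact: near_ge_half (mlow_gt0 ae e0) cm.
have /nbhs_cabsP [r r0 hr] := near_and (cdom_near e0) nc.
pose r' := Num.min r d.
have r'0 : 0 < r' by rewrite lt_min r0.
exists (c * r' / 2); first by have := mulr_gt0 c0 r'0; lra.
move=> q l H hl.
have hw w : cabs (w - w0) < r' -> cdom e w /\ c <= mlow e w.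
  by rewrite lt_min => /andP[h _]; exact: hr.
have [|h1 h2 _] := path_stays ae c0 hw H (ltW hl) ep.
  by rewrite subrr cabs0 mulr0 add0r; have := mulr_gt0 c0 r'0; lra.
split => //; apply: (lt_le_trans h2); by rewrite ge_min lexx orbT.
Qed.

(** [curve_Cn] demands regularity in every chart of the atlas; the continuity of [dtrans] is what
    transfers it from [e]. *)
Lemma lift_curve_C1 e I (v v1 : R -> Cx R) : atlas e -> open I ->
  (forall t, I t -> vderiv v t (v1 t)) -> (forall t, I t -> {for t, continuous v1}) ->
  (forall t, I t -> cdom e (v t)) -> curve_Cn 1 I (chart_inv e \o v).
Proof.
move=> ae oI dv cv1 ev.
have cs t : I t -> {for t, continuous (chart_inv e \o v)}.
  move=> It; apply: (@continuous_comp _ _ _ v (chart_inv e)); first exact: vderiv_continuous (dv t It).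
  exact: chart_inv_continuous (ev t It).
split => // e2 ae2.
have ov t : (I `&` (chart_inv e \o v) @^-1` chart_dom e2) t -> overlap e e2 (v t).
  by move=> [It h]; apply/overlapP; split; [exact: ev | exact: h].
have oD : open (I `&` (chart_inv e \o v) @^-1` chart_dom e2).
  rewrite openE => t [It e2t].
  have nI : \forall r \near t, I r by exact: open_nbhs_nbhs.
  by apply: filterI nI (cs t It _ (dom_near e2t)).
pose D t := dtrans e e2 (v t) * v1 t.
have dD t : (I `&` (chart_inv e \o v) @^-1` chart_dom e2) t -> vderiv (trans e e2 \o v) t (D t).
  by move=> Dt; exact: vderiv_comp (dv t Dt.1) (trans_cderiv ae ae2 (ov t Dt)).
apply: (@Cn1_R _ _ _ (fun t => pair_of_Cx (D t)) oD).
  move=> t Dt; apply: (@is_derive_pair _ (coords e2 \o (chart_inv e \o v))).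
    exact: vderiv_Re (dD t Dt).
  exact: vderiv_Im (dD t Dt).
move=> t Dt; apply: (@continuous_comp _ _ _ D (@pair_of_Cx R)); last exact: pair_of_Cx_continuous.
apply: continuousM_Cx; last exact: cv1 t Dt.1.
apply: (@continuous_comp _ _ _ v (dtrans e e2)); first exact: vderiv_continuous (dv t Dt.1).
exact: (trans_continuous sm im co mi ae ae2 (ov t Dt)).
Qed.

Lemma lift_curve_speed e (v : R -> Cx R) t l : atlas e -> vderiv v t l -> cdom e (v t) ->
  enorm (derive1 (f \o (chart_inv e \o v)) t) =
    (cabs (phA f e (v t) * l) + cabs (phB f e (v t) * l)) / 2.
Proof.
move=> ae dv ev.
have cs : {for t, continuous (chart_inv e \o v)}.
  apply: (@continuous_comp _ _ _ v (chart_inv e)); first exact: vderiv_continuous dv.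
  exact: chart_inv_continuous ev.
have dv' : vderiv (chart_map e \o (chart_inv e \o v)) t l.
  have nr : \forall r \near t, cdom e (v r) by have cv := vderiv_continuous dv; exact: (cv _ (cdom_near ev)).
  by apply: vderiv_near dv _; apply: filterS nr => r er /=; rewrite chart_invK.
have [_ E] := deriv_f sm ae (chart_inv_dom ev) cs dv'.
by rewrite derive1E E /= chart_invK// fvel_norm.
Qed.

End Metric.

(** * Reversal of paths *)

Section Reversal.
Variables (R : realType) (M : riemannSurface R) (f : M -> 'rV[R]_3).
Hypotheses (sm : smooth_map f) (im : immersion f) (co : conformal f) (mi : minimal f).
Implicit Types (e : chart R M) (s : R -> M) (p q : M) (I : set R).

Lemma opp_continuous_at (t : R) : {for t, continuous (fun r : R => - r)}.
Proof. exact: (@cvgN R R^o _ (nbhs t) _ id _ cvg_id). Qed.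

Lemma vderiv_opp (u : R -> Cx R) (t : R) (l : Cx R) : vderiv u (- t) l ->
  vderiv (fun r => u (- r)) t (- l).
Proof.
move=> du d d0; have nt := opp_continuous_at (du d d0).
apply: (@filterS _ (nbhs t) _ _ _ _ nt) => r /=.
have -> : - r - - t = - (r - t) by ring.
by rewrite rcN mulrN mulNr normrN.
Qed.

Lemma curve_opp I s : open I -> curve_Cn 1 I s -> curve_Cn 1 [set t | I (- t)] (fun t => s (- t)).
Proof.
move=> oI cs.
have cs' t : I (- t) -> {for t, continuous (fun t => s (- t))}.
  by move=> It; apply: (@continuous_comp _ _ _ (fun r : R => - r) s t); [exact: opp_continuous_at | exact: cs.1].
split=> // e ae.
have oD : open ([set t | I (- t)] `&` (fun t => s (- t)) @^-1` chart_dom e).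
  rewrite openE => t [It et].
  have nI : \forall r \near - t, I r by exact: open_nbhs_nbhs.
  have n1 := opp_continuous_at nI; have n2 := cs' t It _ (dom_near et).
  exact: (@filterI _ (nbhs t) _ _ _ n1 n2).
have dD t : ([set t | I (- t)] `&` (fun t => s (- t)) @^-1` chart_dom e) t ->
    vderiv (fun r => chart_map e (s (- r))) t (- vel e s (- t)).
  by move=> [It et]; exact: vderiv_opp (C1_curve ae cs It et).1.
apply: (@Cn1_R _ _ _ (fun t => pair_of_Cx (- vel e s (- t))) oD).
  move=> t Dt; apply: (@is_derive_pair _ (coords e \o (fun t => s (- t)))).
    exact: vderiv_Re (dD t Dt).
  exact: vderiv_Im (dD t Dt).
move=> t [It et]; apply: (@continuous_comp _ _ _ (fun t => - vel e s (- t)) (@pair_of_Cx R)); last exact: pair_of_Cx_continuous.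
have cv : {for t, continuous (fun r => vel e s (- r))}.
  apply: (@continuous_comp _ _ _ (fun r : R => - r) (vel e s)); first exact: opp_continuous_at.
  exact: (C1_curve ae cs It et).2.
have -> : (fun t => - vel e s (- t)) = (fun t => (-1) * vel e s (- t)) by apply/funext => r; rewrite mulN1r.
exact: continuousZ_Cx cv.
Qed.

Lemma speed_opp I s t : curve_Cn 1 I s -> I (- t) ->
  enorm (derive1 (f \o (fun t => s (- t))) t) = enorm (derive1 (f \o s) (- t)).
Proof.
move=> cs It; have [e ae et] := atlas_cover (s (- t)).
have cst : {for t, continuous (fun t => s (- t))}.
  by apply: (@continuous_comp _ _ _ (fun r : R => - r) s t); [exact: opp_continuous_at | exact: cs.1].
have dv := (C1_curve ae cs It et).1.
have [_ E1] := deriv_f sm ae et (cs.1 _ It) dv.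
have [_ E2] := @deriv_f _ _ f sm e (fun t => s (- t)) t _ ae et cst (vderiv_opp dv).
rewrite !derive1E E1 E2 !(fvel_norm co _ ae)//; try exact: cdom_map.
by rewrite !mulrN !cabsN.
Qed.

Lemma arc_length_opp I s (a b : R) : open I -> curve_Cn 1 I s -> `[a, b] `<=` I -> a <= b ->
  arc_length f (fun t => s (- t)) (- b) (- a) = arc_length f s a b.
Proof.
move=> oI cs sub ab; rewrite /arc_length.
have It t : a <= t <= b -> I t by move=> ht; apply: sub; rewrite /= in_itv.
pose G t := enorm (derive1 (f \o s) (- t)).
transitivity (\int[lebesgue_measure]_(t in `[(- b)%R, (- a)%R]) (G t)%:E)%E.
  apply: eq_integral => t; rewrite inE /= in_itv /= => /andP[h1 h2].
  rewrite (speed_opp cs)//; apply: It; apply/andP; split; lra.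
rewrite (@integration_by_substitution_oppr R G a b ab); last first.
  apply: within_continuous => t /andP[h1 h2].
  apply: (@continuous_comp _ _ _ (fun r : R => - r) (fun r => enorm (derive1 (f \o s) r))).
    exact: opp_continuous_at.
  apply: (speed_continuous sm im co mi oI cs); apply: It; apply/andP; split; lra.
by apply: eq_integral => t _; rewrite /G /= opprK.
Qed.

(** Continuation produces paths forward in time only, whereas the Cauchy condition asks for
    distances in both orders. *)
Lemma pwC1_path_sym p q (l : \bar R) : pwC1_path f p q l -> pwC1_path f q p l.
Proof.
elim=> [q'|s a b I q' l' ab oI sub cs _ IH]; first exact: pwC1_nil.
have oI' : open [set t : R | I (- t)].
  rewrite openE => t It; have nI : \forall r \near - t, I r by exact: open_nbhs_nbhs.
  exact: (opp_continuous_at nI).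
have ab' : - b <= - a by rewrite lerN2.
have sub' : `[- b, - a] `<=` [set t : R | I (- t)].
  by move=> t /=; rewrite in_itv /= => /andP[h1 h2]; apply: sub; rewrite /= in_itv /=; apply/andP; split; lra.
have H := @pwC1_cons R M f (fun t => s (- t)) (- b) (- a) _ _ _ ab' oI' sub' (curve_opp oI cs) (pwC1_nil _ _).
rewrite (arc_length_opp oI cs sub ab) adde0 !opprK in H.
by rewrite addeC; exact: pwC1_path_cat IH H.
Qed.

End Reversal.

Lemma near_comp (T U : topologicalType) (g : T -> U) (x : T) (A : set U) :
  {for x, continuous g} -> (\forall y \near g x, A y) -> \forall y \near x, A (g y).
Proof. by move=> cg; exact: cg. Qed.

Lemma vderiv_eq (R : realType) (u : R -> Cx R) t (l m : Cx R) : vderiv u t l -> l = m -> vderiv u t m.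
Proof. by move=> h <-. Qed.

Lemma vderivN (R : realType) (u : R -> Cx R) t (l : Cx R) : vderiv u t l -> vderiv (fun s => - u s) t (- l).
Proof.
move=> h; have := vderivZ (-1) h; rewrite mulN1r => h'; apply: vderiv_near h' _.
by apply: (@nearW _ (nbhs t)) => s; rewrite mulN1r.
Qed.

(** * Continuation of the surface along complex time *)

Section Continuation.
Variables (R : realType) (M : riemannSurface R) (f : M -> 'rV[R]_3).
Hypotheses (sm : smooth_map f) (im : immersion f) (co : conformal f) (mi : minimal f).
Variables P P1 P2 Q Q1 Q2 : Cx R -> Cx R.
Hypotheses (dP : forall z, cderiv P z (P1 z)) (dP1 : forall z, cderiv P1 z (P2 z)).
Hypotheses (dQ : forall z, cderiv Q z (Q1 z)) (dQ1 : forall z, cderiv Q1 z (Q2 z)).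
Implicit Types (e : chart R M) (z w y : Cx R) (p q : M).

(* [zeta] is a holomorphic function near [p] that pulls [dP], [dQ] back to the
   differentials of x + iy, x - iy: the surface near [p] looks like the analytic
   continuation of the curve at the complex time [z]. *)
Definition germ e p z (zeta zeta1 : Cx R -> Cx R) :=
  zeta (chart_map e p) = z /\ \forall w \near chart_map e p,
    [/\ cderiv zeta w (zeta1 w), P1 (zeta w) * zeta1 w = phA f e w &
        Q1 (zeta w) * zeta1 w = phB f e w].

(** The chart is existentially quantified; [attached_chart] shows that any chart at [p] will do. *)
Definition attached z p := exists e zeta zeta1,
  [/\ atlas e, chart_dom e p & germ e p z zeta zeta1].

Lemma attached_chart z p e : attached z p -> atlas e -> chart_dom e p ->
  exists zeta zeta1, germ e p z zeta zeta1.
Proof.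
move=> [e2 [zeta [zeta1 [ae2 e2p [zp nz]]]]] ae ep.
have ov : overlap e e2 (chart_map e p).
  by apply/overlapP; split; [exact: cdom_map | rewrite chart_mapK].
exists (zeta \o trans e e2), (fun w => zeta1 (trans e e2 w) * dtrans e e2 w).
have Tp : trans e e2 (chart_map e p) = chart_map e2 p by rewrite /trans /= chart_mapK.
split; first by rewrite /= Tp.
have cT := cderiv_continuous (trans_cderiv ae ae2 ov).
pose N w := [/\ cderiv zeta w (zeta1 w), P1 (zeta w) * zeta1 w = phA f e2 w &
  Q1 (zeta w) * zeta1 w = phB f e2 w].
have nN : nbhs (trans e e2 (chart_map e p)) N by rewrite Tp; exact: nz.
have nT : \forall w \near chart_map e p, N (trans e e2 w) by exact: near_comp cT nN.
apply: filterS2 nT (overlap_near ov) => w [h1 h2 h3] ow; split.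
- exact: cderiv_comp (trans_cderiv ae ae2 ow) h1.
- by rewrite mulrA h2 /phA !(ph_trans sm _ ae ae2 ow); ring.
- by rewrite mulrA h3 /phB !(ph_trans sm _ ae ae2 ow); ring.
Qed.

(** A zero of [zeta1] would be a common zero of [phA] and [phB]. Hence complex time is a local
    coordinate of the surface at every attached point. *)
Lemma germ_neq0 e p z zeta zeta1 : atlas e -> chart_dom e p -> germ e p z zeta zeta1 ->
  zeta1 (chart_map e p) != 0.
Proof.
move=> ae ep [_ nz]; have [_ hA hB] := nbhs_singleton nz.
apply/eqP => z0; rewrite z0 !mulr0 in hA hB.
exact: (phAB_neq0 sm im co ae (cdom_map ep)).
Qed.

Lemma cderiv_zero_near (h : Cx R -> Cx R) w : (\forall y \near w, h y = 0) -> cderiv h w 0.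
Proof. by move=> h0; apply: cderiv_near (cderiv_cst 0 w) _; apply: filterS h0 => y ->. Qed.

Lemma vderiv0_cst (k : R -> Cx R) (t0 t d : R) : (forall s, `|s - t0| < d -> vderiv k s 0) ->
  `|t - t0| < d -> k t = k t0.
Proof.
move=> dk.
have aux a b : a <= b -> (forall s, a <= s <= b -> vderiv k s 0) -> k b = k a.
  move=> ab hk; have := @mean_value_vderiv R k (fun=> 0) a b 0 ab hk (fun s _ => _).
  rewrite mul0r => H; apply/eqP; rewrite -subr_eq0 -cabs_eq0 eq_le cabs_ge0 andbT H//.
  by rewrite cabs0.
rewrite ltr_norml => /andP[h1 h2]; have [tt|tt] := leP t0 t.
  apply: aux => // s /andP[s1 s2]; apply: dk; rewrite ltr_norml; apply/andP; split; lra.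
apply/esym/aux; first exact: ltW.
by move=> s /andP[s1 s2]; apply: dk; rewrite ltr_norml; apply/andP; split; lra.
Qed.

(** [G] inverts [Q] near [z0], and [FA], [FB] are primitives of [phA], [phB] near [w0]; candidates
    for [zeta] are then [G (c + FB w)]. The bound [d / 4] keeps [c + FB w] in the domain of [G] for
    all [c] within [d / 2] of [Q z0]. *)
Definition lift_data e (w0 z0 : Cx R) (G FA FB : Cx R -> Cx R) (d eta r : R) :=
  [/\ 0 < d, 0 < eta, 0 < r & FB w0 = 0] /\
  [/\ forall w, cabs (w - w0) < r ->
        [/\ cdom e w, cderiv FA w (phA f e w), cderiv FB w (phB f e w) & cabs (FB w) < d / 4],
      forall y, cabs (y - Q z0) < d ->
        [/\ Q (G y) = y, Q1 (G y) != 0 & cderiv G y (Q1 (G y))^-1] &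
      forall w, cabs (w - z0) < eta -> cabs (Q w - Q z0) < d -> G (Q w) = w].

Lemma lift_data_exists e w0 z0 : atlas e -> cdom e w0 -> Q1 z0 != 0 ->
  exists G FA FB d eta r, lift_data e w0 z0 G FA FB d eta r.
Proof.
move=> ae ew Qz0.
have [G [d [eta [d0 eta0 _ GP GQ]]]] :=
  inverse_function ltr01 (fun w _ => dQ w) (cderiv_continuous (dQ1 z0)) Qz0.
have /nbhs_cabsP [r0 r00 hr0] := cdom_near ew.
have [FA [_ dFA]] := primitive_ball r00 (fun w hw => phA_cderiv sm im co mi ae (hr0 w hw))
  (fun w hw => dphA_continuous sm ae (hr0 w hw)).
have [FB [FB0 dFB]] := primitive_ball r00 (fun w hw => phB_cderiv sm im co mi ae (hr0 w hw))
  (fun w hw => dphB_continuous sm ae (hr0 w hw)).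
have w0in : cabs (w0 - w0) < r0 by rewrite subrr cabs0.
have d4 : 0 < d / 4 by lra.
have /continuous_cabsP /(_ _ d4) /nbhs_cabsP [r1 r10 hr1] := cderiv_continuous (dFB w0 w0in).
exists G, FA, FB, d, eta, (Num.min r0 r1); split; first by split => //; rewrite lt_min r00.
split=> //.
  move=> w; rewrite lt_min => /andP[h1 h2]; split; [exact: hr0|exact: dFA|exact: dFB|].
  by have := hr1 w h2; rewrite FB0 subr0.
by move=> y /GP [_ h1 h2 h3].
Qed.

Lemma lift_deriv e w0 z0 G FA FB d eta r c : atlas e -> lift_data e w0 z0 G FA FB d eta r ->
  cabs (c - Q z0) < d / 2 -> forall w, cabs (w - w0) < r ->
  let Z w := G (c + FB w) in let Z1 w := (Q1 (Z w))^-1 * phB f e w in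
  [/\ Q (Z w) = c + FB w, Q1 (Z w) != 0, cderiv Z w (Z1 w) & exists l, cderiv Z1 w l].
Proof.
move=> ae [[d0 eta0 r0 FB0] [hr GP GQ]] hc w hw Z Z1.
have [ew dA dB FBw] := hr w hw.
have yd : cabs (c + FB w - Q z0) < d.
  have -> : c + FB w - Q z0 = (c - Q z0) + FB w by ring.
  by apply: (le_lt_trans (cabsD _ _)); lra.
have [h1 h2 h3] := GP _ yd.
have dZ : cderiv Z w (Z1 w).
  by apply: (@cderiv_comp R (fun w => c + FB w) G w (phB f e w)) h3; apply: cderiv_eq (cderivD (cderiv_cst c w) dB) _; rewrite add0r.
split=> //; eexists; apply: cderivM (phB_cderiv sm im co mi ae ew).
exact: (@cderivV _ (Q1 \o Z) w _ h2 (cderiv_comp dZ (dQ1 (Z w)))).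
Qed.

(* Two solutions of [Q(zeta) = FB + const] coincide near [q], and the identity
   theorem spreads the relation for [P] to a disk of fixed size. *)
Lemma lift_relation e w0 z0 G FA FB d eta r z q : atlas e -> lift_data e w0 z0 G FA FB d eta r ->
  attached z q -> chart_dom e q -> cabs (z - z0) < eta -> cabs (Q z - Q z0) < d / 4 ->
  cabs (chart_map e q - w0) < r / 4 ->
  forall w, cabs (w - w0) < r / 12 ->
  let y := Q z - FB (chart_map e q) + FB w in
  P1 (G y) * phB f e w = phA f e w * Q1 (G y).
Proof.
move=> ae LD az eq hz hQ hq w hw /=.
have [[d0 eta0 r0 FB0] [hr GP GQ]] := LD.
set wq := chart_map e q in hq *.
have wqr : cabs (wq - w0) < r by lra.
have [ewq _ _ FBq] := hr wq wqr.
set c := Q z - FB wq.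
have hc : cabs (c - Q z0) < d / 2.
  have -> : c - Q z0 = (Q z - Q z0) + - FB wq by rewrite /c; ring.
  by apply: (le_lt_trans (cabsD _ _)); rewrite cabsN; lra.
pose Z x := G (c + FB x); pose Z1 x := (Q1 (Z x))^-1 * phB f e x.
have LZ x : cabs (x - w0) < r -> [/\ Q (Z x) = c + FB x, Q1 (Z x) != 0, cderiv Z x (Z1 x) & exists l, cderiv Z1 x l].
  by move=> hx; exact: (lift_deriv ae LD hc hx).
have [zeta [zeta1 [zq nz]]] := attached_chart az ae eq.
have [cz _ _] := nbhs_singleton nz; have {}cz := cderiv_continuous cz; rewrite -/wq in zq nz cz.
have e1 : 0 < eta - cabs (z - z0) by rewrite subr_gt0.
have /continuous_cabsP /(_ _ e1) n1 := cz.
have r3 : 0 < r - cabs (wq - w0) by rewrite subr_gt0.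
have /nbhs_cabsP [rho rho0 hrho] := near_and (near_and nz n1) (near_cabs wq r3).
have inr x : cabs (x - wq) < r - cabs (wq - w0) -> cabs (x - w0) < r.
  by move=> hx; apply: (le_lt_trans (cabsB_le x wq w0)); lra.
have wqin : cabs (wq - wq) < rho by rewrite subrr cabs0.
(* Both sides have derivative [phB] and agree at [wq] by the choice of [c]. As [G] inverts [Q] near
   [z0], this identifies [zeta] with [Z]. *)
have Qz x : cabs (x - wq) < rho -> Q (zeta x) = c + FB x.
  move=> hx; have := @cderiv0_cst R (fun x => Q (zeta x) - FB x) wq wq x rho _ wqin hx.
  rewrite zq -/c => H; apply/eqP; rewrite -subr_eq; apply/eqP/H => y /hrho [[[h1 h2 h3] _] hy].
  have [_ _ h4 _] := hr y (inr y hy).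
  by apply: cderiv_eq (cderivB (cderiv_comp h1 (dQ (zeta y))) h4) _; rewrite h3 subrr.
have zZ x : cabs (x - wq) < rho -> zeta x = Z x.
  move=> hx; have [[_ h1] h2] := hrho x hx.
  rewrite /Z -Qz// GQ//.
    by apply: (le_lt_trans (cabsB_le _ z _)); rewrite zq in h1; lra.
  rewrite Qz//; have [_ _ _ FBx] := hr x (inr x h2).
  have -> : c + FB x - Q z0 = (c - Q z0) + FB x by ring.
  by apply: (le_lt_trans (cabsD _ _)); lra.
pose H x := P (Z x) - FA x - (P z - FA wq).
pose H1 x := P1 (Z x) * Z1 x - phA f e x.
have dH x : cabs (x - w0) < r -> cderiv H x (H1 x).
  move=> hx; have [_ _ h1 _] := LZ x hx; have [_ h2 _ _] := hr x hx.
  by apply: cderiv_eq (cderivB (cderivB (cderiv_comp h1 (dP (Z x))) h2) (cderiv_cst _ x)) _; rewrite subr0.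
have dH1 x : cabs (x - w0) < r -> exists l, cderiv H1 x l.
  move=> hx; have [_ _ h1 [l h2]] := LZ x hx; have [ex _ _ _] := hr x hx.
  eexists; exact: cderivB (cderivM (cderiv_comp h1 (dP1 (Z x))) h2) (phA_cderiv sm im co mi ae ex).
have H0 : \forall x \near wq, H x = 0.
  apply/nbhs_cabsP; exists rho; first exact: rho0.
  move=> x hx.
  have := @cderiv0_cst R (fun x => P (zeta x) - FA x) wq wq x rho _ wqin hx.
  rewrite zq /H -(zZ x hx) => E; apply/eqP; rewrite subr_eq0; apply/eqP/E => y /hrho [[[h1 h2 h3] _] hy].
  have [_ h4 _ _] := hr y (inr y hy).
  by apply: cderiv_eq (cderivB (cderiv_comp h1 (dP (zeta y))) h4) _; rewrite h2 subrr.
(* Radii around [wq], which is within [r / 4] of [w0]: [2 * r / 3 + r / 4 < r] keeps the larger ball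
   inside the domain of [H], and [r / 12 + r / 4 = r / 3] puts the disk of radius [r / 12] about
   [w0] inside the smaller one. *)
have r30 : 0 < r / 3 by lra.
have inr3 x : cabs (x - wq) < 2 * (r / 3) -> cabs (x - w0) < r.
  by move=> hx; apply: (le_lt_trans (cabsB_le x wq w0)); lra.
have HZ := @identity_ball R H H1 wq (r / 3) r30 (fun x hx => dH x (inr3 x hx)) (fun x hx => dH1 x (inr3 x hx)) H0.
have wr : cabs (w - w0) < r by lra.
have H1w : H1 w = 0.
  apply: (cderiv_unique (dH w wr)); apply: cderiv_zero_near.
  have r12 : 0 < r / 12 - cabs (w - w0) by lra.
  apply: filterS (near_cabs w r12) => x hx; apply: HZ.
  have := cabsB_le x w w0; have := cabsB_le x w0 wq; rewrite [cabs (w0 - wq)]cabsBC; lra.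
have [_ Qn _ _] := LZ w wr.
move/eqP: H1w; rewrite /H1 /Z1 subr_eq0 mulrCA -/(Z w) => /eqP <-.
by rewrite mulrAC mulVf// mul1r.
Qed.

Lemma continuous_neq0 (h : Cx R -> Cx R) y : {for y, continuous h} -> h y != 0 ->
  exists2 d : R, 0 < d & forall x, cabs (x - y) < d -> h x != 0.
Proof.
move=> /continuous_cabsP ch; rewrite -cabs_gt0 => h0.
have /nbhs_cabsP [d d0 hd] := ch _ h0; exists d => // x /hd hx.
by apply/eqP => x0; rewrite x0 sub0r cabsN ltxx in hx.
Qed.

(** [G (Q z0 + FB w)] satisfies the equation for [Q] by construction; the hypothesis is the equation
    for [P] with the denominator [Q1] cleared. *)
Lemma attached_of_relation e p z0 G FA FB d eta r (r' : R) : atlas e -> chart_dom e p ->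
  lift_data e (chart_map e p) z0 G FA FB d eta r -> 0 < r' -> r' <= r ->
  (forall w, cabs (w - chart_map e p) < r' ->
    P1 (G (Q z0 + FB w)) * phB f e w = phA f e w * Q1 (G (Q z0 + FB w))) ->
  attached z0 p.
Proof.
move=> ae ep LD r'0 r'r H; have [[d0 eta0 r0 FB0] [hr GP GQ]] := LD.
have hc : cabs (Q z0 - Q z0) < d / 2 by rewrite subrr cabs0; lra.
exists e, (fun w => G (Q z0 + FB w)), (fun w => (Q1 (G (Q z0 + FB w)))^-1 * phB f e w).
split=> //; split; first by rewrite FB0 addr0 GQ// subrr cabs0.
apply: filterS (near_cabs (chart_map e p) r'0) => w hw.
have [h1 h2 h3 _] := lift_deriv ae LD hc (lt_le_trans hw r'r).
split=> //; last by rewrite mulrA divff// mul1r.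
by rewrite mulrCA H// mulrCA mulVf// mulr1.
Qed.

(** [lift_relation] holds on a disk whose radius does not depend on the approximating point. If the
    limit relation failed at some [w] of that disk, [F] would be nonzero at all nearby arguments,
    including those where [lift_relation] makes it vanish. *)
Lemma attached_limit e p z0 : atlas e -> chart_dom e p -> Q1 z0 != 0 ->
  (forall d : R, 0 < d -> exists z q, [/\ attached z q, cabs (z - z0) < d, chart_dom e q &
     cabs (chart_map e q - chart_map e p) < d]) -> attached z0 p.
Proof.
move=> ae ep Qz0 Hlim; set w0 := chart_map e p in Hlim.
have [G [FA [FB [d [eta [r LD]]]]]] := lift_data_exists ae (cdom_map ep) Qz0.
have [[d0 eta0 r0 FB0] [hr GP GQ]] := LD; rewrite -/w0 in LD FB0 hr.
have r12 : 0 < r / 12 by lra.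
have r12' : r / 12 <= r by lra.
apply: (attached_of_relation ae ep LD r12 r12') => w hw.
pose F y := P1 (G y) * phB f e w - phA f e w * Q1 (G y).
have wr : cabs (w - w0) < r by rewrite -/w0 in hw; lra.
have [ew _ _ FBw] := hr w wr.
have yd : cabs (Q z0 + FB w - Q z0) < d by rewrite addrAC subrr add0r; lra.
have [_ _ dG] := GP _ yd.
apply/eqP; rewrite -subr_eq0 -/(F (Q z0 + FB w)); apply: contrapT => /negP Fn.
have cF : {for Q z0 + FB w, continuous F}.
  apply: (@cderiv_continuous _ F); apply: cderivB.
    exact: cderivM (cderiv_comp dG (dP1 _)) (cderiv_cst _ _).
  exact: cderivZ (cderiv_comp dG (dQ1 _)).
have [ep' ep'0 hep] := continuous_neq0 cF Fn.
pose m := Num.min (ep' / 2) (d / 4).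
have m0 : 0 < m by rewrite lt_min; apply/andP; split; lra.
have /continuous_cabsP /(_ _ m0) /nbhs_cabsP [d1 d10 hd1] := cderiv_continuous (dQ z0).
have w0r : cabs (w0 - w0) < r by rewrite subrr cabs0.
have [_ _ dFB _] := hr w0 w0r.
have /continuous_cabsP /(_ _ m0) /nbhs_cabsP [d2 d20 hd2] := cderiv_continuous dFB.
pose dd := Num.min (Num.min d1 d2) (Num.min eta (r / 4)).
have r40 : 0 < r / 4 by lra.
have dd0 : 0 < dd by rewrite !lt_min d10 d20 eta0 r40.
have [z [q [az]]] := Hlim dd dd0.
rewrite !lt_min => /andP[/andP[z1 _] /andP[z3 _]] eq /andP[/andP[_ q2] /andP[_ q4]].
have := hd1 z z1; rewrite lt_min => /andP[Qe Qd].
have := hd2 _ q2; rewrite FB0 subr0 lt_min => /andP[Be _].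
have := lift_relation ae LD az eq z3 Qd q4 hw.
move=> /= E; have := hep (Q z - FB (chart_map e q) + FB w).
rewrite /F E subrr eqxx => /(_ _)/negP; case => //.
have -> : Q z - FB (chart_map e q) + FB w - (Q z0 + FB w) = (Q z - Q z0) + - FB (chart_map e q) by ring.
by apply: (le_lt_trans (cabsD _ _)); rewrite cabsN; lra.
Qed.

(* Where [P1] vanishes, so does [phi_3], by [phi_3^2 = - A B]; hence [P1] would
   vanish to second order, as [A = P1(zeta) zeta1]. *)
Lemma attached_end z p : P1 z = 0 -> P2 z != 0 -> Q1 z != 0 -> ~ attached z p.
Proof.
move=> P1z P2z Q1z [e [zeta [zeta1 [ae ep G]]]].
have zn := germ_neq0 ae ep G; have [zp nz] := G.
set w0 := chart_map e p in zn zp nz.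
have ew : cdom e w0 by exact: cdom_map.
have [dz A0 B0] := nbhs_singleton nz; rewrite zp P1z mul0r in A0.
have p30 : ph f e 2%:R w0 = 0.
  have := phAB co ae ew; rewrite -A0 mul0r => /esym/eqP.
  by rewrite oppr_eq0 expf_eq0 => /eqP.
have d3 := ph_cderiv sm im co mi 2%:R ae ew.
have dB := phB_cderiv sm im co mi ae ew.
have dL := cderivM (cderivN (cderivX 2 d3)) (cderiv_comp dz (dQ1 (zeta w0))).
have dR := cderivM (cderiv_comp dz (dP1 (zeta w0))) (cderivX 2 dB).
(* Multiplying the null relation by [Q1 (zeta w)] eliminates [zeta1], whose differentiability is not
   part of [germ]. At [w0] the left side has derivative zero, the right side
   [P2 * zeta1 * phB ^ 2]. *)
have E : \forall w \near w0, (- ph f e 2%:R w ^+ 2) * (Q1 \o zeta) w = (P1 \o zeta) w * phB f e w ^+ 2.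
  apply: filterS2 nz (cdom_near ew) => w [_ hA hB] ew'.
  by rewrite -(phAB co ae ew') -{1}hA -hB /=; ring.
have := cderiv_unique (cderiv_near dL E) dR.
rewrite /= p30 zp P1z expr1 mulr0 oppr0 mul0r expr0n oppr0 mul0r addr0 mul0r addr0.
move=> /esym/eqP; rewrite mulf_eq0 expf_eq0 /= mulf_eq0 (negPf P2z) (negPf zn) /=.
by rewrite -B0 zp mulf_eq0 (negPf Q1z) (negPf zn).
Qed.

Lemma nbhs_RP (t : R) (A : set R) : nbhs t A ->
  exists2 d : R, 0 < d & forall s, `|s - t| < d -> A s.
Proof.
by move=> /nbhs_ballP [d /= d0 hd]; exists d => // s hs; apply: hd; rewrite /ball /= distrC.
Qed.

(* [P(zeta) - FA], read in the coordinate [zeta], is constant on a real segment,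
   hence constant. *)
Lemma attached_start e p (u u1 : R -> Cx R) (t1 : R) : atlas e -> chart_dom e p ->
  u t1 = chart_map e p -> Q1 (rc t1) != 0 ->
  (\forall t \near t1, [/\ vderiv u t (u1 t), phA f e (u t) * u1 t = P1 (rc t) &
     phB f e (u t) * u1 t = Q1 (rc t)]) -> attached (rc t1) p.
Proof.
move=> ae ep ut1 Qt1 nu; set w0 := chart_map e p in ut1; set z0 := rc t1 in Qt1 *.
have [G [FA [FB [d [eta [r LD]]]]]] := lift_data_exists ae (cdom_map ep) Qt1.
have [[d0 eta0 r0 FB0] [hr GP GQ]] := LD; rewrite -/w0 in LD FB0 hr.
have hc : cabs (Q z0 - Q z0) < d / 2 by rewrite subrr cabs0; lra.
pose Z w := G (Q z0 + FB w); pose Z1 w := (Q1 (Z w))^-1 * phB f e w.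
have LZ w : cabs (w - w0) < r ->
    [/\ Q (Z w) = Q z0 + FB w, Q1 (Z w) != 0, cderiv Z w (Z1 w) & exists l, cderiv Z1 w l].
  by move=> hw; exact: (lift_deriv ae LD hc hw).
have w0r : cabs (w0 - w0) < r by rewrite subrr cabs0.
have Zw0 : Z w0 = z0 by rewrite /Z FB0 addr0 GQ// subrr cabs0.
have [dut1 _ But1] := nbhs_singleton nu; rewrite ut1 in But1.
have Z1w0 : Z1 w0 != 0.
  have [_ h _ _] := LZ w0 w0r; rewrite /Z1 mulf_neq0 ?invr_eq0//.
  by apply: contraNneq Qt1 => B0; rewrite -/z0 -But1 B0 mul0r.
have cZ1 : {for w0, continuous Z1}.
  by have [_ _ _ [l h]] := LZ w0 w0r; exact: cderiv_continuous h.
(* [Z] is a local coordinate at [w0], since [phB] does not vanish there; its inverse [om] sends real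
   times to the curve [u]. *)
have [om [d' [e' [d'0 e'0 e'r omP omZ]]]] :=
  inverse_function r0 (fun w hw => let: And4 _ _ h _ := LZ w hw in h) cZ1 Z1w0.
rewrite Zw0 in omP omZ.
have crc : {for t1, continuous (@rc R)} by exact: vderiv_continuous (vderiv_rc t1).
have cu : {for t1, continuous u} by exact: vderiv_continuous dut1.
pose m := Num.min r e'; have m0 : 0 < m by rewrite lt_min r0.
pose m' := Num.min eta d'; have m'0 : 0 < m' by rewrite lt_min eta0.
have n1 : \forall t \near t1, cabs (u t - w0) < m.
  by have := near_comp cu (near_cabs (u t1) m0); rewrite ut1.
have n2 : \forall t \near t1, cabs (rc t - z0) < m' := near_comp crc (near_cabs z0 m'0).
have n3 : \forall t \near t1, cabs (Q (rc t) - Q z0) < d.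
  have /continuous_cabsP cQ := cderiv_continuous (dQ z0).
  exact: near_comp crc (cQ _ d0).
have [rho rho0 hrho] := nbhs_RP (near_and nu (near_and n1 (near_and n2 n3))).
have t1in : `|t1 - t1| < rho by rewrite subrr normr0.
have ur t : `|t - t1| < rho -> cabs (u t - w0) < r.
  by move=> /hrho [_ [h _]]; move: h; rewrite lt_min => /andP[].
have FBu t : `|t - t1| < rho -> Q (rc t) = Q z0 + FB (u t).
  move=> ht; have := @vderiv0_cst (fun t => Q (rc t) - FB (u t)) t1 t rho _ ht.
  rewrite ut1 FB0 subr0 => H; apply/eqP; rewrite -subr_eq; apply/eqP/H => s hs.
  have [[h1 _ h2] _] := hrho s hs; have [_ _ h3 _] := hr _ (ur s hs).
  apply: (@vderiv_eq _ _ _ (Q1 (rc s) * 1 + - (phB f e (u s) * u1 s))).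
    exact: vderivD (vderiv_comp (vderiv_rc s) (dQ _)) (vderivN (vderiv_comp h1 h3)).
  by rewrite h2 mulr1 subrr.
have FAu t : `|t - t1| < rho -> P (rc t) - FA (u t) = P z0 - FA w0.
  move=> ht; have := @vderiv0_cst (fun t => P (rc t) - FA (u t)) t1 t rho _ ht.
  rewrite ut1; apply => s hs.
  have [[h1 h2 _] _] := hrho s hs; have [_ h3 _ _] := hr _ (ur s hs).
  apply: (@vderiv_eq _ _ _ (P1 (rc s) * 1 + - (phA f e (u s) * u1 s))).
    exact: vderivD (vderiv_comp (vderiv_rc s) (dP _)) (vderivN (vderiv_comp h1 h3)).
  by rewrite h2 mulr1 subrr.
have Zu t : `|t - t1| < rho -> Z (u t) = rc t.
  move=> ht; have [_ [_ [h2 h3]]] := hrho t ht.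
  by move: h2; rewrite lt_min /Z -FBu// => /andP[h _]; rewrite GQ.
have omu t : `|t - t1| < rho -> om (rc t) = u t.
  move=> ht; have [_ [h1 [h2 h3]]] := hrho t ht; rewrite -Zu// omZ//.
    by move: h1; rewrite lt_min => /andP[].
  by rewrite Zu//; move: h2; rewrite lt_min => /andP[].
(* On real times [om (rc t) = u t], where [P (rc t)] and [FA (u t)] have the same derivative; so [H]
   vanishes on a real segment and [identity_segment] applies. *)
pose H y := P y - FA (om y) - (P z0 - FA w0).
pose H1 y := P1 y - phA f e (om y) * (Z1 (om y))^-1.
have omr y : cabs (y - z0) < d' -> cabs (om y - w0) < r.
  by move=> /omP [h _ _ _]; exact: lt_le_trans h e'r.
have dH y : cabs (y - z0) < d' -> cderiv H y (H1 y).
  move=> hy; have [_ _ _ h1] := omP y hy; have [_ h2 _ _] := hr _ (omr y hy).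
  by apply: cderiv_eq (cderivB (cderivB (dP y) (cderiv_comp h1 h2)) (cderiv_cst _ y)) _; rewrite subr0.
have dH1 y : cabs (y - z0) < d' -> exists l, cderiv H1 y l.
  move=> hy; have [_ _ h0 h1] := omP y hy; have [_ _ _ [l h2]] := LZ _ (omr y hy).
  have [ex _ _ _] := hr _ (omr y hy).
  eexists; apply: cderivB (dP1 y) (cderivM (cderiv_comp h1 (phA_cderiv sm im co mi ae ex)) _).
  exact: (@cderivV _ (Z1 \o om) y _ h0 (cderiv_comp h1 h2)).
pose r1 := Num.min (rho / 2) (d' / 2).
have r10 : 0 < r1 by rewrite lt_min; apply/andP; split; lra.
have r1d y : cabs (y - z0) < 2 * r1 -> cabs (y - z0) < d'.
  move=> hy; apply: (lt_le_trans hy).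
  have : r1 <= d' / 2 by rewrite ge_min lexx orbT.
  lra.
have H0 s : `|s - t1| <= r1 -> H (rc s) = 0.
  move=> hs; have ht : `|s - t1| < rho.
    apply: (le_lt_trans hs); have : r1 <= rho / 2 by rewrite ge_min lexx.
    lra.
  by rewrite /H omu// FAu// subrr.
have /nbhs_cabsP [d2 d20 hd2] := identity_segment r10 (fun y hy => dH y (r1d y hy))
  (fun y hy => dH1 y (r1d y hy)) H0.
pose d3 := Num.min d2 d'; have d30 : 0 < d3 by rewrite lt_min d20.
have [_ _ dZw0 _] := LZ w0 w0r.
have n4 : \forall w \near w0, cabs (Z w - z0) < d3.
  by have := near_comp (cderiv_continuous dZw0) (near_cabs (Z w0) d30); rewrite Zw0.
have /nbhs_cabsP [r2 r20 hr2] := n4.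
pose r3 := Num.min r2 e'; have r30 : 0 < r3 by rewrite lt_min r20.
have r3r : r3 <= r by apply: le_trans e'r; rewrite ge_min lexx orbT.
apply: (attached_of_relation ae ep LD r30 r3r) => w hw.
have wr := lt_le_trans hw r3r.
move: hw; rewrite lt_min => /andP[w2 we].
have := hr2 w w2; rewrite lt_min => /andP[Zd2 Zd'].
have H1Z : H1 (Z w) = 0.
  apply: (cderiv_unique (dH _ Zd')); apply: cderiv_zero_near.
  have dd : 0 < d2 - cabs (Z w - z0) by rewrite subr_gt0.
  apply: filterS (near_cabs (Z w) dd) => y hy; apply: hd2.
  by have := cabsB_le y (Z w) z0; lra.
have [_ Qn _ _] := LZ w wr.
have [_ _ Zn _] := omP _ Zd'; rewrite omZ// in Zn.
move/eqP: H1Z; rewrite /H1 subr_eq0 omZ// => /eqP E.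
rewrite -/(Z w) E /Z1 invfM invrK -mulrA; congr (_ * _).
have Bn : phB f e w != 0 by apply: contraNneq Zn => B0; rewrite /Z1 B0 mulr0.
by rewrite mulfVK.
Qed.

(** The local inverse of [zeta] lifts the time segment to the surface. Along the lift, [phA] and
    [phB] times the chart velocity are [P1 * v] and [Q1 * v], so the length bound depends on times
    only. The step size [dl], in contrast, depends on [p]; completeness has to make up for this. *)
Lemma attached_step z p (v : Cx R) : attached z p -> Q1 z != 0 ->
  exists2 dl : R, 0 < dl & forall tau K : R, 0 <= tau <= dl ->
    (forall t, 0 <= t <= tau ->
      (cabs (P1 (z + rc t * v) * v) + cabs (Q1 (z + rc t * v) * v)) / 2 <= K) ->
    exists q l, [/\ attached (z + rc tau * v) q, pwC1_path f p q l & (l <= (K * tau)%:E)%E].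
Proof.
move=> [e [zeta [zeta1 [ae ep G]]]] Qz.
have zn := germ_neq0 ae ep G; have [zp nz] := G; set w0 := chart_map e p in zn zp nz.
have [dz0 _ _] := nbhs_singleton nz.
have nQ : \forall w \near w0, Q1 (zeta w) != 0.
  have cQ := cderiv_continuous (dQ1 z).
  have [d d0 hd] := continuous_neq0 cQ Qz; rewrite -zp in hd.
  by apply: filterS (near_comp (cderiv_continuous dz0) (near_cabs (zeta w0) d0)) => w; exact: hd.
have /nbhs_cabsP [r r0 hr] := near_and nz (near_and nQ (cdom_near (cdom_map ep))).
have dzeta w : cabs (w - w0) < r -> cderiv zeta w (zeta1 w) by move=> /hr [[]].
(* [germ] does not include this; it follows from [zeta1 = phB / Q1 (zeta)] where [Q1 (zeta)] is
   nonzero. *)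
have czeta1 w : cabs (w - w0) < r -> {for w, continuous zeta1}.
  move=> hw; have [_ [h1 ew]] := hr w hw.
  have dd : 0 < r - cabs (w - w0) by rewrite subr_gt0.
  apply: (@continuous_near_eq _ _ _ (fun w => phB f e w * (Q1 (zeta w))^-1)).
    apply: filterS (near_cabs w dd) => y hy.
    have [|[_ _ <-] [Qn _]] := hr y; first by have := cabsB_le y w w0; lra.
    by rewrite mulrAC mulfV// mul1r.
  apply: continuousM_Cx; first exact: cderiv_continuous (phB_cderiv sm im co mi ae ew).
  apply: (@continuousV_Cx _ _ _ (fun w => Q1 (zeta w)) h1).
  exact: (cderiv_continuous (cderiv_comp (dzeta w hw) (dQ1 _))).
have w0r : cabs (w0 - w0) < r by rewrite subrr cabs0.
have [om [d [e' [d0 e'0 e'r omP omZ]]]] := inverse_function r0 dzeta (czeta1 w0 w0r) zn.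
rewrite zp in omP omZ.
pose line t := z + rc t * v.
pose I := [set t | cabs (line t - z) < d].
have cline t : {for t, continuous line} by exact: vderiv_continuous (vderiv_line z v t).
have oI : open I.
  rewrite openE => t It; have dd : 0 < d - cabs (line t - z) by rewrite subr_gt0.
  have n := near_comp (cline t) (near_cabs (line t) dd).
  by apply: (filterS _ n) => s hs; rewrite /I /=; have := cabsB_le (line s) (line t) z; lra.
have line0 : line 0 = z by rewrite /line rc0 mul0r addr0.
have I0 : I 0 by rewrite /I /= line0 subrr cabs0.
have nI : nbhs (0 : R) I by exact: open_nbhs_nbhs.
have [dl dl0 hdl] := nbhs_RP nI.
exists (dl / 2); first by lra.
move=> tau K /andP[tau0 taud] HK.
have It t : 0 <= t <= tau -> I t.
  by move=> /andP[h1 h2]; apply: hdl; rewrite subr0 ger0_norm//; lra.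
pose c t := om (line t); pose c1 t := (zeta1 (c t))^-1 * v.
have cr t : I t -> cabs (c t - w0) < r by move=> /omP [h _ _ _]; exact: lt_le_trans h e'r.
have dc t : I t -> vderiv c t (c1 t).
  by move=> /omP [_ _ _ h]; exact: vderiv_comp (vderiv_line z v t) h.
have cc1 t : I t -> {for t, continuous c1}.
  move=> t_I; have [_ _ h _] := omP _ t_I.
  apply: continuousM_Cx; last by move=> A /nbhs_singleton h'; apply: (@nearW _ (nbhs t)).
  apply: (@continuousV_Cx _ _ _ (fun t => zeta1 (c t)) h).
  apply: (@continuous_comp _ _ _ c zeta1); first exact: vderiv_continuous (dc t t_I).
  exact: czeta1 (cr t t_I).
have ec t : I t -> cdom e (c t) by move=> /cr /hr [_ [_ h]].
have C1 := lift_curve_C1 sm im co mi ae oI dc cc1 ec.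
pose s := chart_inv e \o c; rewrite -/s in C1.
have c0 : c 0 = w0 by rewrite /c line0 -zp omZ// ?zp subrr cabs0.
have s0 : s 0 = p by rewrite /s /= c0 /w0 chart_mapK.
have sub : `[0, tau] `<=` I by move=> t; rewrite /= in_itv /=; exact: It.
have Itau : I tau by apply: It; rewrite tau0 lexx.
exists (s tau), (arc_length f s 0 tau + 0)%E; split.
- have sd : chart_dom e (s tau) := chart_inv_dom (ec tau Itau).
  exists e, zeta, zeta1; split; [exact: ae | exact: sd |].
  have sc : chart_map e (s tau) = c tau by rewrite /s /= chart_invK//; exact: ec.
  have [_ h _ _] := omP _ Itau; split; rewrite sc; first exact: h.
  have dd : 0 < r - cabs (c tau - w0) by rewrite subr_gt0; exact: cr.
  apply: filterS (near_cabs (c tau) dd) => w hw.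
  by have [|h' _] := hr w; [have := cabsB_le w (c tau) w0; lra | exact: h'].
- by rewrite -[X in pwC1_path f X]s0; exact: pwC1_cons tau0 oI sub C1 (pwC1_nil _ _).
- rewrite adde0; have -> : K * tau = K * (tau - 0) by rewrite subr0.
  apply: (arc_length_le sm im co mi oI C1 sub tau0) => t ht.
  have t_I := It t ht; rewrite (lift_curve_speed sm co ae (dc t t_I) (ec t t_I)).
  have [_ zc zn' _] := omP _ t_I.
  have [[_ hA hB] _] := hr _ (cr t t_I).
  have E (a b : Cx R) : b != 0 -> a * b * (b^-1 * v) = a * v.
    by move=> b0; rewrite mulrA mulfK.
  by rewrite -hA -hB /c1 !E// /c zc; exact: HK.
Qed.

End Continuation.

(** * Continuation along a whole segment by completeness *)

Section CompleteContinuation.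
Variables (R : realType) (M : riemannSurface R) (f : M -> 'rV[R]_3).
Hypotheses (sm : smooth_map f) (im : immersion f) (co : conformal f) (mi : minimal f).
Hypothesis cf : complete_immersion f.
Variables P P1 P2 Q Q1 Q2 : Cx R -> Cx R.
Hypotheses (dP : forall z, cderiv P z (P1 z)) (dP1 : forall z, cderiv P1 z (P2 z)).
Hypotheses (dQ : forall z, cderiv Q z (Q1 z)) (dQ1 : forall z, cderiv Q1 z (Q2 z)).
Variables (z0 v : Cx R).

Let segment (tau : R) := z0 + rc tau * v.
Hypothesis Q1n : forall tau, 0 <= tau <= 1 -> Q1 (segment tau) != 0.

Lemma speed_bound : exists2 K, 0 <= K & forall tau, 0 <= tau <= 1 ->
  (cabs (P1 (segment tau) * v) + cabs (Q1 (segment tau) * v)) / 2 <= K.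
Proof.
have cs t : {for t, continuous (fun r => (cabs (P1 (segment r) * v) + cabs (Q1 (segment r) * v)) / 2)}.
  have dl := vderiv_line z0 v t.
  have cc : {for t, continuous (fun=> v : Cx R)}.
    by move=> A /nbhs_singleton h'; apply: (@nearW _ (nbhs t)).
  have cA := continuousM_Cx (vderiv_continuous (vderiv_comp dl (dP1 _))) cc.
  have cB := continuousM_Cx (vderiv_continuous (vderiv_comp dl (dQ1 _))) cc.
  exact: continuous_half_sum cA cB.
have [c cin Hc] := EVT_max ler01 (within_continuous (a := 0) (b := 1) (fun t _ => cs t)).
exists ((cabs (P1 (segment c) * v) + cabs (Q1 (segment c) * v)) / 2).
  by rewrite divr_ge0// addr_ge0// cabs_ge0.
by move=> tau htau; apply: Hc; rewrite in_itv.
Qed.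

(** The arbitrarily small excess [e] lets the bound pass to a limit point, which completeness
    provides only in the sense of the induced distance. *)
Definition short_path (K : R) (p q : M) := forall e : R, 0 < e ->
  exists2 l, pwC1_path f p q l & (l < (K + e)%:E)%E.

Lemma short_path_refl p : short_path 0 p p.
Proof. by move=> e e0; exists 0%E; [exact: pwC1_nil | rewrite add0r lte_fin]. Qed.

Lemma short_path_cat (K K' : R) p q p' : short_path K p q -> short_path K' q p' ->
  short_path (K + K') p p'.
Proof.
move=> h h' e e0; have e2 : 0 < e / 2 by lra.
have [l hl ll] := h _ e2; have [l' hl' ll'] := h' _ e2.
exists (l + l')%E; first exact: pwC1_path_cat hl hl'.
have -> : K + K' + e = (K + e / 2) + (K' + e / 2) by lra.
by rewrite EFinD; exact: lteD.
Qed.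

Lemma short_path_dist (K K' : R) p q : short_path K p q -> K < K' -> (induced_dist f p q < K'%:E)%E.
Proof.
move=> h KK; have e0 : 0 < K' - K by rewrite subr_gt0.
have [l hl ll] := h _ e0; apply: le_lt_trans (ereal_inf_lbound hl) _.
by rewrite addrC subrK in ll.
Qed.

Lemma short_path_sym (K : R) p q : short_path K p q -> short_path K q p.
Proof. by move=> h e /h [l hl ll]; exists l => //; exact: pwC1_path_sym hl. Qed.

Lemma short_path_le (K K' : R) p q : short_path K p q -> K <= K' -> short_path K' p q.
Proof.
move=> h KK e /h [l hl ll]; exists l => //; apply: (lt_le_trans ll).
by rewrite lee_fin lerD2r.
Qed.

Section Reach.
Variable K : R.
Hypothesis HK : forall tau, 0 <= tau <= 1 ->
  (cabs (P1 (segment tau) * v) + cabs (Q1 (segment tau) * v)) / 2 <= K.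

Definition state (x : R * M) := 0 <= x.1 <= 1 /\ attached f P1 Q1 (segment x.1) x.2.

(* [reach] orders the states as in Ekeland's principle: advancing in time costs
   at most [K] times as much in length, so a sequence that exhausts its horizon
   is Cauchy. *)
Definition reach (x y : R * M) :=
  [/\ x.1 <= y.1, state y & short_path (K * (y.1 - x.1)) x.2 y.2].

Lemma reach_refl x : state x -> reach x x.
Proof. by move=> sx; split=> //; rewrite subrr mulr0; exact: short_path_refl. Qed.

Lemma reach_trans x y z : reach x y -> reach y z -> reach x z.
Proof.
move=> [h1 h2 h3] [h4 h5 h6]; split=> //; first exact: le_trans h1 h4.
have -> : K * (z.1 - x.1) = K * (y.1 - x.1) + K * (z.1 - y.1) by ring.
exact: short_path_cat h3 h6.
Qed.

(** It depends on the point as well as on the time: continuations from different points attached at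
    one time are not compared. *)
Definition horizon (x : R * M) := sup [set s | exists q, reach x (s, q)].

Lemma horizon_ge x y : reach x y -> y.1 <= horizon x.
Proof.
case: y => s q rxy; apply: sup_upper_bound; last by exists q.
split; first by exists s, q.
by exists 1 => u [q' [_ [/andP[_ h] _] _]].
Qed.

Lemma horizon_le1 x : state x -> horizon x <= 1.
Proof.
move=> sx; apply: ge_sup; last by move=> u [q' [_ [/andP[_ h] _] _]].
by exists x.1, x.2; rewrite -surjective_pairing; exact: reach_refl.
Qed.

Lemma horizon_mono x y : reach x y -> horizon y <= horizon x.
Proof.
move=> rxy; have sy : state y by case: rxy.
apply: ge_sup; first by exists y.1, y.2; rewrite -surjective_pairing; exact: reach_refl.
by move=> s [q ryz]; apply: (@horizon_ge x (s, q)); exact: reach_trans rxy ryz.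
Qed.

Lemma reach_half x : state x -> exists2 y, reach x y & horizon x - y.1 <= (horizon x - x.1) / 2.
Proof.
move=> sx; have := horizon_ge (reach_refl sx); rewrite le_eqVlt => /orP[/eqP E|lt].
  by exists x; [exact: reach_refl | rewrite -E subrr mul0r].
have e0 : 0 < (horizon x - x.1) / 2 by lra.
have hs : has_sup [set s | exists q, reach x (s, q)].
  split; last by exists 1 => u [q' [_ [/andP[_ h] _] _]].
  by exists x.1, x.2; rewrite -surjective_pairing; exact: reach_refl.
have [s [q rxs]] := sup_adherent e0 hs; rewrite -/(horizon x) => hs'.
by exists (s, q) => //=; lra.
Qed.

Lemma reach_step x : state x -> x.1 < 1 -> exists2 y, reach x y & x.1 < y.1.
Proof.
move: x => [tau p] [/= ht ap] t1; have [t0 _] := andP ht.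
have [dl dl0 H] := attached_step sm im co mi dQ1 v ap (Q1n ht).
pose d := Num.min dl (1 - tau).
have d0 : 0 < d by rewrite lt_min dl0 subr_gt0.
have dle : d <= 1 - tau by rewrite ge_min lexx orbT.
have segD t : segment tau + rc t * v = segment (tau + t) by rewrite /segment rcD; ring.
have [|t /andP[h1 h2]|q [l [aq hp hl]]] := H d K.
- by rewrite ltW//= ge_min lexx.
- by rewrite segD; apply: HK; apply/andP; split; lra.
rewrite segD in aq; exists (tau + d, q) => /=; last by lra.
split=> /=; first by lra.
  by split => //=; apply/andP; split; lra.
move=> e e0; exists l => //; apply: (le_lt_trans hl).
by rewrite lte_fin [tau + d]addrC addrK ltrDl.
Qed.

Lemma maximal_sequence p : attached f P1 Q1 z0 p -> exists x : nat -> R * M,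
  [/\ forall n, state (x n), forall n m, (n <= m)%N -> reach (x n) (x m) &
      forall n, horizon (x n) - (x n).1 <= 1 * 2^-1 ^+ n].
Proof.
move=> ap.
have s0 : state (0, p) by split => /=; rewrite ?lexx ?ler01// /segment rc0 mul0r addr0.
have step (x : {x | state x}) : {y : {x | state x} | reach (sval x) (sval y) /\
    horizon (sval x) - (sval y).1 <= (horizon (sval x) - (sval x).1) / 2}.
  apply: cid; case: x => x sx /=; have [y rxy hy] := reach_half sx.
  by have sy : state y by [case: rxy]; exists (exist _ y sy).
have [X [X0 HX]] := dependent_choice step (exist _ (0, p) s0).
pose x n := sval (X n); have sx n : state (x n) by rewrite /x; case: (X n).
exists x; split; [exact: sx | move=> n m |].
  elim: m => [|m IH].
    rewrite leqn0 => /eqP n0; rewrite n0; exact: reach_refl (sx 0%N).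
  rewrite leq_eqVlt => /orP[/eqP nm|]; first by rewrite nm; exact: reach_refl (sx m.+1).
  by rewrite ltnS => /IH h; exact: reach_trans h (HX m).1.
elim=> [|n IH].
  by rewrite /x X0 /= subr0 expr0 mulr1; exact: horizon_le1.
have [h1 h2] := HX n; have h3 := horizon_mono h1.
rewrite -/(x n) -/(x n.+1) in h2 h3; rewrite exprSr mulrA.
lra.
Qed.

End Reach.

Lemma pow_half_small (e : R) : 0 < e -> exists N, 2^-1 ^+ N < e.
Proof.
move=> e0; apply: contrapT => H.
have : e <= 0.
  apply: (@le0_geometric R e 1 2^-1) => //; first by apply/andP; split; lra.
  by move=> n; rewrite mul1r leNgt; apply/negP => h; apply: H; exists n.
by rewrite leNgt e0.
Qed.

Lemma pow_half_le (N n : nat) : (N <= n)%N -> (2^-1 : R) ^+ n <= 2^-1 ^+ N.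
Proof.
move=> Nn; by apply: ler_wiXn2l => //; rewrite invf_le1// ler1n.
Qed.

(** The times of the maximal sequence increase to [t], and its points form a Cauchy sequence because
    length costs at most [K] per unit of time; the limit point is attached at [t]. If [t < 1], one
    more step from it would pass the horizons, which converge to [t]. *)
Lemma continuation p : attached f P1 Q1 z0 p -> exists q, attached f P1 Q1 (z0 + v) q.
Proof.
move=> ap; have [K K0 HK] := speed_bound.
have [x [sx rx hx]] := maximal_sequence K ap.
have tau_le n m : (n <= m)%N -> (x m).1 - (x n).1 <= 2^-1 ^+ n.
  by move=> nm; have := horizon_ge (rx n m nm); have := hx n; rewrite mul1r; lra.
have mono n m : (n <= m)%N -> (x n).1 <= (x m).1 by move=> /rx [].
pose T := [set s | exists n, s = (x n).1].
have hT : has_sup T.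
  split; first by exists (x 0%N).1, 0%N.
  by exists 1 => _ [n ->]; have [/andP[]] := sx n.
pose t := sup T.
have xt n : (x n).1 <= t by apply: sup_upper_bound hT _ _; exists n.
have tx n : t <= (x n).1 + 2^-1 ^+ n.
  apply: ge_sup; first by exists (x 0%N).1, 0%N.
  move=> _ [m ->]; have [nm|/ltnW mn] := leqP n m; first by have := tau_le n m nm; lra.
  have := mono m n mn; have : 0 <= (2^-1 : R) ^+ n by rewrite exprn_ge0// invr_ge0.
  lra.
have t01 : 0 <= t <= 1.
  have [/andP[h _] _] := sx 0%N; have := xt 0%N => h'.
  apply/andP; split; first exact: le_trans h h'.
  by apply: ge_sup; [exists (x 0%N).1, 0%N | move=> _ [n ->]; have [/andP[]] := sx n].
have sp n m : (n <= m)%N -> short_path (K * 2^-1 ^+ n) (x n).2 (x m).2.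
  move=> nm; have [_ _ h] := rx n m nm; apply: (short_path_le h).
  by apply: ler_wpM2l => //; exact: tau_le.
have Kpos : 0 < K + 1 by lra.
have small (e : R) : 0 < e -> exists N, forall n, (N <= n)%N -> K * 2^-1 ^+ n < e /\ 2^-1 ^+ n < e.
  move=> e0; have [|N HN] := @pow_half_small (e / (K + 1)); first by rewrite divr_gt0.
  exists N => n Nn; have h1 := pow_half_le Nn.
  rewrite ltr_pdivlMr// in HN.
  have g0 : 0 < (2^-1 : R) ^+ n by rewrite exprn_gt0// invr_gt0.
  have h2 : 2^-1 ^+ n * (K + 1) <= 2^-1 ^+ N * (K + 1) by rewrite ler_wpM2r// ltW.
  have h3 : 0 <= K * 2^-1 ^+ n by rewrite mulr_ge0// ltW.
  split; nra.
have [|q Hq] := cf (u := fun n => (x n).2).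
  move=> e e0; have [N HN] := small e e0; exists N => m n Nm Nn.
  have [mn|/ltnW nm] := leqP m n.
    by apply: short_path_dist (sp m n mn) _; have [] := HN m Nm.
  by apply: short_path_dist (short_path_sym (sp n m nm)) _; have [] := HN n Nn.
have aq : attached f P1 Q1 (segment t) q.
  have [e ae eq] := atlas_cover q.
  apply: (attached_limit sm im co mi dP dP1 dQ dQ1 ae eq (Q1n t01)) => d d0.
  have [L L0 HL] := path_limit sm im co mi ae eq d0.
  have [N1 HN1] := Hq L L0.
  have v0 : 0 < cabs v + 1 by have := cabs_ge0 v; lra.
  have [|N2 HN2] := small (d / (cabs v + 1)); first by rewrite divr_gt0.
  pose n := maxn N1 N2; exists (segment (x n).1), (x n).2.
  have [l hl ll] := ereal_inf_lt (HN1 n (leq_maxl _ _)).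
  have [h1 h2] := HL _ _ hl ll; have [_ an] := sx n; split; [exact: an | | exact: h1 | exact: h2].
  have -> : segment (x n).1 - segment t = rc ((x n).1 - t) * v by rewrite /segment rcB; ring.
  rewrite cabsM cabs_rc distrC ger0_norm ?subr_ge0//.
  have [_ h3] := HN2 n (leq_maxr _ _); rewrite ltr_pdivlMr// in h3.
  apply: le_lt_trans h3; apply: ler_pM; rewrite ?subr_ge0 ?cabs_ge0//; first by have := tx n; lra.
  lra.
have st : state (t, q) by [].
(* Go to a late [x m] first, then along a path of length below [e / 2] to [q]. *)
have rt n : reach K (x n) (t, q).
  split => //; move=> e e0; have e2 : 0 < e / 2 by lra.
  have [N HN] := Hq _ e2; pose m := maxn n N.
  have [_ _ hs] := rx n m (leq_maxl _ _).
  have [l hl ll] := hs _ e2.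
  have [l' hl' ll'] := ereal_inf_lt (HN m (leq_maxr _ _)).
  exists (l + l')%E; first exact: pwC1_path_cat hl hl'.
  apply: (@lt_le_trans _ _ ((K * ((x m).1 - (x n).1) + e / 2)%:E + (e / 2)%:E)%E).
    exact: lteD.
  rewrite -EFinD lee_fin /=.
  have : K * ((x m).1 - (x n).1) <= K * (t - (x n).1) by apply: ler_wpM2l => //; have := xt m; lra.
  lra.
suff t1 : t = 1 by exists q; move: aq; rewrite t1 /segment rc1 mul1r.
have [_ tle] := andP t01; apply/eqP; rewrite eq_le tle /= leNgt; apply/negP => tlt.
have [y ry /= ty] := reach_step HK st tlt.
suff : y.1 - t <= 0 by lra.
apply: (@le0_geometric R _ 1 2^-1) => //; first by apply/andP; split; lra.
by move=> n; have := horizon_ge (reach_trans (rt n) ry); have := hx n; have := xt n; lra.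
Qed.

End CompleteContinuation.

(** * Epitrochoids at complex times *)

Section Exponential.
Variable R : realType.
Implicit Types (z w : Cx R).

(** The entire function [exp (i z)], built from real functions so that its derivative can be checked
    by the Cauchy-Riemann criterion. *)
Definition expi z : Cx R := rc (expR (- Im z)) * (rc (cos (Re z)) + ci R * rc (sin (Re z))).

Lemma Re_expi z : Re (expi z) = expR (- Im z) * cos (Re z).
Proof. by rewrite /expi !ReImE; ring. Qed.

Lemma Im_expi z : Im (expi z) = expR (- Im z) * sin (Re z).
Proof. by rewrite /expi !ReImE; ring. Qed.

Lemma is_derive_exp_mul (c y : R) :
  is_derive y 1 (fun t : R => expR (- t) * c) (- (expR (- y) * c)).
Proof.
have h := is_derive1_comp (is_derive_expR (- y)) (is_deriveN (is_derive_id y (1 : R))).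
have H : is_derive y 1 (fun t : R => expR (- t) * c)
    (expR (- y) *: (0 : R) + c *: (expR (- y) * -1)) := is_deriveM h (is_derive_cst c y 1).
by apply: (is_derive_eq H); rewrite scaler0 add0r /GRing.scale /=; ring.
Qed.

Lemma is_derive_mul_l (g : R -> R) (c x l : R) : is_derive x 1 g l ->
  is_derive x 1 (fun t : R => c * g t) (c * l).
Proof. by move=> h; exact: (is_deriveZ c h). Qed.

Lemma is_derive_shift (g : R -> R) (c l : R) : is_derive c 1 g l ->
  is_derive (0 : R) 1 (fun s : R => g (s + c)) l.
Proof.
move=> dg; have ds : is_derive (0 : R) 1 (fun s : R => s + c) (1 + 0) :=
  is_deriveD (is_derive_id (0 : R) (1 : R)) (is_derive_cst c (0 : R) 1).
have dg0 : is_derive (0 + c) 1 g l by rewrite add0r.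
by have := @is_derive1_comp R g (fun s : R => s + c) 0 l (1 + 0) dg0 ds; rewrite addr0 mulr1.
Qed.

Lemma exp_mul_partials (g g1 : R -> R) (x : R * R) : (forall t : R, is_derive t 1 g (g1 t)) ->
  is_derive x (1, 0) (fun y => expR (- y.2) * g y.1) (expR (- x.2) * g1 x.1) /\
  is_derive x (0, 1) (fun y => expR (- y.2) * g y.1) (- (expR (- x.2) * g x.1)).
Proof.
move=> dg; split; apply: is_derive_line => /=.
  have E : (fun s : R => expR (- (s *: (1, 0) + x).2) * g (s *: (1, 0) + x).1) =
      (fun s : R => expR (- x.2) * g (s + x.1)).
    by apply/funext => s; rewrite /= /GRing.scale /= mulr0 add0r mulr1.
  by rewrite E; apply: is_derive_mul_l; exact: is_derive_shift.
have E : (fun s : R => expR (- (s *: (0, 1) + x).2) * g (s *: (0, 1) + x).1) =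
    (fun s : R => expR (- (s + x.2)) * g x.1).
  by apply/funext => s; rewrite /= /GRing.scale /= mulr0 add0r mulr1.
by rewrite E; exact: (is_derive_shift (is_derive_exp_mul (g x.1) x.2)).
Qed.

Lemma exp_mul_continuous (g : R -> R) (c : R) (x : R * R) : continuous g ->
  {for x, continuous (fun y : R * R => c * (expR (- y.2) * g y.1))}.
Proof.
move=> cg.
have c2 : {for x, continuous (fun y : R * R => expR (- y.2))}.
  apply: (@continuous_comp _ _ _ (fun y : R * R => y.2) (fun t : R => expR (- t))); first exact: cvg_snd.
  have h := is_derive1_comp (is_derive_expR (- x.2)) (is_deriveN (is_derive_id x.2 (1 : R))).
  exact: is_derive_continuous h.
have c1 : {for x, continuous (fun y : R * R => g y.1)}.
  by apply: (@continuous_comp _ _ _ (fun y : R * R => y.1) g); [exact: cvg_fst | exact: cg].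
have c3 := @cvgM _ _ (nbhs x) _ _ _ _ _ c2 c1.
by apply: (@cvgM _ _ (nbhs x)); [exact: cvg_cst | exact: c3].
Qed.

Lemma exp_mul_cgrad (g g1 : R -> R) z : (forall t : R, is_derive t 1 g (g1 t)) -> continuous g1 ->
  cgrad (fun w : Cx R => expR (- Im w) * g (Re w)) z
    (rc (expR (- Im z) * g1 (Re z)) + ci R * rc (expR (- Im z) * g (Re z))).
Proof.
move=> dg cg1; have cg : continuous g by move=> t; exact: is_derive_continuous (dg t).
have c1 := @exp_mul_continuous g1 1 (pair_of_Cx z) cg1.
have c2 := @exp_mul_continuous g (-1) (pair_of_Cx z) cg.
have E1 : (fun y : R * R => 1 * (expR (- y.2) * g1 y.1)) = (fun y => expR (- y.2) * g1 y.1).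
  by apply/funext => y; rewrite mul1r.
have E2 : (fun y : R * R => -1 * (expR (- y.2) * g y.1)) = (fun y => - (expR (- y.2) * g y.1)).
  by apply/funext => y; rewrite mulN1r.
rewrite E1 in c1; rewrite E2 in c2.
have := C1_cgrad openT I (fun y _ => (exp_mul_partials y dg).1) (fun y _ => (exp_mul_partials y dg).2) c1 c2.
rewrite pair_of_CxK => H; apply: (cgrad_eq H).
by rewrite /grad /= rcN mulrN opprK.
Qed.

Lemma expi_cderiv z : cderiv expi z (ci R * expi z).
Proof.
apply: cderivP.
  have E : (fun y => Re (expi y)) = (fun w : Cx R => expR (- Im w) * cos (Re w)).
    by apply/funext => y; exact: Re_expi.
  have cg : continuous (fun t : R => - sin t).
    move=> t; exact: is_derive_continuous (is_deriveN (is_derive_sin t)).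
  rewrite E; apply: (cgrad_eq (exp_mul_cgrad z (@is_derive_cos R) cg)).
  by rewrite /expi mulrN rcN !rcM; have := ci_sqr R; move: (ci R) (rc _) (rc _) (rc _) => i a b c ii; ring: ii.
have E : (fun y => Im (expi y)) = (fun w : Cx R => expR (- Im w) * sin (Re w)).
  by apply/funext => y; exact: Im_expi.
rewrite E; apply: (cgrad_eq (exp_mul_cgrad z (@is_derive_sin R) (@continuous_cos R))).
by rewrite /expi !rcM; have := ci_sqr R; move: (ci R) (rc _) (rc _) (rc _) => i a b c ii; ring: ii.
Qed.

Lemma expiD z w : expi (z + w) = expi z * expi w.
Proof.
apply: Cx_eq.
  by rewrite [RHS]ReM !Re_expi !Im_expi ReD ImD opprD expRD cosD; ring.
by rewrite [RHS]ImM !Re_expi !Im_expi ReD ImD opprD expRD sinD; ring.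
Qed.

Lemma expi0 : expi 0 = 1.
Proof. by apply: Cx_eq; rewrite ?Re_expi ?Im_expi /= oppr0 expR0 ?cos0 ?sin0 ?mulr0 ?mul1r. Qed.

Lemma expiNK z : expi (- z) * expi z = 1.
Proof. by rewrite -expiD addNr expi0. Qed.

Lemma expi_neq0 z : expi z != 0.
Proof. by apply/eqP => h; have := expiNK z; rewrite h mulr0 => /esym/eqP; rewrite oner_eq0. Qed.

Lemma expiX z n : expi z ^+ n = expi (n%:R * z).
Proof.
elim: n => [|n IH]; first by rewrite expr0 mul0r expi0.
by rewrite exprS IH -expiD; congr expi; rewrite -[n.+1]add1n natrD mulrDl mul1r.
Qed.

Lemma cabs_expi z : cabs (expi z) = expR (- Im z).
Proof.
by rewrite cabsE Re_expi Im_expi !exprMn -mulrDr cos2Dsin2 mulr1 sqrtr_sqr gtr0_norm// expR_gt0.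
Qed.

Lemma natr_rc n : (n%:R : Cx R) = rc n%:R.
Proof. by elim: n => [|n IH]; rewrite ?rc0// -addn1 !natrD IH rcD rc1. Qed.

Lemma expi_rc (t : R) : expi (rc t) = rc (cos t) + ci R * rc (sin t).
Proof. by rewrite /expi /= oppr0 expR0 mul1r. Qed.

End Exponential.

(** * The epitrochoid and its critical complex times *)

Section ComplexEpitrochoid.
Variables (R : realType) (r lam : R) (m : nat).
Hypotheses (r0 : 0 < r) (lam0 : 0 < lam) (lamr : lam <> r) (m0 : (0 < m)%N).
Implicit Types (z : Cx R) (t : R).

(** With [g] one of [exp (i z)] and [exp (- i z)], this is the common shape of [P], [Q] and their
    derivatives up to a constant factor; differentiating only multiplies [b] by [m.+1]. *)
Definition two_term (a b : R) (g : Cx R -> Cx R) z : Cx R := rc a * g z - rc b * g z ^+ m.+1.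

Lemma two_term_cderiv a b (c : Cx R) g z : cderiv g z (c * g z) ->
  cderiv (two_term a b g) z (c * two_term a (m.+1%:R * b) g z).
Proof.
move=> dg; apply: cderiv_eq (cderivB (cderivZ (rc a) dg) (cderivZ (rc b) (cderivX m.+1 dg))) _.
by rewrite /two_term rcM -natr_rc exprS /=; ring.
Qed.

Lemma expiN_cderiv z : cderiv (fun w => expi (- w)) z (- ci R * expi (- z)).
Proof.
by apply: cderiv_eq (cderiv_comp (cderivN (cderiv_id z)) (expi_cderiv (- z))) _; ring.
Qed.

(** [m] stands for [k + 1], so [n] is [(r_c + r_m) / r_m] and [a] is [r_c + r_m]. *)
Let n : R := m.+1%:R.
Let a := n * r.

(* [epi] and [epiJ] continue x + iy and x - iy to complex times; the suffixes 1
   and 2 mark derivatives. *)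
Definition epi z := two_term a lam (@expi R) z.
Definition epi1 z := ci R * two_term a (n * lam) (@expi R) z.
Definition epi2 z := ci R * (ci R * two_term a (n * (n * lam)) (@expi R) z).
Definition epiJ z := two_term a lam (fun w => expi (- w)) z.
Definition epiJ1 z := - ci R * two_term a (n * lam) (fun w => expi (- w)) z.
Definition epiJ2 z := - ci R * (- ci R * two_term a (n * (n * lam)) (fun w => expi (- w)) z).

Lemma epi_cderiv z : cderiv epi z (epi1 z).
Proof. exact: two_term_cderiv (expi_cderiv z). Qed.

Lemma epi1_cderiv z : cderiv epi1 z (epi2 z).
Proof. exact: cderivZ (two_term_cderiv _ _ (expi_cderiv z)). Qed.

Lemma epiJ_cderiv z : cderiv epiJ z (epiJ1 z).
Proof. exact: two_term_cderiv (expiN_cderiv z). Qed.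

Lemma epiJ1_cderiv z : cderiv epiJ1 z (epiJ2 z).
Proof. exact: cderivZ (two_term_cderiv _ _ (expiN_cderiv z)). Qed.

Lemma two_term_rc A B t : two_term A B (@expi R) (rc t) =
  rc (A * cos t - B * cos (n * t)) + ci R * rc (A * sin t - B * sin (n * t)).
Proof. by rewrite /two_term expiX natr_rc -/n -rcM !expi_rc !rcB !rcM; ring. Qed.

Lemma two_term_opp_rc A B t : two_term A B (fun w => expi (- w)) (rc t) =
  rc (A * cos t - B * cos (n * t)) - ci R * rc (A * sin t - B * sin (n * t)).
Proof.
by rewrite /two_term expiX natr_rc -/n -rcN -rcM mulrN !expi_rc !cosN !sinN !rcB !rcN !rcM; ring.
Qed.

Lemma epiJ1_rc t : epiJ1 (rc t) = rc (Re (epi1 (rc t))) - ci R * rc (Im (epi1 (rc t))).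
Proof.
rewrite /epiJ1 /epi1 two_term_opp_rc two_term_rc; apply: Cx_eq; rewrite !ReImE; ring.
Qed.

(* The velocity of x + iy vanishes at [i shift], that of x - iy only on the
   line [Im z = - shift]. *)
Definition shift : R := ln (lam / r) / m%:R.

Let mR0 : (0 : R) < m%:R. Proof. by rewrite ltr0n. Qed.

Lemma shift_mul : m%:R * shift = ln (lam / r).
Proof. by rewrite /shift mulrC divfK// lt0r_neq0. Qed.

Lemma expR_shift : expR (m%:R * shift) = lam / r.
Proof. by rewrite shift_mul lnK// posrE divr_gt0. Qed.

Lemma shift_neq0 : shift != 0.
Proof.
apply/eqP => s0; apply: lamr; have := expR_shift; rewrite s0 mulr0 expR0 => /esym q1.
by rewrite -[lam](divfK (lt0r_neq0 r0)) q1 mul1r.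
Qed.

Let n0 : 0 < n. Proof. by rewrite ltr0n. Qed.

(** As [a = n * r], dividing by [n * lam * g z] leaves this equation; its modulus determines
    [Im z]. *)
Lemma two_term_eq0 (g : Cx R -> Cx R) z : g z != 0 -> two_term a (n * lam) g z = 0 ->
  g z ^+ m = rc (r / lam).
Proof.
move=> gn /eqP; rewrite /two_term subr_eq0 => /eqP E.
have nl : rc (n * lam) != 0.
  by apply/eqP => /rc_inj /eqP; rewrite mulf_eq0 !gt_eqF.
apply: (mulfI nl); apply: (mulIf gn); rewrite -mulrA -exprSr -E.
by rewrite -rcM; congr (rc _ * _); rewrite /a; field; rewrite gt_eqF.
Qed.

Lemma epi1_shift : epi1 (ci R * rc shift) = 0.
Proof.
have E : expi (ci R * rc shift) ^+ m = rc (r / lam).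
  rewrite expiX /expi !ReImE natr_rc !Im_rc !Re_rc.
  have -> : m%:R * (0 * shift - 1 * 0) - 0 * (0 * 0 + 1 * shift) = 0 :> R by ring.
  have -> : - (m%:R * (0 * 0 + 1 * shift) + 0 * (0 * shift - 1 * 0)) = - (m%:R * shift) :> R by ring.
  rewrite cos0 sin0 rc0 rc1 mulr0 addr0 mulr1 expRN expR_shift; congr rc.
  by rewrite invf_div.
rewrite /epi1 /two_term exprS E; apply/eqP; rewrite mulf_eq0 (negPf (ci_neq0 R)) /=.
rewrite [rc (n * lam) * _]mulrCA -rcM; have -> : n * lam * (r / lam) = a by rewrite /a; field; rewrite gt_eqF.
by rewrite mulrC subrr.
Qed.

(** A common zero of [epi1] and [epi2] would force [a = n * a], although [n = m + 1 > 1]. *)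
Lemma epi2_shift : epi2 (ci R * rc shift) != 0.
Proof.
have := epi1_shift; rewrite /epi1 => /eqP; rewrite mulf_eq0 (negPf (ci_neq0 R)) /= => /eqP E.
have en := expi_neq0 (ci R * rc shift).
rewrite /epi2 !mulf_neq0 ?ci_neq0//; apply/eqP => E2.
have := two_term_eq0 en E => Em.
move/eqP: E2; rewrite /two_term exprSr Em mulrA -rcM -mulrBl mulf_eq0 (negPf en) orbF -rcB.
move=> /eqP /rc_inj /eqP; have -> : a - n * (n * lam) * (r / lam) = - (n * (r * (n - 1))).
  by rewrite /a; field; rewrite gt_eqF.
rewrite oppr_eq0 !mulf_eq0 !gt_eqF//= /n -addn1 natrD addrK.
exact: mR0.
Qed.

Lemma epiJ1_neq0 z : Im z != - shift -> epiJ1 z != 0.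
Proof.
move=> iz; rewrite /epiJ1 mulf_neq0 ?oppr_eq0 ?ci_neq0//; apply/eqP => E.
have := two_term_eq0 (g := fun w => expi (- w)) (expi_neq0 _) E => Em.
have := congr1 (@cabs R) Em; rewrite cabsX cabs_expi ImN opprK cabs_rc.
rewrite gtr0_norm ?divr_gt0// -expRM_natl -invf_div -expR_shift -expRN => /expR_inj.
rewrite -mulrN => /(mulfI (lt0r_neq0 mR0)) iz'.
by rewrite iz' eqxx in iz.
Qed.

(* A time at which the curve is farthest from the centre of the fixed circle. *)
Definition outer_time : R := pi / m%:R.

(** On real times [epiJ1] is the conjugate velocity, so this is [x' y'' - y' x''], the numerator of
    the signed curvature. At [outer_time] the [m]-th power of [expi] is [-1]: the two terms of the
    velocity, and those of the acceleration, add up for every [lam]. *)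
Lemma curvature_outer : 0 < Im (epiJ1 (rc outer_time) * epi2 (rc outer_time)).
Proof.
set w := rc outer_time.
have wm : m%:R * w = rc pi.
  by rewrite natr_rc -rcM /outer_time mulrC divfK// lt0r_neq0.
have E1 : expi w ^+ m = -1.
  by rewrite expiX wm expi_rc cospi sinpi rc0 mulr0 addr0 rcN rc1.
have E2 : expi (- w) ^+ m = -1.
  by rewrite expiX mulrN wm -rcN expi_rc cosN sinN cospi sinpi oppr0 rc0 mulr0 addr0 rcN rc1.
have -> : epiJ1 w * epi2 w = ci R * rc ((a + n * lam) * (a + n * (n * lam))).
  rewrite /epiJ1 /epi2 /two_term !exprS E1 E2 [rc ((a + _) * _)]rcM !rcD.
  have := expiNK w; have := ci_sqr R; move: (expi w) (expi (- w)) (ci R) (rc a) (rc (n * lam)) (rc (n * (n * lam))).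
  by move=> x y i b c d ii xy; ring: ii xy.
rewrite !ReImE; have : 0 < (a + n * lam) * (a + n * (n * lam)).
  by rewrite mulr_gt0// addr_gt0// ?mulr_gt0.
lra.
Qed.

End ComplexEpitrochoid.

(** * Planar geodesics *)

Section PlanarGeodesic.
Variable R : realType.

Definition planar (P : Cx R -> Cx R) (t : R) : 'rV[R]_3 :=
  \row_(j < 3) [:: Re (P (rc t)); Im (P (rc t)); 0]`_j.

Lemma planarE P t : [/\ planar P t 0 0 = Re (P (rc t)), planar P t 0 1 = Im (P (rc t)) &
  planar P t 0 2%:R = 0].
Proof. by split; rewrite mxE. Qed.

Lemma ord3P (j : 'I_3) : [\/ j = 0, j = 1 | j = 2%:R].
Proof.
by case: j => [[|[|[|//]]]] ij; [constructor 1|constructor 2|constructor 3]; apply: val_inj.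
Qed.

Lemma derive1_planar (P P1 : Cx R -> Cx R) t : (forall z, cderiv P z (P1 z)) ->
  derive1 (planar P) t = planar P1 t.
Proof.
move=> dP; have dv : vderiv (fun s => P (rc s)) t (P1 (rc t)).
  apply: (@vderiv_eq _ _ _ (P1 (rc t) * 1)); last by rewrite mulr1.
  exact: vderiv_comp (vderiv_rc t) (dP _).
have H j : is_derive t 1 (fun s : R => planar P s 0 j) (planar P1 t 0 j).
  have [E0 E1 E2] := planarE P1 t.
  have [->|->|->] := ord3P j; rewrite ?E0 ?E1 ?E2.
  - have -> : (fun s : R => planar P s 0 0) = (fun s : R => Re (P (rc s))).
      by apply/funext => s; rewrite mxE.
    exact: vderiv_Re dv.
  - have -> : (fun s : R => planar P s 0 1) = (fun s : R => Im (P (rc s))).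
      by apply/funext => s; rewrite mxE.
    exact: vderiv_Im dv.
  - have -> : (fun s : R => planar P s 0 2%:R) = cst 0.
      by apply/funext => s; rewrite mxE.
    exact: is_derive_cst.
have df : derivable (planar P) t 1.
  by apply/derivable_mxP => i j; rewrite (ord1 i); have [dfj _] := H j.
rewrite derive1E derive_mx//; apply/rowP => j; rewrite mxE.
by have [_ <-] := H j.
Qed.

(** With [Re a2 = 0], the imaginary part of the null relation makes [(Im a0, Im a1)] orthogonal to
    the velocity [(Re a0, Re a1)], and the last hypothesis then makes it orthogonal to the
    acceleration [(p2, q2)]. Nonzero curvature means that these two span the plane. *)
Lemma isotropic_planar (a0 a1 a2 : Cx R) (p2 q2 mu : R) :
  a0 ^+ 2 + a1 ^+ 2 + a2 ^+ 2 = 0 -> Re a2 = 0 -> Re a0 * q2 - Re a1 * p2 != 0 ->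
  (p2 - mu * Re a0) * Im a0 + (q2 - mu * Re a1) * Im a1 = 0 -> Im a0 = 0 /\ Im a1 = 0.
Proof.
move=> N0 r2 dn N; have := congr1 (@complex.Im R) N0; rewrite !expr2 !ReImE r2 /= => I0.
have o1 : Re a0 * Im a0 + Re a1 * Im a1 = 0 by lra.
have o2 : p2 * Im a0 + q2 * Im a1 = 0.
  have -> : p2 * Im a0 + q2 * Im a1 = (p2 - mu * Re a0) * Im a0 + (q2 - mu * Re a1) * Im a1 +
    mu * (Re a0 * Im a0 + Re a1 * Im a1) by ring.
  by rewrite N o1 mulr0 addr0.
split; apply: (mulfI dn); rewrite mulr0.
  have -> : (Re a0 * q2 - Re a1 * p2) * Im a0 = q2 * (Re a0 * Im a0 + Re a1 * Im a1) -
    Re a1 * (p2 * Im a0 + q2 * Im a1) by ring.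
  by rewrite o1 o2 !mulr0 subrr.
have -> : (Re a0 * q2 - Re a1 * p2) * Im a1 = Re a0 * (p2 * Im a0 + q2 * Im a1) -
    p2 * (Re a0 * Im a0 + Re a1 * Im a1) by ring.
by rewrite o1 o2 !mulr0 subrr.
Qed.

Variables (M : riemannSurface R) (f : M -> 'rV[R]_3) (gamma : R -> M).
Hypotheses (sm : smooth_map f) (im : immersion f) (co : conformal f) (mi : minimal f).
Hypotheses (sg : smooth_curve gamma) (geo : geodesic_up_to_reparam f gamma).
Variables P P1 P2 Q Q1 Q2 : Cx R -> Cx R.
Hypotheses (dP : forall z, cderiv P z (P1 z)) (dP1 : forall z, cderiv P1 z (P2 z)).
Hypotheses (dQ : forall z, cderiv Q z (Q1 z)) (dQ1 : forall z, cderiv Q1 z (Q2 z)).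
Hypothesis fg : f \o gamma = planar P.
Hypothesis QP : forall t, Q1 (rc t) = rc (Re (P1 (rc t))) - ci R * rc (Im (P1 (rc t))).

(** The geodesic condition makes the acceleration, less a multiple of the velocity, orthogonal to
    the conormal; so the horizontal part of the conormal vanishes, [ph f e 0 w * l] and
    [ph f e 1 w * l] are real, and they are the components of the velocity. *)
Lemma geodesic_velocity e t : atlas e -> chart_dom e (gamma t) ->
  Im (Q1 (rc t) * P2 (rc t)) != 0 ->
  phA f e (chart_map e (gamma t)) * vel e gamma t = P1 (rc t) /\
  phB f e (chart_map e (gamma t)) * vel e gamma t = Q1 (rc t).
Proof.
move=> ae et curv; have cg : curve_Cn 1 [set: R] gamma := sg 1.
have [dv _] := C1_curve ae cg I et.
set w := chart_map e (gamma t); set l := vel e gamma t in dv *.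
have [_ fv] := deriv_f sm ae et (cg.1 t I) dv; rewrite fg -derive1E (derive1_planar t dP) -/w in fv.
have [c0 c1 c2] := planarE P1 t; rewrite fv !mxE in c0 c1 c2.
have [mu [_ ort]] := geo t.
have d2 : derive1n 2 (f \o gamma) t = planar P2 t.
  rewrite /derive1n /= fg.
  have -> : derive1 (planar P) = planar P1 by apply/funext => s; exact: derive1_planar.
  exact: derive1_planar.
have d1 : derive1 (f \o gamma) t = planar P1 t by rewrite fg; exact: derive1_planar.
rewrite d2 d1 in ort.
have N := ph_null co ae (cdom_map et); rewrite -/w in N.
have Nl : (ph f e 0 w * l) ^+ 2 + (ph f e 1 w * l) ^+ 2 + (ph f e 2%:R w * l) ^+ 2 = 0.
  by rewrite !exprMn -!mulrDl N mul0r.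
have [a0 a1] : Im (ph f e 0 w * l) = 0 /\ Im (ph f e 1 w * l) = 0.
  apply: (isotropic_planar (mu := mu) (p2 := Re (P2 (rc t))) (q2 := Im (P2 (rc t))) Nl c2).
    rewrite c0 c1; move: curv; rewrite QP !ReImE; apply: contraNneq => h.
    by apply/eqP; rewrite -[RHS]h; ring.
  (* The conormal is the image of the direction [i l]; its entries are [- Im (ph f e j w * l)]. *)
  have tp : tangent_plane f (gamma t)
      ('D_(pair_of_Cx (ci R * l)) (in_chart f e) (coords e (gamma t))).
    by exists e, (pair_of_Cx (ci R * l)).
  have := ort _ tp; rewrite dotE.
  have ent j : ('D_(pair_of_Cx (ci R * l)) (in_chart f e) (coords e (gamma t))) 0 j = - Im (ph f e j w * l).
    by rewrite (derive_ph sm j _ ae et) pair_of_CxK mulrCA ReM Re_ci Im_ci mul0r mul1r sub0r.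
  have dd j : (planar P2 t - mu *: planar P1 t) 0 j = planar P2 t 0 j - mu * planar P1 t 0 j.
    have H (x y : 'rV[R]_3) : (x - mu *: y) 0 j = x 0 j - mu * y 0 j by rewrite !mxE.
    exact: H.
  have [x0 x1 x2] := planarE P1 t; have [y0 y1 y2] := planarE P2 t.
  rewrite c0 c1 !ent !dd x0 x1 x2 y0 y1 y2 mulr0 subrr mul0r addr0 => h.
  by rewrite -[RHS]oppr0 -h; ring.
have b0 : ph f e 0 w * l = rc (Re (P1 (rc t))) by rewrite -c0 [LHS]CxE a0 rc0 mulr0 addr0.
have b1 : ph f e 1 w * l = rc (Im (P1 (rc t))) by rewrite -c1 [LHS]CxE a1 rc0 mulr0 addr0.
split; last by rewrite QP -b0 -b1 /phB; ring.
by rewrite [RHS]CxE -b0 -b1 /phA; ring.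
Qed.

Lemma geodesic_attached t1 : 0 < Im (Q1 (rc t1) * P2 (rc t1)) ->
  {for rc t1, continuous P2} -> Q1 (rc t1) != 0 ->
  attached f P1 Q1 (rc t1) (gamma t1).
Proof.
move=> curv cP2 Qn; have [e ae et] := atlas_cover (gamma t1).
have cg : curve_Cn 1 [set: R] gamma := sg 1.
have cgt := cg.1 t1 I.
apply: (attached_start sm im co mi dP dP1 dQ dQ1 (u := chart_map e \o gamma) (u1 := vel e gamma) ae et (erefl _) Qn).
have n1 : \forall t \near t1, chart_dom e (gamma t) := near_comp cgt (dom_near et).
have crc : {for t1, continuous (@rc R)} := vderiv_continuous (vderiv_rc t1).
have cI : {for rc t1, continuous (fun z => Im (Q1 z * P2 z))}.
  have cm := continuousM_Cx (cderiv_continuous (dQ1 (rc t1))) cP2.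
  exact: (@continuous_comp _ _ _ (fun z => Q1 z * P2 z) (fun z => Im z) _ cm (@Im_continuous R _)).
have n2 : \forall z \near rc t1, Im (Q1 (rc t1) * P2 (rc t1)) / 2 <= Im (Q1 z * P2 z).
  exact: (@near_ge_half R _ (rc t1) (fun z => Im (Q1 z * P2 z)) curv cI).
apply: filterS2 n1 (near_comp crc n2) => t ett h.
have cn : Im (Q1 (rc t) * P2 (rc t)) != 0 by apply: lt0r_neq0; lra.
have [dv _] := C1_curve ae cg I ett.
by have [hA hB] := geodesic_velocity ae ett cn.
Qed.

End PlanarGeodesic.

Lemma epitrochoid_planar (R : realType) (r lam : R) (m : nat) : 0 < r ->
  epitrochoid (m%:R * r) r lam = planar (epi r lam m).
Proof.
move=> r0; apply/funext => t; apply/rowP => j; rewrite !mxE /epi two_term_rc !ReImE.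
have -> : m%:R * r + r = m.+1%:R * r by rewrite -addn1 natrD; ring.
rewrite mulfK ?gt_eqF//; congr ([:: _; _; _]`_j); ring.
Qed.

Lemma no_complete_extension (R : realType) (r lam : R) (m : nat) (M : riemannSurface R)
    (f : M -> 'rV[R]_3) (gamma : R -> M) :
  0 < r -> 0 < lam -> lam <> r -> (0 < m)%N ->
  smooth_map f -> immersion f -> conformal f -> minimal f -> complete_immersion f ->
  smooth_curve gamma -> geodesic_up_to_reparam f gamma ->
  f \o gamma <> epitrochoid (m%:R * r) r lam.
Proof.
move=> r0 lam0 lamr m0 sm im co mi cf sg geo; rewrite epitrochoid_planar// => fg.
set t1 := outer_time R m; set z1 := ci R * rc (shift r lam m).
have d0 := epi_cderiv r lam m; have d1 := epi1_cderiv r lam m.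
have dJ0 := epiJ_cderiv r lam m; have dJ1 := epiJ1_cderiv r lam m.
have sn0 := shift_neq0 r0 lam0 lamr m0.
(* The imaginary part on the segment is [tau * shift]; it would equal [- shift] only if
   [(tau + 1) * shift = 0]. *)
have Jn tau : 0 <= tau <= 1 -> epiJ1 r lam m (rc t1 + rc tau * (z1 - rc t1)) != 0.
  move=> /andP[h0 _]; apply: (epiJ1_neq0 r0 lam0 m0).
  rewrite -addr_eq0 /z1 !ReImE.
  have -> : 0 + (tau * (0 * 0 + 1 * shift r lam m + - 0) + 0 * (0 * shift r lam m - 1 * 0 + - t1)) + shift r lam m
    = (tau + 1) * shift r lam m by ring.
  by rewrite mulf_neq0// gt_eqF//; lra.
have J1n : epiJ1 r lam m (rc t1) != 0.
  by have := Jn 0; rewrite lexx ler01 rc0 mul0r addr0; exact.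
have cP2 : {for rc t1, continuous (epi2 r lam m)}.
  have h := two_term_cderiv m (m.+1%:R * r) (m.+1%:R * (m.+1%:R * lam)) (expi_cderiv (rc t1)).
  exact: cderiv_continuous (cderivZ (ci R) (cderivZ (ci R) h)).
have st := geodesic_attached sm im co mi sg geo d0 d1 dJ0 dJ1 fg (epiJ1_rc r lam m)
  (curvature_outer r0 lam0 m0) cP2 J1n.
have [q aq] := continuation sm im co mi cf d0 d1 dJ0 dJ1 Jn st.
rewrite addrC subrK in aq.
have Jz1 : epiJ1 r lam m z1 != 0.
  have <- : rc t1 + rc 1 * (z1 - rc t1) = z1 by rewrite rc1 mul1r addrC subrK.
  by apply: Jn; rewrite lexx ler01.
exact: (attached_end sm im co mi d1 dJ1 (epi1_shift r0 lam0 m0) (epi2_shift r0 lam0 m0) Jz1 aq).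
Qed.

Theorem mainTheorem1 (R : realType) (rc rm lambda : R) (k : nat)
    (rc_gt0 : 0 < rc) (k_ge1 : (1 <= k)%N) (rmE : rm = rc / (k + 1)%:R)
    (lambda_gt0 : 0 < lambda) (lambda_neq_rm : lambda <> rm) :
  ~ exists (M : riemannSurface R) (f : M -> 'rV[R]_3) (gamma : R -> M),
      [/\ smooth_map f, immersion f, conformal f & minimal f] /\
      complete_immersion f /\
      smooth_curve gamma /\
      f \o gamma = epitrochoid rc rm lambda /\
      geodesic_up_to_reparam f gamma.
Proof.
move=> [M [f [gamma [[sm im co mi] [cf [sg [fg geo]]]]]]].
have k0 : (0 : R) < (k + 1)%:R by rewrite ltr0n addn1.
have rm0 : 0 < rm by rewrite rmE divr_gt0.
have rcE : rc = (k + 1)%:R * rm by rewrite rmE mulrC divfK// gt_eqF.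
rewrite rcE in fg.
have k1 : (0 < k + 1)%N by rewrite addn1.
exact: (no_complete_extension rm0 lambda_gt0 lambda_neq_rm k1 sm im co mi cf sg geo fg).
Qed.
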